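(* Let $k\ge1$ be an integer and $r>0$. Assume that the families $\mathcal{Q}^*_n$, $n\ge1$, of admissible noise distributions satisfy $\mathcal{Q}^*_n\subset\mathcal{P}^*_n$ and $Q_0\in\mathcal{Q}^*_n$. Then $$\lim_{n\to\infty}\,n^{2k/(2k+1)}\,\frac{1}{R^*_{k,n}}\,\inf_{\widetilde S_n\in\Pi_n}\ \sup_{S\in W^k_r}\mathcal{R}^*_n(\widetilde S_n,S)=1 .$$
   Context: **Model.** For each integer $n\ge1$ one observes $(y_t)_{0\le t\le n}$ with $dy_t=S(t)\,dt+d\xi_t$, where $S:\mathbb{R}\to\mathbb{R}$ is an unknown 1-periodic function, $S\in L_2[0,1]$, and $\xi$ is a semimartingale noise with càdlàg (Skorohod space) paths and distribution $Q$. Write $\|f\|^2=\int_0^1 f^2(x)\,dx$, $\mathbf{E}_Q$ for expectation under $Q$, and $\mathbf{E}_{Q,S}$ for expectation when the noise has distribution $Q$ and the regression function is $S$. $[x]$ denotes the integer part of $x$. **Noise classes.** Let $(\sigma^*_n)_{n\ge1}$ be positive constants with $0<\liminf_n\sigma^*_n\le\limsup_n\sigma^*_n<\infty$. Regard $Q$ as the law of a semimartingale $(\xi_t)_{t\ge0}$ for which the integrals $I_m(f)=\int_0^m f_s\,d\xi_s$, $f\in L_2[0,m]$, are well defined. $\mathcal{P}_n$ is the class of all such $Q$ with $\mathbf{E}_Q I_n(f)=0$ and $\mathbf{E}_Q I_n^2(f)\le\sigma^*_n\int_0^n f_s^2\,ds$ for all $f\in L_2[0,n]$. $Q_0$ is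 the law of $\xi_t=\sqrt{\sigma^*_n}\,w_t$, with $w$ a standard Brownian motion. Let $(\phi_j)_{j\ge1}$ be the trigonometric basis: $\phi_1=1$ and, for $j\ge2$, $\phi_j(x)=\sqrt2\cos(2\pi[j/2]x)$ for $j$ even, $\phi_j(x)=\sqrt2\sin(2\pi[j/2]x)$ for $j$ odd. Put $\xi_{j,m}=m^{-1/2}I_m(\phi_j)$, $\sigma(Q)=\limsup_{m\to\infty}\max_{1\le j\le m}\mathbf{E}_Q\xi_{j,m}^2$, $\widetilde\xi_{j,n}=\xi_{j,n}^2-\mathbf{E}_Q\xi_{j,n}^2$, $$\mathbf{L}_{1,n}(Q)=\sup_{x\in[-1,1]^\infty,\ \#(x)\le n}\Big|\sum_{j\ge1}x_j\big(\mathbf{E}_Q\xi_{j,n}^2-\sigma(Q)\big)\Big|,\qquad \mathbf{L}_{2,n}(Q)=\sup_{|x|\le1,\ \#(x)\le n}\mathbf{E}_Q\Big(\sum_{j\ge1}x_j\widetilde\xi_{j,n}\Big)^2,$$ where $|x|^2=\sum_j x_j^2$ and $\#(x)$ is the number of nonzero coordinates of $x$. Let $(l_n)$ be a positive sequence with $l_n\to\infty$ increasing and $l_n/n^\delta\to0$ for every $\delta>0$. Put $\mathcal{P}^*_n=\{Q\in\mathcal{P}_n:\mathbf{L}_{1,n}(Q)+\mathbf{L}_{2,n}(Q)\le l_n\}$. **Robust risk.** $\mathcal{R}^*_n(\widetilde S,S)=\sup_{Q\in\mathcal{Q}^*_n}\mathbf{E}_{Q,S}\|\widetilde S-S\|^2$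 for an estimator $\widetilde S$. $\Pi_n$ is the set of all estimators $\widetilde S_n$ of $S$ measurable with respect to $\sigma\{y_t,\,0\le t\le n\}$. **Function class.** $W^k_r$ is the set of $k$ times continuously differentiable $f:[0,1]\to\mathbb{R}$ with $f^{(i)}(0)=f^{(i)}(1)$ for $0\le i\le k$ and $\sum_{j=0}^k\|f^{(j)}\|^2\le r$ (extended 1-periodically to $\mathbb{R}$). **Normalizing constant.** $$R^*_{k,n}=\big((2k+1)r\big)^{1/(2k+1)}\Big(\frac{\sigma^*_n k}{(k+1)\pi}\Big)^{2k/(2k+1)}.$$ *)

(* Defs.v *)
From HB Require Import structures.
From mathcomp Require Import all_boot all_order all_algebra.
From mathcomp Require Import all_classical all_reals all_analysis.

Set Implicit Arguments.
Unset Strict Implicit.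
Unset Printing Implicit Defensive.

Import Order.TTheory GRing.Theory Num.Theory.
Import numFieldNormedType.Exports.

Local Open Scope classical_set_scope.
Local Open Scope ring_scope.

(* Paths are total functions on R of which only the restriction to [0, +oo[
   matters: both cadlag and the sigma-algebras below ignore negative times. *)
Definition cadlag (R : realType) (f : R -> R) : Prop :=
  (forall t, 0 <= t -> f @ t^'+ --> f t) /\
  (forall t, 0 < t -> cvg (f @ t^'-)).

Lemma cadlag0 (R : realType) : cadlag (fun=> 0 : R).
Proof.
split=> t _; first exact: cvg_cst.
by apply/cvg_ex; exists 0; exact: cvg_cst.
Qed.

Record cadlag_path (R : realType) := CadlagPath {
  path_fun :> R -> R;
  path_cadlag : cadlag path_fun }.

HB.instance Definition _ (R : realType) := gen_eqMixin (cadlag_path R).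
HB.instance Definition _ (R : realType) := gen_choiceMixin (cadlag_path R).
HB.instance Definition _ (R : realType) :=
  isPointed.Build (cadlag_path R) (CadlagPath (@cadlag0 R)).

(* The events {X_t in B}, for t in the set of times J and B Borel. *)
Definition cylinders (R : realType) (T : Type) (X : R -> T -> R) (J : set R) :
    set (set T) :=
  [set A | exists (t : R) (B : set R), [/\ J t, measurable B & A = X t @^-1` B]].

Definition coord (R : realType) (t : R) (w : cadlag_path R) : R := w t.

(* D[0, +oo[; the Borel sigma-algebra of the Skorohod topology is the one
   generated by the coordinates. *)
Definition skorohod (R : realType) :=
  g_sigma_algebraType (cylinders (@coord R) `[0, +oo[).

Section semimartingales.
Context (R : realType) (d : measure_display) (T : measurableType d).
Implicit Types (P : probability T R) (F : R -> set (set T))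
  (X M A H : R -> T -> R).

Definition filtration F : Prop :=
  [/\ forall t, 0 <= t -> sigma_algebra setT (F t),
      forall t, 0 <= t -> F t `<=` measurable,
      forall s t, 0 <= s -> s <= t -> F s `<=` F t
    & forall t, 0 <= t -> F t = \bigcap_(s in `]t, +oo[) F s].

Definition adapted F X : Prop :=
  forall t, 0 <= t -> forall B : set R, measurable B -> F t (X t @^-1` B).

Definition martingale P F M : Prop :=
  [/\ adapted F M,
      forall t, 0 <= t -> P.-integrable setT (EFin \o M t)
    & forall s t, 0 <= s -> s <= t -> forall E, F s E ->
        (\int[P]_(w in E) (M t w)%:E = \int[P]_(w in E) (M s w)%:E)%E].

Definition stopping_time F (tau : T -> \bar R) : Prop :=
  (forall w, 0 <= tau w)%E /\
  (forall t, 0 <= t -> F t [set w | (tau w <= t%:E)%E]).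

Definition stopped M (tau : T -> \bar R) : R -> T -> R :=
  fun t w => M (fine (mine t%:E (tau w))) w.

Definition local_martingale P F M : Prop :=
  [/\ adapted F M,
      {ae P, forall w, cadlag (M ^~ w)}
    & exists tau : nat -> T -> \bar R,
        [/\ forall k, stopping_time F (tau k),
            {ae P, forall w, nondecreasing_seq (tau ^~ w)},
            {ae P, forall w, tau k w @[k --> \oo] --> +oo%E}
          & forall k, martingale P F (stopped M (tau k))]].

Definition finite_variation_process P F A : Prop :=
  [/\ adapted F A,
      {ae P, forall w, cadlag (A ^~ w)}
    & {ae P, forall w, forall t, 0 <= t -> bounded_variation 0 t (A ^~ w)}].

Definition semimartingale P F X : Prop :=
  [/\ filtration F, adapted F X, {ae P, forall w, cadlag (X ^~ w)}
    & exists M A,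
        [/\ local_martingale P F M,
            finite_variation_process P F A,
            {ae P, forall w, M 0 w = 0 /\ A 0 w = 0}
          & {ae P, forall w, forall t, 0 <= t -> X t w = X 0 w + M t w + A t w}]].

Definition cvg_in_probability P (Y : nat -> T -> R) (Z : T -> R) : Prop :=
  forall e : R, 0 < e -> P [set w | e <= `|Y k w - Z w|] @[k --> \oo] --> 0%E.

Definition predictable_rectangles F (m : nat) : set (set (T * R)) :=
  [set E | exists s t C, [/\ 0 <= s, s <= t, t <= m%:R, F s C
    & E = C `*` [set u | s < u <= t]] ].

(* Predictable processes on ]0, m]. *)
Definition predictable F (m : nat) H : Prop :=
  forall B : set R, measurable B ->
    <<s setT `*` `]0, m%:R], predictable_rectangles F m >>
      [set p : T * R | p.2 \in `]0, m%:R] /\ B (H p.2 p.1)].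

(* L_2[0, m]; every Lebesgue class has such a Borel representative. *)
Definition L2 (m : nat) (f : R -> R) : Prop :=
  measurable_fun (`[0, m%:R] : set R) f /\
  (\int[lebesgue_measure]_(s in (`[0%R, m%:R] : set R)) ((f s) ^+ 2)%:E < +oo)%E.

Definition dominated (m : nat) H (g : R -> R) : Prop :=
  forall s w, s \in `]0, m%:R] -> `|H s w| <= g s.

(* [stochastic_integral P F X m I] says that I is H |-> \int_0^m H_s dX_s on the
   predictable processes H dominated by some function of L_2[0, m].  As usual,
   the stochastic integral is the (almost surely unique) linear extension of
   the elementary integral that satisfies dominated convergence in probability.
   For a semimartingale X such an I exists iff every function of L_2[0, m] is
   X-integrable on ]0, m] (iff, for each g in L_2[0, m], the integrals of the
   bounded predictable H with |H| <= g are bounded in probability). *)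
Definition stochastic_integral P F X (m : nat)
    (I : (R -> T -> R) -> T -> R) : Prop :=
  let dom H := predictable F m H /\ (exists2 g, L2 m g & dominated m H g) in
  [/\ forall H, dom H -> measurable_fun setT (I H),
      forall s t C, 0 <= s -> s <= t -> t <= m%:R -> F s C ->
        {ae P, forall w, I (fun u w' => \1_C w' * \1_(`]s, t]) u) w
                         = \1_C w * (X t w - X s w)},
      forall (a : R) H K, dom H -> dom K ->
        {ae P, forall w, I (fun u w' => a * H u w' + K u w') w
                         = a * I H w + I K w}
    & forall (g : R -> R) (Hk : nat -> R -> T -> R) H,
        L2 m g ->
        (forall k, predictable F m (Hk k) /\ dominated m (Hk k) g) ->
        (forall s w, s \in `]0, m%:R] -> Hk k s w @[k --> \oo] --> H s w) ->
        cvg_in_probability P (fun k => I (Hk k)) (I H)].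

Definition standard_brownian P (W : R -> T -> R) : Prop :=
  [/\ forall t, 0 <= t -> measurable_fun setT (W t),
      {ae P, forall w, W 0 w = 0},
      {ae P, forall w, {within `[0, +oo[, continuous (W ^~ w)}},
      forall (s t : R) (B : set R), 0 <= s -> s < t -> measurable B ->
        P [set w | B (W t w - W s w)%R] = normal_prob 0 (Num.sqrt (t - s)) B
    & forall (s t : R) (B : set R) (E : set T), 0 <= s -> s < t -> measurable B ->
        <<s cylinders W `[0, s] >> E ->
        (P (E `&` [set w | B (W t w - W s w)%R])
         = P E * P [set w | B (W t w - W s w)%R])%E].

End semimartingales.

Section model.
Context (R : realType).
Implicit Types (Q : probability (skorohod R) R) (f S : R -> R) (n m j k : nat)
  (sigma r : R).

(* ||f||^2 = \int_0^1 f^2 *)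
Definition sqnorm f : \bar R :=
  (\int[lebesgue_measure]_(x in `[0%R, 1%R]) ((f x) ^+ 2)%:E)%E.

(* The coordinate process is a semimartingale under Q for which the integrals
   I_m(f), f in L_2[0, m], m >= 1, are well defined. *)
Definition integrable_law Q (F : R -> set (set (skorohod R))) : Prop :=
  semimartingale Q F (@coord R) /\
  (forall m, (0 < m)%N ->
    exists I, stochastic_integral Q F (@coord R) m I).

(* I_m(f) under Q: a version of the almost surely unique (whatever the
   filtration) integral. *)
Definition Iint Q m f : skorohod R -> R :=
  xget (fun=> 0) [set Y | exists F I,
    [/\ integrable_law Q F, stochastic_integral Q F (@coord R) m I
      & Y = I (fun s _ => f s)]].

Definition noise_class sigma n : set (probability (skorohod R) R) :=
  [set Q | (exists F, integrable_law Q F) /\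
    (forall f, L2 n f ->
      ('E_Q[Iint Q n f] = 0)%E /\
      ('E_Q[fun w => ((Iint Q n f w) ^+ 2)%R] <=
       sigma%:E * \int[lebesgue_measure]_(s in (`[0%R, n%:R] : set R)) ((f s) ^+ 2)%:E)%E)].

Definition trig_basis j (x : R) : R :=
  if j == 1%N then 1
  else if odd j then Num.sqrt 2 * sin (2 * pi * (j./2)%:R * x)
  else Num.sqrt 2 * cos (2 * pi * (j./2)%:R * x).

Definition xi Q j m : skorohod R -> R :=
  fun w => (Num.sqrt m%:R)^-1 * Iint Q m (trig_basis j) w.

Definition xi2_mean Q j m : \bar R := ('E_Q[fun w => ((xi Q j m w) ^+ 2)%R])%E.

(* sigma(Q); the maximum is over nonnegative numbers, hence the default 0. *)
Definition noise_level Q : \bar R :=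
  limn_esup (fun m => \big[maxe/0%E]_(1 <= j < m.+1) xi2_mean Q j m).

Definition xi_tilde Q j n : skorohod R -> R :=
  fun w => (xi Q j n w) ^+ 2 - fine (xi2_mean Q j n).

(* Sequences are indexed by j >= 1. *)
Definition pos : set nat := [set j | (0 < j)%N].

Definition nonzero_at_most (x : nat -> R) n : Prop :=
  ([set j | pos j /\ x j != 0] #<= `I_n)%card.

Definition L1n Q n : \bar R :=
  ereal_sup [set `| \sum_(j \in pos) ((x j)%:E * (xi2_mean Q j n - noise_level Q)) |%E
            | x in [set x : nat -> R |
                (forall j, pos j -> -1 <= x j <= 1) /\ nonzero_at_most x n]].

Definition L2n Q n : \bar R :=
  ereal_sup [set 'E_Q[fun w => ((\sum_(j \in pos) (x j * xi_tilde Q j n w)) ^+ 2)%R]%E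
            | x in [set x : nat -> R |
                \sum_(j \in pos) (x j) ^+ 2 <= 1 /\ nonzero_at_most x n]].

Definition restricted_noise_class (sigma l : R) n :
    set (probability (skorohod R) R) :=
  [set Q | noise_class sigma n Q /\ (L1n Q n + L2n Q n <= l%:E)%E].

(* Q is the law of (sqrt sigma) w, w a standard Brownian motion. *)
Definition brownian_noise sigma Q : Prop :=
  exists2 W : R -> skorohod R -> R, standard_brownian Q W &
    forall t w, 0 <= t -> coord t w = Num.sqrt sigma * W t w.

(* y_t = \int_0^t S + xi_t for t >= 0 *)
Definition observation S (w : cadlag_path R) : R -> R :=
  fun t => \int[lebesgue_measure]_(x in `[0, t]) S x + w t.

(* The space of observations with the sigma-algebra sigma(y_t, 0 <= t <= n). *)
Definition observed n :=
  g_sigma_algebraType (cylinders (fun t (y : R -> R) => y t) `[0, n%:R]).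

(* An estimator of S is a function of the observed path with values in the
   functions on [0, 1]; it is measurable jointly in the path and the point. *)
Definition estimator n : set ((R -> R) -> R -> R) :=
  [set est | measurable_fun (setT `*` `[0, 1] : set (observed n * R))
               (fun p : observed n * R => est p.1 p.2)].

Definition robust_risk (Qs : set (probability (skorohod R) R))
    (est : (R -> R) -> R -> R) S : \bar R :=
  ereal_sup [set (\int[Q]_w sqnorm (fun x => est (observation S w) x - S x)%R)%E | Q in Qs].

(* D i is the i-th derivative on [0, 1]; at the endpoints it is one-sided, which
   by the mean value theorem is the continuity of D i and D i.+1 there. *)
Definition function_class k r : set (R -> R) :=
  [set S | (forall x : R, S (x + 1) = S x) /\
    exists D : nat -> R -> R,
      [/\ forall x : R, x \in `[0, 1] -> D 0%N x = S x,
          forall i (x : R), (i < k)%N -> x \in `]0, 1[ ->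
            is_derive x 1 (D i) (D i.+1 x),
          forall i, (i <= k)%N -> {within `[0, 1], continuous (D i)},
          forall i, (i <= k)%N -> D i 0 = D i 1
        & (\sum_(0 <= j < k.+1) sqnorm (D j) <= r%:E)%E]].

Definition rate_exponent k : R := (2 * k)%:R / (2 * k + 1)%:R.

Definition pinsker_constant k r sigma : R :=
  ((2 * k + 1)%:R * r) `^ ((2 * k + 1)%:R)^-1 *
  (sigma * k%:R / ((k + 1)%:R * pi)) `^ rate_exponent k.

Definition minimax_risk k r n (Qs : set (probability (skorohod R) R)) : \bar R :=
  ereal_inf [set ereal_sup [set robust_risk Qs est S | S in function_class k r]
            | est in estimator n].

End model.

(* Main.v *)
(* Put tau = sigma / n.  For the upper bound, the linear estimator with the Pinsker
   weights 1 - (j/m)^k is applied to Riemann sums approximating the empirical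
   Fourier coefficients.  Its bias is at most r / (pi m)^(2k) on the class, and
   E I(f)^2 <= sigma ||f||^2 bounds its variance by tau \sum_(j < m) (1 - (j/m)^k)^2
   for all the noise laws at once.
   For the lower bound, the noise is Brownian and the first Fourier coefficients are
   given independent centred Gaussian priors of variances s_i^2.  Given the other
   coefficients, the i-th one is the parameter of a one-dimensional Gaussian shift, so
   its Bayes risk is at least s_i^2 tau / (s_i^2 + tau): this is Cameron-Martin for
   paths observed on a finite grid, and the general case follows by approximating the
   estimator in L^2 by functions of finitely many observed values.  With variances
   slightly below the least favourable ones, the prior leaves the class with
   exponentially small probability.
   Both bounds are equivalent to tau m k / (k + 1) when
   m^(2k+1) = r (k+1) (2k+1) / (k pi^(2k) tau). *)
Require Import Defs.
From HB Require Import structures.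
From mathcomp Require Import all_boot all_order all_algebra.
From mathcomp Require Import all_classical all_reals all_analysis.
From mathcomp Require Import measurable_realfun.
From mathcomp Require Import zify ring lra.

Set Implicit Arguments.
Unset Strict Implicit.
Unset Printing Implicit Defensive.

Import Order.TTheory GRing.Theory Num.Theory.
Import numFieldNormedType.Exports.

Local Open Scope classical_set_scope.
Local Open Scope ring_scope.

(** * Gaussian integrals *)

(** The two bounds meet because the Pinsker weights are the Bayes weights of the prior: s_j^2 = tau
    ((m/j)^k - 1) gives s_j^2 / (s_j^2 + tau) = 1 - (j/m)^k. The equation for m says that this prior
    has energy r, that is tau pi^(2k) \sum_(j < m) (j^k m^k - j^(2k)) = r up to lower order terms.
    At this m the squared bias is the fraction 1/(2k+1) of the upper bound, the variance the
    fraction 2k/(2k+1). The class enters through weights \sum_(q <= k) freq^(2q) of the squared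
    coefficients, which lie between (pi j)^(2k) and (pi (j+2))^(2k); hence the same asymptotics on
    both sides. Charging the truncated tail to this ellipsoid requires completeness of the basis on
    the class. Increments of the observed path are explicit functions of it, whence the step
    functions; the mesh is refined at fixed n, so its error disappears before n grows. In the lower
    bound the estimator is replaced by its clipped coefficients, which controls the loss where the
    unbounded Gaussian prior leaves the class. *)

Lemma integral_prob_cst (R : realType) d (T : measurableType d)
  (P : probability T R) (c : \bar R) : (\int[P]_x c = c)%E.
Proof.
rewrite integral_cst//= [X in (_ * X)%E](_ : _ = 1%E) ?mule1//.
exact: probability_setT.
Qed.

Section density.
Import HBNNSimple.

(** Both sides are limits along an increasing sequence of simple functions, and for the indicator of
    a measurable set the identity is the hypothesis on [nu]. *)
Lemma ge0_integral_density (R : realType) d (T : measurableType d)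
    (la nu : {measure set T -> \bar R}) (g : T -> R) (f : T -> \bar R) :
  measurable_fun setT g -> (forall x, 0 <= g x) ->
  (forall A, measurable A -> nu A = \int[la]_(x in A) (g x)%:E)%E ->
  measurable_fun setT f -> (forall x, 0 <= f x)%E ->
  (\int[nu]_x f x = \int[la]_x (f x * (g x)%:E))%E.
Proof.
move=> mg g0 nuE mf f0.
pose f_ := nnsfun_approx measurableT mf.
transitivity (limn (fun n => \int[nu]_x (f_ n x)%:E))%E.
  rewrite -monotone_convergence//.
  - by apply: eq_integral => y _; apply/esym/cvg_lim => //; apply: cvg_nnsfun_approx.
  - by move=> n; exact/measurable_EFinP/measurable_funTS.
  - by move=> n y _; rewrite lee_fin.
  - by move=> y _ m n mn; rewrite lee_fin; exact/lefP/nd_nnsfun_approx.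
rewrite [X in limn X](_ : _ = fun n => \int[la]_x ((f_ n x)%:E * (g x)%:E))%E.
  rewrite -monotone_convergence//.
  - apply: eq_integral => y _; apply/cvg_lim => //.
    apply: cvgeZr => //; exact: cvg_nnsfun_approx.
  - move=> n; apply: emeasurable_funM; first exact/measurable_EFinP/measurable_funTS.
    exact/measurable_EFinP.
  - by move=> n y _; rewrite mule_ge0 ?lee_fin.
  - move=> y _ m n mn; apply: lee_wpmul2r; rewrite ?lee_fin//.
    exact/lefP/nd_nnsfun_approx.
apply/funext => n.
have mi r : measurable_fun setT (fun x => r * \1_(f_ n @^-1` [set r]) x).
  by apply: measurable_funM => //; apply: measurable_indic.
under eq_integral do rewrite fimfunE -fsumEFin//.
rewrite ge0_integral_fsum//; last 2 first.
- by move=> r; exact/measurable_EFinP.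
- by move=> r x _; rewrite nnfun_muleindic_ge0.
under [RHS]eq_integral.
  move=> x _; rewrite -EFinM fimfunE /= fsbig_finite//= mulr_suml.
  rewrite -sumEFin.
  under eq_bigr do rewrite EFinM.
  rewrite -fsbig_finite//=.
  over.
rewrite ge0_integral_fsum//; last 2 first.
- move=> r; apply/measurable_EFinP; apply: measurable_funM => //; exact: mi.
- by move=> r x _; rewrite mule_ge0 ?nnfun_muleindic_ge0// lee_fin.
apply: eq_fsbigr => r _.
have [r0|r0] := ltP r 0.
  have f0' : f_ n @^-1` [set r] = set0 by apply: preimage_nnfun0.
  by rewrite f0' indic0; rewrite !integral0_eq// => x _; rewrite !mulr0// mul0e.
under [RHS]eq_integral do rewrite EFinM -muleA.
rewrite ge0_integralZl_EFin//=; last 2 first.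
- by move=> x _; rewrite mule_ge0// lee_fin.
- by apply: emeasurable_funM; apply/measurable_EFinP => //; exact: measurable_indic.
under eq_integral do rewrite EFinM.
rewrite ge0_integralZl_EFin//=; last exact/measurable_EFinP/measurable_indic.
congr (_ * _)%E.
rewrite integral_indic//= setIT nuE//.
rewrite [LHS]integral_mkcond; apply: eq_integral => x _ /=.
by rewrite epatch_indic muleC.
Qed.

End density.

Section gaussian.
Context (R : realType).
Implicit Types (m s b c u v x z : R) (f : R -> \bar R).
Local Notation mu := (@lebesgue_measure R).

(** The image of Lebesgue measure under a translation has the right values on intervals, hence is
    Lebesgue measure by uniqueness. *)
Lemma ge0_integral_translation f b : measurable_fun [set: R] f ->
  (forall x, 0 <= f x)%E -> (\int[mu]_x f (x + b)%R = \int[mu]_x f x)%E.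
Proof.
move=> mf f0.
have mb : measurable_fun [set: measurableTypeR R]
    (fun x : R => x + b : measurableTypeR R).
  by apply: measurable_funD.
have E A : measurable A ->
    pushforward mu (fun x : R => x + b : measurableTypeR R) A = mu A.
  move=> mA; apply/esym/lebesgue_measure_unique => //= _ [[p q]] _ <-.
  have -> : pushforward mu (fun x => x + b : measurableTypeR R) `]p, q]
      = mu `]p - b, q - b].
    by congr (mu _); apply/seteqP; split=> x /=;
      rewrite !in_itv/= ltrBlDr lerBrDr.
  rewrite !lebesgue_measure_itv/= !lte_fin ltrD2r; case: ifP => // _.
  by rewrite -!EFinB; congr EFin; ring.
have := @ge0_integral_pushforward _ _ (measurableTypeR R) (measurableTypeR R) R
  _ mb mu setT f measurableT mf (fun y _ => f0 y).
rewrite preimage_setT => <-.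
by apply: eq_measure_integral => //= A mA _; exact: E.
Qed.

Lemma ge0_integral_normal m s f : measurable_fun [set: R] f ->
  (forall x, 0 <= f x)%E ->
  (\int[normal_prob m s]_x f x = \int[mu]_x (f x * (normal_pdf m s x)%:E))%E.
Proof.
move=> mf f0; apply: ge0_integral_density => //; first exact: measurable_normal_pdf.
by move=> x; exact: normal_pdf_ge0.
Qed.

Lemma normal_peakE s : 0 < s -> normal_peak s = s^-1 * (Num.sqrt (pi *+ 2))^-1.
Proof.
move=> s0; rewrite /normal_peak -mulrnAr sqrtrM ?sqr_ge0// sqrtr_sqr gtr0_norm//.
by rewrite invfM.
Qed.

(** Completing the square: the prior density N(0, s^2) times the likelihood is the posterior density
    N(vz, v) times a factor free of [x]. *)
Lemma normal_pdf_tilt s z c v x : 0 < s -> 0 < v -> v^-1 = s ^- 2 + c ->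
  normal_pdf 0 s x * expR (x * z - x ^+ 2 * c / 2) =
  Num.sqrt v / s * expR (v * z ^+ 2 / 2) * normal_pdf (v * z) (Num.sqrt v) x.
Proof.
move=> s0 v0 vE.
have sv0 : 0 < Num.sqrt v by rewrite sqrtr_gt0.
rewrite !normal_pdfE ?gt_eqF//= /normal_fun !normal_peakE//.
rewrite sqr_sqrtr ?ltW//.
have -> : c = v^-1 - s ^- 2 by rewrite vE; ring.
rewrite -[LHS]mulrA -[in LHS]expRD [RHS]mulrACA -[in RHS]expRD.
have h0 : s != 0 by rewrite gt_eqF.
have h1 : v != 0 by rewrite gt_eqF.
have h2 : Num.sqrt v != 0 by rewrite gt_eqF.
set q := (Num.sqrt (pi *+ 2))^-1.
have -> : Num.sqrt v / s * ((Num.sqrt v)^-1 * q) = s^-1 * q.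
  by field; rewrite h0 h2.
congr (_ * expR _).
by field; rewrite h0 h1.
Qed.

Lemma ge0_integral_opp f : measurable_fun [set: R] f ->
  (forall x, 0 <= f x)%E -> (\int[mu]_x f (- x)%R = \int[mu]_x f x)%E.
Proof.
move=> mf f0.
have mb : measurable_fun [set: measurableTypeR R]
    (-%R : _ -> measurableTypeR R) by exact: oppr_measurable.
have := @ge0_integral_pushforward _ _ (measurableTypeR R) (measurableTypeR R) R
  _ mb mu setT f measurableT mf (fun y _ => f0 y).
rewrite preimage_setT => <-.
by apply: eq_measure_integral => //= A mA _; exact: lebesgue_measureN.
Qed.

Lemma measurable_normal_pdfE m s : measurable_fun [set: R] (fun x => (normal_pdf m s x)%:E).
Proof. by apply/measurable_EFinP; exact: measurable_normal_pdf. Qed.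

(** The one-dimensional Cameron-Martin formula: translate the Lebesgue integral, then take the
    quotient of the two Gaussian densities. *)
Lemma normal_shift s b f : 0 < s -> measurable_fun [set: R] f ->
  (forall x, 0 <= f x)%E ->
  (\int[normal_prob 0 s]_x f (x + b)%R =
   \int[normal_prob 0 s]_x (f x * (expR (x * b / s ^+ 2 - b ^+ 2 / s ^+ 2 / 2))%:E))%E.
Proof.
move=> s0 mf f0.
have mexp : measurable_fun [set: R]
    (fun x => (expR (x * b / s ^+ 2 - b ^+ 2 / s ^+ 2 / 2))%:E).
  apply/measurable_EFinP/measurableT_comp => //.
  by apply: measurable_funB => //; apply: measurable_funM => //; apply: measurable_funM.
rewrite ge0_integral_normal//; last first.
  by apply: measurableT_comp => //; exact: measurable_funD.
rewrite ge0_integral_normal//; last 2 first.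
- exact: emeasurable_funM.
- by move=> x; rewrite mule_ge0// lee_fin expR_ge0.
have <- := @ge0_integral_translation
  (fun x => f x * (expR (x * b / s ^+ 2 - b ^+ 2 / s ^+ 2 / 2))%:E *
    (normal_pdf 0 s x)%:E)%E b; last 2 first.
- by apply: emeasurable_funM; [exact: emeasurable_funM|exact: measurable_normal_pdfE].
- by move=> x; rewrite !mule_ge0// lee_fin ?expR_ge0 ?normal_pdf_ge0.
apply: eq_integral => x _; rewrite -muleA; congr (_ * _)%E.
rewrite -EFinM; congr EFin.
rewrite normal_pdfE ?gt_eqF// /normal_fun mulrCA; congr (_ * _).
rewrite -expRD; congr expR.
by field; rewrite gt_eqF.
Qed.

Lemma integral_normal_cst m s c : (\int[normal_prob m s]_x c%:E = c%:E)%E.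
Proof. exact: (@integral_prob_cst _ _ _ (normal_prob m s)). Qed.

(** The case z = 0 of [normal_pdf_tilt], integrated. The sign of [c] is free as long as [v] is
    positive; a negative [c] gives the exponential moments of the Chernoff bound. *)
Lemma normal_exp_sq s c v : 0 < s -> 0 < v -> v^-1 = s ^- 2 + c ->
  (\int[normal_prob 0 s]_x (expR (- (x ^+ 2 * c / 2)))%:E = (Num.sqrt v / s)%:E)%E.
Proof.
move=> s0 v0 vE.
rewrite ge0_integral_normal//; last first.
  apply/measurable_EFinP/measurableT_comp => //; apply: measurableT_comp => //.
  by apply: measurable_funM => //; apply: measurable_funM.
under eq_integral.
  move=> x _; rewrite -EFinM.
  have := @normal_pdf_tilt s 0 c v x s0 v0 vE.
  rewrite mulr0 sub0r expr0n/= !mulr0 mul0r expR0 mulr1 [LHS]mulrC => ->.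
  rewrite EFinM.
  over.
rewrite ge0_integralZl_EFin//=.
- by rewrite integral_normal_pdf mule1.
- by move=> x _; rewrite lee_fin normal_pdf_ge0.
- exact: measurable_normal_pdfE.
- by rewrite divr_ge0// ltW.
Qed.

(** Read off [normal_exp_sq]: the inequality 1 - exp(-c x^2/2) <= c x^2/2 bounds the second moment
    below by (2/c) (1 - sqrt v / s), which tends to s^2 as c tends to 0. *)
Lemma normal_sq_ge s : 0 < s ->
  ((s ^+ 2)%:E <= \int[normal_prob 0 s]_x (x ^+ 2)%:E)%E.
Proof.
move=> s0.
set I := (\int[_]_x _)%E.
have msq c : measurable_fun [set: R] (fun x => x ^+ 2 * c / 2).
  by apply: measurable_funM => //; apply: measurable_funM.
have key u : 0 < u -> ((s ^+ 2 / (1 + u))%:E <= I)%E.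
  move=> u0.
  have u1 : 0 < 1 + u by rewrite ltr_wpDl.
  pose c := u / s ^+ 2.
  have c0 : 0 < c by rewrite divr_gt0// exprn_gt0.
  pose v := s ^+ 2 / (1 + u).
  have v0 : 0 < v by rewrite divr_gt0// exprn_gt0.
  have vE : v^-1 = s ^- 2 + c by rewrite /v /c; field; rewrite !gt_eqF.
  have E1 : (1 = \int[normal_prob 0 s]_x ((1 - expR (- (x ^+ 2 * c / 2))) +
      expR (- (x ^+ 2 * c / 2)))%:E)%E.
    under eq_integral do rewrite subrK.
    by rewrite integral_normal_cst.
  have pos x : 0 <= 1 - expR (- (x ^+ 2 * c / 2)).
    rewrite subr_ge0 -expR0 ler_expR oppr_le0.
    by rewrite divr_ge0// mulr_ge0 ?sqr_ge0// ltW.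
  have me : measurable_fun [set: R] (fun x => expR (- (x ^+ 2 * c / 2))).
    by apply: measurableT_comp => //; exact: measurableT_comp.
  move: E1; under eq_integral do rewrite EFinD.
  rewrite ge0_integralD//=; last 3 first.
  - by move=> x _; rewrite lee_fin.
  - by apply/measurable_EFinP; exact: measurable_funB.
  - exact/measurable_EFinP.
  rewrite (normal_exp_sq s0 v0 vE) => E1.
  have E2 : (\int[normal_prob 0 s]_x (1 - expR (- (x ^+ 2 * c / 2)))%:E =
      (1 - Num.sqrt v / s)%:E)%E.
    by rewrite EFinB [X in (_ = X - _)%E]E1 addeK.
  have : ((1 - Num.sqrt v / s)%:E <= (c / 2)%:E * I)%E.
    rewrite -E2 /I -ge0_integralZl_EFin//=; last 3 first.
    - by move=> x _; rewrite lee_fin sqr_ge0.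
    - by apply/measurable_EFinP.
    - by rewrite divr_ge0// ltW.
    apply: ge0_le_integral => //=.
    - by move=> x _; rewrite lee_fin.
    - by apply/measurable_EFinP; exact: measurable_funB.
    - by apply: emeasurable_funM => //; apply/measurable_EFinP.
    move=> x _; rewrite lee_fin lerBlDl.
    by have := expR_ge1Dx (- (x ^+ 2 * c / 2)) => h; lra.
  have c20 : 0 < c / 2 by exact: divr_gt0.
  rewrite -lee_pdivrMl// => /(le_trans _); apply.
  rewrite -EFinM lee_fin.
  (* With w = sqrt (1 + u) the bound is 2 s^2 / (w (w + 1)), at least s^2 / w^2 because w >= 1. *)
  have -> : Num.sqrt v / s = (Num.sqrt (1 + u))^-1.
    rewrite /v sqrtrM ?sqr_ge0// sqrtr_sqr gtr0_norm// sqrtrV ?ltW//.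
    by field; rewrite !gt_eqF// sqrtr_gt0.
  set w := Num.sqrt _.
  have w0 : 0 < w by rewrite sqrtr_gt0.
  have w2 : w ^+ 2 = 1 + u by rewrite sqr_sqrtr// ltW.
  have w1 : 1 <= w by rewrite /w -[leLHS]sqrtr1 ler_wsqrtr// lerDl ltW.
  rewrite -w2 /c.
  have -> : u = w ^+ 2 - 1 by rewrite w2 addrC addKr.
  have w21 : 0 < w ^+ 2 - 1 by rewrite w2 addrC addKr.
  rewrite -subr_ge0.
  have -> : ((w ^+ 2 - 1) / s ^+ 2 / 2)^-1 * (1 - w^-1) - s ^+ 2 / w ^+ 2 =
     s ^+ 2 * (w - 1) / (w ^+ 2 * (w + 1)).
    field; rewrite !gt_eqF//= ?addr_gt0//.
  by rewrite divr_ge0// ?mulr_ge0 ?sqr_ge0// ?subr_ge0// ?addr_ge0// ltW.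
apply/lee_addgt0Pr => e e0.
have s20 : 0 < s ^+ 2 by rewrite exprn_gt0.
have := key (e / s ^+ 2) (divr_gt0 e0 s20).
rewrite -(leeD2rE _ _ (isT : e%:E \is a fin_num)); apply: le_trans.
rewrite -EFinD lee_fin -lerBlDr.
have p : 0 < s ^+ 2 + e by rewrite addr_gt0.
rewrite -subr_ge0.
have -> : s ^+ 2 / (1 + e / s ^+ 2) - (s ^+ 2 - e) = e ^+ 2 / (s ^+ 2 + e).
  by field; rewrite !gt_eqF.
by rewrite divr_ge0 ?sqr_ge0 ?ltW.
Qed.

(** After centring, the law is symmetric, so the losses at S and - S have the same mean. Their sum
    is 2 x^2 + 2 S^2, without cross term, and only nonnegative functions are integrated. *)
Lemma normal_mse_ge m s (T : R) : 0 < s ->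
  ((s ^+ 2)%:E <= \int[normal_prob m s]_x ((T - x) ^+ 2)%:E)%E.
Proof.
move=> s0.
have mB a : measurable_fun [set: R] (fun x => ((a - x) ^+ 2)%:E).
  by apply/measurable_EFinP; apply: measurable_funX; exact: measurable_funB.
have B0 a x : (0 <= ((a - x) ^+ 2)%:E)%E by rewrite lee_fin sqr_ge0.
have EI m' a : (\int[normal_prob m' s]_x ((a - x) ^+ 2)%:E =
    \int[mu]_x (((a - x) ^+ 2)%:E * (normal_pdf m' s x)%:E))%E.
  by apply: ge0_integral_normal; [exact: mB|exact: B0].
pose S := T - m.
have -> : (\int[normal_prob m s]_x ((T - x) ^+ 2)%:E =
    \int[normal_prob 0 s]_x ((S - x) ^+ 2)%:E)%E.
  rewrite (EI m T) (EI 0 S).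
  have <- := @ge0_integral_translation
    (fun x => ((T - x) ^+ 2)%:E * (normal_pdf m s x)%:E)%E m.
  - apply: eq_integral => x _; rewrite /S; congr ((_ ^+ 2)%:E * (_)%:E)%E.
    by ring.
  by rewrite !normal_pdfE ?gt_eqF// /normal_fun subr0 addrK.
  - by apply: emeasurable_funM; [exact: mB|exact: measurable_normal_pdfE].
  - by move=> x; rewrite mule_ge0// lee_fin normal_pdf_ge0.
have Eopp : (\int[normal_prob 0 s]_x ((S - x) ^+ 2)%:E =
    \int[normal_prob 0 s]_x ((- S - x) ^+ 2)%:E)%E.
  rewrite (EI 0 S) (EI 0 (- S)).
  have <- := @ge0_integral_opp
    (fun x => ((S - x) ^+ 2)%:E * (normal_pdf 0 s x)%:E)%E.
  - apply: eq_integral => x _; congr ((_)%:E * (_)%:E)%E.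
      by ring.
    by rewrite !normal_pdfE ?gt_eqF// /normal_fun !subr0 sqrrN.
  - by apply: emeasurable_funM; [exact: mB|exact: measurable_normal_pdfE].
  - by move=> x; rewrite mule_ge0// lee_fin normal_pdf_ge0.
apply: le_trans (normal_sq_ge s0) _.
have h2 : (0 < 2%:R :> R) by [].
rewrite -(@lee_pmul2l _ 2%:E)//; set J := (\int[_]_x (((S - _) ^+ 2)%:E))%E.
have -> : (2%:E * J = J + J)%E by rewrite (mule_natl J 2) mule2n.
rewrite {2}/J Eopp -ge0_integralD//=.
rewrite -ge0_integralZl_EFin//=; last 2 first.
- by move=> x _; rewrite lee_fin sqr_ge0.
- exact/measurable_EFinP.
apply: ge0_le_integral => //=.
- by move=> x _; rewrite lee_fin mulr_ge0// sqr_ge0.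
- by apply: emeasurable_funM => //; exact/measurable_EFinP.
- by apply: emeasurable_funD; exact: mB.
- move=> x _; rewrite lee_fin.
  have -> : (S - x) ^+ 2 + (- S - x) ^+ 2 = 2 * x ^+ 2 + 2 * S ^+ 2 by ring.
  by rewrite lerDl mulr_ge0// sqr_ge0.
- exact: mB.
- exact: mB.
Qed.

(** This is [normal_mse_ge] for the posterior law N(vz, v), times the marginal likelihood. Without
    normalization it can be integrated over the observations under the law without drift. *)
Lemma normal_bayes s z c v (T : R) : 0 < s -> 0 < v -> v^-1 = s ^- 2 + c ->
  (v%:E * \int[normal_prob 0 s]_x (expR (x * z - x ^+ 2 * c / 2))%:E <=
   \int[normal_prob 0 s]_x ((T - x) ^+ 2 * expR (x * z - x ^+ 2 * c / 2))%:E)%E.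
Proof.
move=> s0 v0 vE.
have me : measurable_fun [set: R] (fun x => expR (x * z - x ^+ 2 * c / 2)).
  apply: measurableT_comp => //; apply: measurable_funB; first exact: measurable_funM.
  by apply: measurable_funM => //; apply: measurable_funM.
have mB : measurable_fun [set: R] (fun x => (T - x) ^+ 2).
  by apply: measurable_funX; exact: measurable_funB.
set K := Num.sqrt v / s * expR (v * z ^+ 2 / 2).
have K0 : 0 <= K by rewrite mulr_ge0 ?expR_ge0// divr_ge0// ltW.
have red (h : R -> R) : measurable_fun [set: R] h -> (forall x, 0 <= h x) ->
    (\int[normal_prob 0 s]_x (h x * expR (x * z - x ^+ 2 * c / 2))%:E =
     K%:E * \int[normal_prob (v * z) (Num.sqrt v)]_x (h x)%:E)%E.
  move=> mh h0.
  rewrite ge0_integral_normal//; last 2 first.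
  - by apply/measurable_EFinP; exact: measurable_funM.
  - by move=> x; rewrite lee_fin mulr_ge0// expR_ge0.
  rewrite ge0_integral_normal//; last exact/measurable_EFinP.
  rewrite -ge0_integralZl_EFin//=; last 2 first.
  - by move=> x _; rewrite -EFinM lee_fin mulr_ge0// normal_pdf_ge0.
  - apply: emeasurable_funM; first exact/measurable_EFinP.
    exact: measurable_normal_pdfE.
  apply: eq_integral => x _; rewrite -!EFinM; congr EFin.
  rewrite -[LHS]mulrA [X in h x * X]mulrC (normal_pdf_tilt _ _ s0 v0 vE) -/K.
  by rewrite mulrCA.
have := red (fun=> 1); under eq_integral do rewrite mul1r.
move=> ->//; rewrite red//; last by move=> x; exact: sqr_ge0.
rewrite integral_normal_cst// mule1 muleC.
apply: lee_wpmul2l; rewrite ?lee_fin//.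
have := @normal_mse_ge (v * z) (Num.sqrt v) T.
rewrite sqr_sqrtr; last exact: ltW.
by move=> H; apply: H; rewrite sqrtr_gt0.
Qed.

End gaussian.

(** * Finite families of independent Gaussian variables *)

Section seqR.
Context (R : realType).

Definition seq_cylinders : set (set (nat -> R)) :=
  [set A | exists i (B : set R), measurable B /\ A = (fun x => x i) @^-1` B].

(** Infinite sequences rather than tuples: the type is then independent of the number of
    coordinates, on which the proofs below go by induction. *)
Definition seqR := g_sigma_algebraType seq_cylinders.

Definition upd (N : nat) (p : measurableTypeR R * seqR) : seqR :=
  fun i => if i == N then p.1 else p.2 i.

Lemma measurable_to_seqR d (T : measurableType d) (f : T -> seqR) :
  (forall i, measurable_fun setT (fun t => f t i : R)) -> measurable_fun setT f.
Proof.
move=> mf; apply: (@measurability _ _ T seqR setT f seq_cylinders) => //.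
move=> _ [_ [i [B [mB ->]]] <-].
by have := mf i measurableT B mB.
Qed.

Lemma measurable_coord_seqR i : measurable_fun setT (fun x : seqR => x i : R).
Proof.
move=> _ B mB; rewrite setTI; apply: sub_sigma_algebra.
by exists i, B.
Qed.

Lemma measurable_upd N : measurable_fun setT (upd N).
Proof.
apply: measurable_to_seqR => i; rewrite /upd; case: eqP => _.
  exact: measurable_fst.
exact: (measurableT_comp (measurable_coord_seqR i) measurable_snd).
Qed.

HB.instance Definition _ N :=
  isMeasurableFun.Build _ _ _ _ (upd N) (measurable_upd N).

(** Independent coordinates N(0, s_i^2) for i < N, and zeros afterwards. Adding one coordinate at a
    time keeps every use of Fubini on a binary product. *)
Fixpoint gauss_seq (s : nat -> R) (N : nat) : probability seqR R :=
  if N is M.+1 then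
    distribution (normal_prob 0 (s M) \x gauss_seq s M)%E (upd M)
  else \d_((fun=> 0) : seqR).

Lemma integral_gauss_seq0 s (f : seqR -> \bar R) : measurable_fun setT f ->
  (\int[gauss_seq s 0]_x f x = f (fun=> 0%R))%E.
Proof. by move=> mf; rewrite integral_dirac// diracT mul1e. Qed.

Lemma integral_gauss_seqS s N (f : seqR -> \bar R) : measurable_fun setT f ->
  (forall x, 0 <= f x)%E ->
  (\int[gauss_seq s N.+1]_x f x =
   \int[normal_prob 0 (s N)]_u \int[gauss_seq s N]_x f (upd N (u, x)))%E.
Proof.
move=> mf f0; rewrite /= ge0_integral_distribution//.
have mfu : measurable_fun setT (f \o upd N) by exact: measurableT_comp.
rewrite (@fubini_tonelli1 _ _ _ _ R _ _ (f \o upd N))//.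
by move=> x; exact: f0.
Qed.

Lemma measurable_upd1 N u : measurable_fun setT (fun x : seqR => upd N (u, x)).
Proof. by apply: (measurableT_comp (measurable_upd N)); exact: measurable_pair1. Qed.

(* The coordinates are independent, so a coordinatewise lower bound that is
   uniform in the other coordinates integrates to the same bound. *)
Lemma integral_gauss_seq_ge s N j (f : seqR -> \bar R) (c : \bar R) :
  measurable_fun setT f -> (forall x, 0 <= f x)%E -> (j < N)%N ->
  (forall x, c <= \int[normal_prob 0 (s j)]_u f (upd j (u, x)))%E ->
  (c <= \int[gauss_seq s N]_x f x)%E.
Proof.
elim: N f => // N IH f mf f0 jN cf.
have mfu : measurable_fun setT (f \o upd N) by exact: measurableT_comp.
rewrite integral_gauss_seqS//.
have [jEN|jnN] := eqVneq j N.
  subst j.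
  rewrite (@fubini_tonelli _ _ _ _ R (normal_prob 0 (s N)) (gauss_seq s N)
    (f \o upd N))//; last by move=> x; exact: f0.
  rewrite -[leLHS]mule1 -(@probability_setT _ _ _ (gauss_seq s N)).
  rewrite -integral_cst//.
  have [c0|c0] := leP 0%E c.
    apply: ge0_le_integral => //=.
    apply: (@measurable_fun_fubini_tonelli_G _ _ _ _ R (normal_prob 0 (s N)) (f \o upd N)) => //.
    by move=> x; exact: f0.
  apply: (@le_trans _ _ 0%E); last first.
    by apply: integral_ge0 => x _; apply: integral_ge0 => u _; exact: f0.
  rewrite integral_cst//= [X in (_ * X)%E](_ : _ = 1%E) ?mule1; first exact: ltW.
  exact: (@probability_setT _ _ _ (gauss_seq s N)).
have {}jN : (j < N)%N by rewrite ltn_neqAle jnN.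
have H u : (c <= \int[gauss_seq s N]_x f (upd N (u, x)))%E.
  apply: IH => //; first exact: (measurableT_comp mf (measurable_upd1 N u)).
  move=> x; have := cf (upd N (u, x)); congr (_ <= _)%E.
  apply: eq_integral => w _; congr f; apply/funext => i; rewrite /upd/=.
  by case: (eqVneq i j) => // ->; rewrite (negbTE jnN).
have [c0|c0] := leP 0%E c; last first.
  apply: (@le_trans _ _ 0%E); first exact: ltW.
  by apply: integral_ge0 => x _; apply: integral_ge0 => u _; exact: f0.
rewrite -[leLHS]mule1 -(@probability_setT _ _ _ (normal_prob 0 (s N))).
rewrite -integral_cst//.
apply: ge0_le_integral => //=.
apply: (@measurable_fun_fubini_tonelli_F _ _ _ _ R (gauss_seq s N) (f \o upd N)) => //.
by move=> x; exact: f0.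
Qed.

Definition shift_seq (b : nat -> R) (N : nat) (x : seqR) : seqR :=
  fun i => if (i < N)%N then x i + b i else x i.

Lemma measurable_shift_seq b N : measurable_fun setT (shift_seq b N).
Proof.
apply: measurable_to_seqR => i; rewrite /shift_seq; case: (i < N)%N.
  by apply: measurable_funD => //; exact: measurable_coord_seqR.
exact: measurable_coord_seqR.
Qed.

(** Linear part of the log-density of the law translated by [b] with respect to the centred one. *)
Definition gauss_lin (s b : nat -> R) N (x : seqR) : R :=
  \sum_(i < N) x i * b i / s i ^+ 2.

Lemma measurable_gauss_lin s b N : measurable_fun setT (gauss_lin s b N).
Proof.
apply: measurable_sum => i.
by do 2 (apply: measurable_funM => //); exact: measurable_coord_seqR.
Qed.

Lemma gauss_lin_upd s b N u x :
  gauss_lin s b N.+1 (upd N (u, x)) = gauss_lin s b N x + u * b N / s N ^+ 2.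
Proof.
rewrite /gauss_lin big_ord_recr/= {2}/upd eqxx; congr (_ + _).
by apply: eq_bigr => i _; rewrite /upd/= [_ == N]ltn_eqF.
Qed.

(** Cameron-Martin in dimension N, by induction: the first coordinates are translated under the
    integral over the last one, to which [normal_shift] then applies. *)
Lemma integral_gauss_shift s b N (f : seqR -> \bar R) :
  (forall i, (i < N)%N -> 0 < s i) ->
  measurable_fun setT f -> (forall x, 0 <= f x)%E ->
  (\int[gauss_seq s N]_x f (shift_seq b N x) =
   \int[gauss_seq s N]_x (f x * (expR (gauss_lin s b N x -
      (\sum_(i < N) b i ^+ 2 / s i ^+ 2) / 2))%:E))%E.
Proof.
move=> + + +; elim: N f => [|N IH] f s0 mf f0.
  rewrite !integral_gauss_seq0//; last first.
    apply: emeasurable_funM => //; apply/measurable_EFinP/measurableT_comp => //.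
    by apply: measurable_funB => //; exact: measurable_gauss_lin.
  by rewrite /gauss_lin !big_ord0 mul0r subrr expR0 mule1.
have mE c M : measurable_fun setT (fun x => (expR (gauss_lin s b M x - c))%:E).
  apply/measurable_EFinP/measurableT_comp => //.
  by apply: measurable_funB => //; exact: measurable_gauss_lin.
rewrite !integral_gauss_seqS//; last 3 first.
- by apply: emeasurable_funM.
- by move=> x; rewrite mule_ge0// lee_fin expR_ge0.
- exact: (measurableT_comp mf (measurable_shift_seq _ _)).
pose c := (\sum_(i < N) b i ^+ 2 / s i ^+ 2) / 2.
pose g (u : R) := (\int[gauss_seq s N]_x (f (upd N (u, x)) *
  (expR (gauss_lin s b N x - c))%:E))%E.
have mg : measurable_fun [set: R] g.
  apply: (@measurable_fun_fubini_tonelli_F _ _ _ _ R (gauss_seq s N)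
    (fun p => f (upd N p) * (expR (gauss_lin s b N p.2 - c))%:E)%E).
  - apply: emeasurable_funM; first exact: (measurableT_comp mf (measurable_upd N)).
    exact: (measurableT_comp (mE _ _) measurable_snd).
  - by move=> x; rewrite mule_ge0// lee_fin expR_ge0.
transitivity (\int[normal_prob 0 (s N)]_u g (u + b N)%R)%E.
  apply: eq_integral => u _; rewrite /g.
  rewrite -(IH (fun x => f (upd N (u + b N, x))))//; last 2 first.
  - by move=> i iN; apply: s0; rewrite ltnS ltnW.
  - exact: (measurableT_comp mf (measurable_upd1 _ _)).
  apply: eq_integral => x _; congr f; apply/funext => i.
  by rewrite /shift_seq /upd/= ltnS; case: (ltngtP i N) => // ->.
rewrite (@normal_shift _ (s N) (b N) g)//; last 2 first.
- by apply: s0.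
- by move=> u; apply: integral_ge0 => x _; rewrite mule_ge0// lee_fin expR_ge0.
apply: eq_integral => u _; rewrite /g -ge0_integralZr//=; last 2 first.
- apply: emeasurable_funM; last exact: mE.
  exact: (measurableT_comp mf (measurable_upd1 _ _)).
- by move=> x _; rewrite mule_ge0// lee_fin expR_ge0.
apply: eq_integral => x _; rewrite -muleA; congr (_ * _)%E.
rewrite -EFinM -expRD; congr (expR _)%:E.
rewrite gauss_lin_upd big_ord_recr/= /c.
by field; rewrite gt_eqF// s0.
Qed.

(** Exponential moment of a diagonal quadratic form, by independence. The equation for [v i], with
    [v i] positive, encodes 2 a_i s_i^2 < 1. *)
Lemma integral_gauss_exp_sq (s a v : nat -> R) N :
  (forall i, (i < N)%N -> [/\ 0 < s i, 0 < v i & (v i)^-1 = s i ^- 2 - a i *+ 2]) ->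
  (\int[gauss_seq s N]_x (expR (\sum_(i < N) a i * (x i) ^+ 2))%:E =
   (\prod_(i < N) (Num.sqrt (v i) / s i))%:E)%E.
Proof.
have mE M : measurable_fun setT (fun x : seqR => (expR (\sum_(i < M) a i * (x i) ^+ 2))%:E).
  apply/measurable_EFinP/measurableT_comp => //; apply: measurable_sum => i.
  apply: measurable_funM => //; apply: measurable_funX.
  exact: measurable_coord_seqR.
elim: N => [|N IH] H.
  rewrite integral_gauss_seq0; first by rewrite !big_ord0 expR0.
  exact: mE.
rewrite integral_gauss_seqS//.
have [s0 v0 vE] := H N (ltnSn N).
under eq_integral.
  move=> u _.
  under eq_integral.
    move=> x _.
    rewrite big_ord_recr/= {2}/upd eqxx/= expRD mulrC EFinM.
    under eq_bigr => i _ do rewrite /upd/= [_ == N]ltn_eqF//.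
    over.
  rewrite ge0_integralZl_EFin//=; last exact: mE.
  rewrite IH; last by move=> i iN; apply: H; rewrite ltnS ltnW.
  rewrite muleC.
  over.
rewrite ge0_integralZl_EFin//=; last 2 first.
- by apply/measurable_EFinP/measurableT_comp => //; apply: measurable_funM => //.
- by apply: prodr_ge0 => i _; have [? ? _] := H i (ltnW (ltn_ord i)); rewrite divr_ge0// ltW.
rewrite big_ord_recr/= [RHS]EFinM; congr (_ * _)%E.
rewrite -(@normal_exp_sq _ (s N) (- (a N *+ 2)) (v N))//.
apply: eq_integral => u _; congr (expR _)%:E.
by rewrite -mulr_natr; field.
Qed.

End seqR.

(** * Bayes risk for a Brownian path with drift *)

Section paths.
Context (R : realType).

(** The sigma-algebra of the values at times in an arbitrary set [J]: the interval [0, n] gives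
    [observed], a finite [J] a discretized observation. *)
Definition paths (J : set R) :=
  g_sigma_algebraType (cylinders (fun t (y : R -> R) => y t) J).

Lemma measurable_to_paths J d (T : measurableType d) (f : T -> paths J) :
  (forall t, J t -> measurable_fun setT (fun w => f w t : R)) ->
  measurable_fun setT f.
Proof.
move=> mf.
apply: (@measurability _ _ T (paths J) setT f
  (cylinders (fun t (y : R -> R) => y t) J)) => //.
move=> _ [_ [t [B [Jt mB ->]]] <-].
by have := mf t Jt measurableT B mB.
Qed.

Lemma measurable_coord_paths J t : J t ->
  measurable_fun setT (fun y : paths J => y t : R).
Proof.
move=> Jt _ B mB; rewrite setTI; apply: sub_sigma_algebra.
by exists t, B; split.
Qed.

(** The sets that contain both or neither of [y] and [y'] form a sigma-algebra, which contains the
    cylinders over [J]. *)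
Lemma paths_local (J : set R) (A : set (paths J)) (y y' : R -> R) :
  measurable A -> (forall t, J t -> y t = y' t) -> A y -> A y'.
Proof.
move=> mA yy'.
suff : [set A : set (R -> R) | A y <-> A y'] A by move=> /= [].
move: A mA; apply: smallest_sub; last first.
  by move=> _ [t [B [Jt mB ->]]] /=; rewrite yy'.
split => //=.
- by move=> A AE; split=> -[_ nA]; split=> // /AE.
- move=> F FE; split=> -[i _ Fi]; exists i => //; exact/(FE i).
Qed.

Lemma measurable_paths_local (J : set R) (T : paths J -> R) (y y' : R -> R) :
  measurable_fun setT T -> (forall t, J t -> y t = y' t) -> T y = T y'.
Proof.
move=> mT yy'.
have mA : measurable (T @^-1` [set T y]) by rewrite -[X in measurable X]setTI; exact: mT.
by have := paths_local mA yy' erefl => /= ->.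
Qed.

End paths.

Section brownian.
Context (R : realType) d (T : measurableType d) (P : probability T R)
  (W : R -> T -> R).
Hypothesis hW : standard_brownian P W.

Definition incr (t : nat -> R) (N : nat) (w : T) : seqR R :=
  fun i => if (i < N)%N then W (t i.+1) w - W (t i) w else 0.

Lemma measurable_brownian t : 0 <= t -> measurable_fun setT (W t).
Proof. by case: hW => + _ _ _ _; exact. Qed.

Lemma grid_ge0 (t : nat -> R) N : 0 <= t 0%N ->
  (forall i, (i < N)%N -> t i < t i.+1) ->
  forall i, (i <= N)%N -> 0 <= t i.
Proof.
move=> t0 tS; elim=> // i IH iN.
by apply: (le_trans (IH (ltnW iN))); exact/ltW/tS.
Qed.

Lemma grid_le (t : nat -> R) N : (forall i, (i < N)%N -> t i < t i.+1) ->
  forall i j, (i <= j)%N -> (j <= N)%N -> t i <= t j.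
Proof.
move=> tS i; elim=> [|j IH]; first by rewrite leqn0 => /eqP ->.
rewrite leq_eqVlt => /predU1P[-> //|]; rewrite ltnS => ij jN.
by apply: (le_trans (IH ij (ltnW jN))); exact/ltW/tS.
Qed.

Lemma measurable_incr t N : 0 <= t 0%N -> (forall i, (i < N)%N -> t i < t i.+1) ->
  measurable_fun setT (incr t N).
Proof.
move=> t0 tS; apply: measurable_to_seqR => i; rewrite /incr.
have [iN|//] := ltnP i N; apply: measurable_funB; apply: measurable_brownian;
  apply: (grid_ge0 t0 tS) => //; exact: ltnW.
Qed.

(** Puts all earlier increments into one event of the past, the form in which [standard_brownian]
    states independence. *)
Lemma incr_past t N C : 0 <= t 0%N -> (forall i, (i < N)%N -> t i < t i.+1) ->
  measurable C -> <<s cylinders W `[0, t N] >> (incr t N @^-1` C).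
Proof.
move=> t0 tS mC.
pose T' := g_sigma_algebraType (cylinders W `[0, t N]).
have mW i : (i <= N)%N -> measurable_fun setT (fun w : T' => W (t i) w : R).
  move=> iN _ B mB; rewrite setTI; apply: sub_sigma_algebra.
  exists (t i), B; split => //=.
  by rewrite in_itv/= (grid_ge0 t0 tS)//= (grid_le tS).
have : measurable_fun setT (incr t N : T' -> seqR R).
  apply: measurable_to_seqR => i; rewrite /incr.
  by have [iN|//] := ltnP i N; apply: measurable_funB; apply: mW => //; exact: ltnW.
by move=> /(_ measurableT C mC); rewrite setTI.
Qed.

(** The last increment is independent of the earlier ones, so the joint law agrees with the product
    measure on rectangles, hence everywhere. *)
Lemma incr_law t N A : 0 <= t 0%N -> (forall i, (i < N)%N -> t i < t i.+1) ->
  measurable A ->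
  P (incr t N @^-1` A) = gauss_seq (fun i => Num.sqrt (t i.+1 - t i)) N A.
Proof.
move=> t0; elim: N A => [|N IH] A tS mA.
  rewrite /= diracE; have [A0|A0] := boolP ((fun=> 0) \in A).
    rewrite (_ : _ @^-1` _ = setT) ?probability_setT//.
    by apply/seteqP; split => // w _; move: A0; rewrite inE.
  rewrite (_ : _ @^-1` _ = set0) ?measure0//.
  by apply/seteqP; split => // w /mem_set; apply/negP.
have tS' i : (i < N)%N -> t i < t i.+1 by move=> iN; apply: tS; rewrite ltnS ltnW.
have mI := measurable_incr t0 tS'.
have tN0 : 0 <= t N by apply: (grid_ge0 t0 tS').
have mX : measurable_fun setT (fun w => W (t N.+1) w - W (t N) w).
  apply: measurable_funB; apply: measurable_brownian => //.
  by apply: (grid_ge0 t0 tS).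
pose h (w : T) : measurableTypeR R * seqR R := (W (t N.+1) w - W (t N) w, incr t N w).
have mh : measurable_fun setT h by exact: measurable_fun_pair.
have -> : incr t N.+1 = (upd N) \o h.
  apply/funext => w; apply/funext => i; rewrite /incr /upd /= ltnS leq_eqVlt.
  by have [->|] := eqVneq i N.
pose mh' := isMeasurableFun.Build _ _ _ _ h mh.
pose hm : {mfun T >-> _} := HB.pack h mh'.
have mA' : measurable (upd N @^-1` A).
  by rewrite -[X in measurable X]setTI; exact: measurable_upd.
rewrite /= /distribution /pushforward.
rewrite [RHS](@product_measure_unique _ _ _ _ R _ _ (distribution P hm))//.
move=> B C mB mC.
change (P (h @^-1` (B `*` C)) = (normal_prob 0 (Num.sqrt (t N.+1 - t N)) B *
  gauss_seq (fun i => Num.sqrt (t i.+1 - t i)) N C)%E).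
have -> : h @^-1` (B `*` C) = incr t N @^-1` C `&`
    [set w | B (W (t N.+1) w - W (t N) w)].
  by apply/seteqP; split=> w /= [? ?]; split.
case: hW => _ _ _ gW iW.
rewrite iW//; last 2 first.
- exact: tS.
- exact: incr_past.
rewrite gW//; last exact: tS.
by rewrite muleC IH.
Qed.

Lemma integral_incr t N (f : seqR R -> \bar R) : 0 <= t 0%N ->
  (forall i, (i < N)%N -> t i < t i.+1) ->
  measurable_fun setT f -> (forall x, 0 <= f x)%E ->
  (\int[P]_w f (incr t N w) =
   \int[gauss_seq (fun i => Num.sqrt (t i.+1 - t i)) N]_x f x)%E.
Proof.
move=> t0 tS mf f0.
have mI := measurable_incr t0 tS.
have := @ge0_integral_pushforward _ _ _ _ R _ mI P setT f measurableT mf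
  (fun y _ => f0 y).
rewrite preimage_setT => <-.
by apply: eq_measure_integral => //= A mA _; exact: incr_law.
Qed.

(** A step path with jump [x i] at time [t i.+1]. On the grid it agrees with any path that starts
    from 0 and has increments [x], and a statistic measurable over the grid sees nothing else. *)
Definition grid_path (t : nat -> R) N (x : seqR R) : R -> R :=
  fun u => \sum_(i < N) if t i.+1 <= u then x i else 0.

Lemma grid_pathE t N x j : (forall i, (i < N)%N -> t i < t i.+1) ->
  (j <= N)%N -> grid_path t N x (t j) = \sum_(i < j) x i.
Proof.
move=> tS jN; rewrite /grid_path -big_mkcond (big_ord_widen N (fun i => x i) jN).
apply: eq_bigl => i; apply/idP/idP; last first.
  by move=> ij; apply: (grid_le tS).
apply: contraTT; rewrite -leqNgt -ltNge => ji.
by apply: (le_lt_trans (grid_le tS ji (ltnW (ltn_ord i)))); exact: tS.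
Qed.

Lemma measurable_grid_path t N J :
  measurable_fun setT (grid_path t N : seqR R -> paths J).
Proof.
apply: measurable_to_paths => u _; rewrite /grid_path.
apply: measurable_sum => i; case: (t i.+1 <= u) => //.
exact: measurable_coord_seqR.
Qed.

(* Bayes risk in a Gaussian shift experiment observed on a finite grid: after
   the Cameron-Martin change of measure the posterior law of the parameter is
   Gaussian with variance [v]. *)
Lemma bayes_grid t N (Psi : R -> R) (T' : paths [set t i | i in [set i | (i <= N)%N]] -> R)
    s v :
  t 0%N = 0 -> (forall i, (i < N)%N -> t i < t i.+1) ->
  measurable_fun setT T' -> Psi 0 = 0 -> 0 < s -> 0 < v ->
  v^-1 = s ^- 2 + \sum_(i < N) (Psi (t i.+1) - Psi (t i)) ^+ 2 / (t i.+1 - t i) ->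
  (v%:E <= \int[normal_prob 0 s]_u \int[P]_w
     ((T' (fun r => (W r w + u * Psi r)%R) - u) ^+ 2)%:E)%E.
Proof.
move=> t0 tS mT' Psi0 s0 v0.
pose sg i := Num.sqrt (t i.+1 - t i).
pose b i := Psi (t i.+1) - Psi (t i).
set c := \sum_(i < N) _ => vE.
have sg0 i : (i < N)%N -> 0 < sg i.
  by move=> iN; rewrite sqrtr_gt0 subr_gt0 tS.
have cE : c = \sum_(i < N) b i ^+ 2 / sg i ^+ 2.
  by apply: eq_bigr => i _; rewrite /sg sqr_sqrtr// subr_ge0 ltW// tS.
have t00 : 0 <= t 0%N by rewrite t0.
have tge := grid_ge0 t00 tS.
pose G x := T' (grid_path t N x).
have mG : measurable_fun setT (G : seqR R -> R).
  exact: (measurableT_comp mT' (@measurable_grid_path _ _ _)).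
have mlin := @measurable_gauss_lin R sg b N.
have mexp u : measurable_fun setT
    (fun x => (expR (u * gauss_lin sg b N x - u ^+ 2 * c / 2))%:E).
  apply/measurable_EFinP/measurableT_comp => //.
  by apply: measurable_funB => //; apply: measurable_funM.
have linE u x : gauss_lin sg (fun i => u * b i) N x = u * gauss_lin sg b N x.
  by rewrite /gauss_lin mulr_sumr; apply: eq_bigr => i _; ring.
have sqE u : \sum_(i < N) (u * b i) ^+ 2 / sg i ^+ 2 = u ^+ 2 * c.
  by rewrite cE mulr_sumr; apply: eq_bigr => i _; ring.
have shiftE u (f : seqR R -> \bar R) : measurable_fun setT f ->
    (forall x, 0 <= f x)%E ->
    (\int[gauss_seq sg N]_x f (shift_seq (fun i => u * b i)%R N x) =
     \int[gauss_seq sg N]_x (f x *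
       (expR (u * gauss_lin sg b N x - u ^+ 2 * c / 2))%:E))%E.
  move=> mf f0.
  rewrite (@integral_gauss_shift _ sg (fun i => u * b i) N f sg0 mf f0).
  by apply: eq_integral => x _; rewrite linE sqE.
have stepE u : (\int[P]_w ((T' (fun r => W r w + u * Psi r) - u) ^+ 2)%:E =
    \int[gauss_seq sg N]_x ((G x - u) ^+ 2 *
      expR (u * gauss_lin sg b N x - u ^+ 2 * c / 2))%:E)%E.
  have mf : measurable_fun setT (fun x => ((G x - u) ^+ 2)%:E).
    by apply/measurable_EFinP; apply: measurable_funX; exact: measurable_funB.
  have f0 x : (0 <= ((G x - u) ^+ 2)%:E)%E by rewrite lee_fin sqr_ge0.
  under [RHS]eq_integral do rewrite EFinM.
  rewrite -(shiftE u (fun x => ((G x - u) ^+ 2)%:E))//.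
  have mfs : measurable_fun setT (fun x => ((G (shift_seq (fun i => u * b i) N x) - u) ^+ 2)%:E).
    exact: (measurableT_comp mf (measurable_shift_seq _ _)).
  rewrite -(integral_incr t00 tS mfs)//.
  (* The two integrands agree where [W 0] vanishes, hence only almost surely. *)
  apply: ge0_ae_eq_integral => //.
  - apply/measurable_EFinP; apply: measurable_funX; apply: measurable_funB => //.
    apply: (measurableT_comp mT'); apply: measurable_to_paths => r [i /= iN <-].
    by apply: measurable_funD => //; apply: measurable_brownian; exact: tge.
  - exact: (measurableT_comp mfs (measurable_incr t00 tS)).
  - by move=> w _; rewrite lee_fin sqr_ge0.
  case: hW => _ W0 _ _ _; apply: filterS W0 => w W0 _.
  congr ((_ - _) ^+ 2)%:E; apply: measurable_paths_local => // _ [j /= jN <-].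
  rewrite grid_pathE//.
  transitivity (\sum_(i < j) ((W (t i.+1) w + u * Psi (t i.+1)) -
    (W (t i) w + u * Psi (t i)))).
    rewrite -(big_mkord xpredT (fun i => W (t i.+1) w + u * Psi (t i.+1) -
      (W (t i) w + u * Psi (t i)))) (telescope_sumr (fun i => W (t i) w + u * Psi (t i)))//.
    by rewrite t0 Psi0 mulr0 addr0 W0 subr0.
  apply: eq_bigr => i _; rewrite /shift_seq /incr (leq_trans (ltn_ord i) jN) /b.
  by ring.
under eq_integral do rewrite stepE.
pose h (p : measurableTypeR R * seqR R) := expR (p.1 * gauss_lin sg b N p.2 - p.1 ^+ 2 * c / 2).
have mh : measurable_fun setT h.
  apply: measurableT_comp => //; apply: measurable_funB.
    apply: measurable_funM; first exact: measurable_fst.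
    exact: (measurableT_comp mlin measurable_snd).
  apply: measurable_funM => //; apply: measurable_funM => //.
  by apply: measurable_funX; exact: measurable_fst.
pose q (p : measurableTypeR R * seqR R) := ((G p.2 - p.1) ^+ 2 * h p)%:E.
have mq : measurable_fun setT q.
  apply/measurable_EFinP; apply: measurable_funM => //; apply: measurable_funX.
  apply: measurable_funB; last exact: measurable_fst.
  exact: (measurableT_comp mG measurable_snd).
have q0 p : (0 <= q p)%E by rewrite lee_fin mulr_ge0 ?sqr_ge0// expR_ge0.
have h0 p : (0 <= (h p)%:E)%E by rewrite lee_fin expR_ge0.
have mhE : measurable_fun setT (EFin \o h) by exact/measurable_EFinP.
rewrite (@fubini_tonelli _ _ _ _ R (normal_prob 0 s) (gauss_seq sg N) q)//.
(* For each parameter the likelihood ratio [h] has integral 1 under the law without drift. So v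
   becomes an integral over x of v times the marginal likelihood, and [normal_bayes] compares the
   integrands. *)
have -> : (v%:E = v%:E *
    \int[gauss_seq sg N]_x \int[normal_prob 0 s]_u (h (u, x))%:E)%E.
  rewrite -(@fubini_tonelli _ _ _ _ R (normal_prob 0 s) (gauss_seq sg N) (EFin \o h))//.
  rewrite [X in (_ = _ * X)%E](_ : _ = 1%E) ?mule1//.
  transitivity (\int[normal_prob 0 s]_u (1%:E : \bar R))%E; last first.
    exact: integral_normal_cst.
  apply: eq_integral => u _.
  transitivity (\int[gauss_seq sg N]_x (1 *
      (expR (u * gauss_lin sg b N x - u ^+ 2 * c / 2))%:E))%E.
    by apply: eq_integral => x _; rewrite mul1e.
  rewrite -(shiftE u (fun=> 1%E))//.
  exact: (@integral_prob_cst _ _ _ (gauss_seq sg N)).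
rewrite -ge0_integralZl_EFin//=; last 3 first.
- by move=> x _; apply: integral_ge0.
- exact: (@measurable_fun_fubini_tonelli_G _ _ _ _ R (normal_prob 0 s) (EFin \o h)).
- exact: ltW.
apply: ge0_le_integral => //=.
- move=> x _; apply: mule_ge0; first by rewrite lee_fin ltW.
  by apply: integral_ge0 => u _; rewrite lee_fin expR_ge0.
- apply: emeasurable_funM => //.
  exact: (@measurable_fun_fubini_tonelli_G _ _ _ _ R (normal_prob 0 s) (EFin \o h)).
- exact: (@measurable_fun_fubini_tonelli_G _ _ _ _ R (normal_prob 0 s) q).
- move=> x _.
  exact: (@normal_bayes _ s (gauss_lin sg b N x) c v (G x) s0 v0 vE).
Qed.

End brownian.

(** * Approximation by functions of finitely many observed values *)

Section approximation.
Context (R : realType).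
Local Notation cyl J := (cylinders (fun t (y : R -> R) => y t) J).

Definition symdiff T (A B : set T) := (A `\` B) `|` (B `\` A).

Lemma sub_cyl (J J' : set R) : J `<=` J' -> <<s cyl J >> `<=` <<s cyl J' >>.
Proof.
move=> JJ'; apply: smallest_sub; first exact: smallest_sigma_algebra.
move=> A [t [B [Jt mB ->]]]; apply: sub_sigma_algebra.
by exists t, B; split => //; exact: JJ'.
Qed.

Lemma cyl_measurable (J J' : set R) (C : set (R -> R)) : J `<=` J' ->
  <<s cyl J >> C -> measurable (C : set (paths J')).
Proof. by move=> JJ'; apply: sub_cyl. Qed.

Section sets.
Variables (J : set R) (nu : probability (paths J) R).

Let approx (A : set (paths J)) := measurable A /\ forall e : R, 0 < e ->
  exists (s : seq R) (C : set (R -> R)), [/\ [set` s] `<=` J,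
    <<s cyl [set` s] >> C & (nu (symdiff A C) <= e%:E)%E].

Let approxU A B : approx A -> approx B -> approx (A `|` B).
Proof.
move=> [mA aA] [mB aB]; split; first exact: measurableU.
move=> e e0; have e2 : 0 < e / 2 by rewrite divr_gt0.
have [s [C [sJ sC nC]]] := aA _ e2; have [s' [C' [sJ' sC' nC']]] := aB _ e2.
have mC : measurable (C : set (paths J)) by exact: cyl_measurable sC.
have mC' : measurable (C' : set (paths J)) by exact: cyl_measurable sC'.
exists (s ++ s'), (C `|` C'); split.
- by move=> x /=; rewrite mem_cat => /orP[] ?; [exact: sJ|exact: sJ'].
- apply: (@measurableU _ (paths [set` s ++ s'])).
    by apply: sub_cyl sC => x /=; rewrite mem_cat => ->.
  by apply: sub_cyl sC' => x /=; rewrite mem_cat orbC => ->.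
- have mS (X Y : set (paths J)) : measurable X -> measurable Y -> measurable (symdiff X Y).
    by move=> mX mY; apply: measurableU; exact: measurableD.
  apply: (@le_trans _ _ (nu (symdiff A C `|` symdiff B C'))).
    apply: le_measure; rewrite ?inE; [|by apply: measurableU; exact: mS|].
      by apply: mS; exact: measurableU.
    move=> x [[[Ax|Bx] /not_orP[nC1 nC2]]|[[Cx|Cx] /not_orP[nA nB]]].
    + by left; left.
    + by right; left.
    + by left; right.
    + by right; right.
  apply: (le_trans (measureU2 _ _ _)); [exact: mS|exact: mS|].
  by rewrite [e]splitr EFinD leeD.
Qed.

(** The sets that can be so approximated form a sigma-algebra containing the cylinders. For a
    countable union, continuity from below reduces to a finite one at the cost of half the error. *)
Lemma approx_cylinder (A : set (paths J)) : measurable A -> forall e : R, 0 < e ->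
  exists (s : seq R) (C : set (R -> R)), [/\ [set` s] `<=` J,
    <<s cyl [set` s] >> C & (nu (symdiff A C) <= e%:E)%E].
Proof.
move: A; suff H : measurable `<=` approx by move=> A /H[].
have a0 : approx set0.
  split => // e e0; exists [::], set0; split => //.
  - by case: (smallest_sigma_algebra setT (cyl [set` [::]])).
  - by rewrite /symdiff !set0D setU0 measure0 lee_fin ltW.
have aC A : approx A -> approx (~` A).
  move=> [mA aA]; split; first exact: measurableC.
  move=> e e0; have [s [C [sJ sC nC]]] := aA _ e0.
  exists s, (~` C); split => //.
    exact: (@measurableC _ (paths [set` s])).
  rewrite (_ : symdiff _ _ = symdiff A C)//.
  rewrite /symdiff setUC !setDE !setCK; congr (_ `|` _).
    by rewrite setIC.
  by rewrite setIC.
apply: smallest_sub => /=.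
  split => //; first by move=> A aA; rewrite setTD; exact: aC.
  change (forall F : nat -> set (paths J), (forall i, approx (F i)) ->
    approx (\bigcup_i F i)).
  move=> F aF; have mF i : measurable (F i) by case: (aF i).
  have mUF : measurable (\bigcup_i F i) by exact: bigcupT_measurable.
  split => // e e0; have e2 : 0 < e / 2 by rewrite divr_gt0.
  pose G M := \big[setU/set0]_(i < M.+1) F i.
  have aG M : approx (G M).
    rewrite /G; elim: M.+1 => [|m IH]; first by rewrite big_ord0.
    by rewrite big_ord_recr/=; exact: approxU.
  have mG M : measurable (G M) by case: (aG M).
  have UG : \bigcup_M G M = \bigcup_i F i.
    by rewrite bigcup_bigsetU_bigcup.
  have ndG : nondecreasing_seq G.
    by move=> m m' mm'; apply/subsetPset; exact: subset_bigsetU.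
  have cG : nu (G M) @[M --> \oo] --> nu (\bigcup_i F i).
    by rewrite -UG; apply: nondecreasing_cvg_mu => //; rewrite UG.
  have nfin A : measurable A -> nu A \is a fin_num by move=> mA; exact: fin_num_measure.
  have [M HM] : exists M, (nu (\bigcup_i F i) - (e / 2)%:E < nu (G M))%E.
    have lt : (nu (\bigcup_i F i) - (e / 2)%:E < nu (\bigcup_i F i))%E.
      by rewrite lteBlDr// lteDl// ?nfin// lte_fin.
    have /= := cG _ (open_nbhs_nbhs (conj (@open_ereal_gt_ereal _ _) lt)).
    by case=> M _ /(_ M (leqnn M)) /= ?; exists M.
  have [_ /(_ _ e2)[s [C [sJ sC nC]]]] := aG M.
  exists s, C; split => //.
  have mC : measurable (C : set (paths J)) by exact: cyl_measurable sC.
  have mS (X Y : set (paths J)) : measurable X -> measurable Y -> measurable (symdiff X Y).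
    by move=> mX mY; apply: measurableU; exact: measurableD.
  have GF : G M `<=` \bigcup_i F i by rewrite -UG; exact: bigcup_sup.
  apply: (@le_trans _ _ (nu ((\bigcup_i F i `\` G M) `|` symdiff (G M) C))).
    apply: le_measure; rewrite ?inE; [exact: mS| |].
      by apply: measurableU; [exact: measurableD|exact: mS].
    move=> x [[Fx nCx]|[Cx nFx]].
      have [Gx|Gx] := pselect (G M x); first by right; left.
      by left.
    by right; right; split => // /GF.
  apply: (le_trans (measureU2 _ _ _)); [exact: measurableD|exact: mS|].
  rewrite [e]splitr EFinD leeD// measureD//; last first.
    by rewrite ltey_eq nfin.
  rewrite (setIidr GF) leeBlDr ?nfin//.
  by rewrite -leeBlDl ?ltW// nfin.
move=> A [t [B [Jt mB ->]]]; split.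
  by apply: sub_sigma_algebra; exists t, B.
move=> e e0; exists [:: t], ((fun y => y t) @^-1` B); split.
- by move=> x /=; rewrite inE => /eqP ->.
- by apply: sub_sigma_algebra; exists t, B; split => //=; rewrite inE.
- by rewrite /symdiff setDv setU0 measure0 lee_fin ltW.
Qed.

End sets.

(** [N] is the minimum of K and the integer part of x: counting the thresholds below a bounded value
    recovers it up to one unit. *)
Lemma count_floor (x : R) K : 0 <= x ->
  let N := (\sum_(i < K) (i.+1%:R <= x)%R)%N in
  N%:R <= x /\ (N = K \/ x < N.+1%:R).
Proof.
move=> x0; elim: K => [|K [IH1 IH2]] /=; first by rewrite big_ord0; split => //; left.
rewrite big_ord_recr/=; set N := (\sum_(i < K) _)%N in IH1 IH2 *.
have [Kx|Kx] := leP K.+1%:R x.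
  rewrite addn1; case: IH2 => [->|xN]; first by split => //; left.
  have := le_lt_trans Kx xN; rewrite ltr_nat ltnS => KN.
  have : (N <= K)%N.
    apply: (@leq_trans (\sum_(i < K) 1)).
      by apply: leq_sum => i _; exact: leq_b1.
    by rewrite sum_nat_const card_ord muln1.
  by rewrite leqNgt KN.
rewrite addn0; split => //; right.
by case: IH2 => // ->.
Qed.

(** The function is rounded to K levels, and each upper level set is replaced by an event of
    finitely many times. The quadratic error is at most the uniform bound [2 * B] times the mean
    absolute error. *)
Lemma approx_fun (J : set R) (nu : probability (paths J) R) (T : paths J -> R)
    (B e : R) : 0 < B -> measurable_fun setT T -> (forall y, `|T y| <= B) ->
  0 < e ->
  exists (s : seq R) (T' : (R -> R) -> R), [/\ [set` s] `<=` J,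
    measurable_fun setT (T' : paths [set` s] -> R) &
    (\int[nu]_y ((T y - T' y) ^+ 2)%:E <= e%:E)%E].
Proof.
move=> B0 mT TB e0.
(* With step h = 2B/K and level sets approximated within 1/K, the error is at most 2 B h (1 + 1) = 8
   B^2 / K. *)
pose K := (Num.truncn (8 * B ^+ 2 / e)).+1.
have K0 : (0 : R) < K%:R by rewrite ltr0n.
have Ke : 8 * B ^+ 2 / K%:R <= e.
  by rewrite ler_pdivrMr// -ler_pdivrMl// mulrC ltW// truncnS_gt.
pose h := 2 * B / K%:R.
have h0 : 0 < h by rewrite divr_gt0// mulr_gt0.
pose A (i : nat) : set (paths J) := T @^-1` `[- B + i.+1%:R * h, +oo[.
have mA i : measurable (A i) by rewrite -[A i]setTI; exact: mT.
have Ki0 : 0 < K%:R^-1 :> R by rewrite invr_gt0.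
have /choice[f fP] : forall i, exists p : seq R * set (R -> R),
    [/\ [set` p.1] `<=` J, <<s cyl [set` p.1] >> p.2 &
        (nu (symdiff (A i) p.2) <= (K%:R^-1)%:E)%E].
  move=> i; have [s [C [? ? ?]]] := approx_cylinder nu (mA i) Ki0.
  by exists (s, C).
pose s := flatten [seq (f i).1 | i <- iota 0 K].
have sE i : (i < K)%N -> [set` (f i).1] `<=` [set` s].
  move=> iK x /= xi; apply/flattenP; exists (f i).1 => //.
  by apply/mapP; exists i => //; rewrite mem_iota.
pose C i := (f i).2.
have mCs i : (i < K)%N -> measurable (C i : set (paths [set` s])).
  by move=> iK; case: (fP i) => _ sC _; exact: (cyl_measurable (sE _ iK) sC).
have mCJ i : measurable (C i : set (paths J)).
  by case: (fP i) => + + _; exact: cyl_measurable.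
pose T' (y : R -> R) := - B + h * \sum_(i < K) \1_(C i) y.
exists s, T'; split.
- move=> x /flattenP[_ /mapP[i _ ->]] xi; case: (fP i) => + _ _; exact.
- apply: measurable_funD => //; apply: measurable_funM => //.
  apply: measurable_sum => i; apply: measurable_indic; exact: mCs.
have mS i : measurable (symdiff (A i) (C i)).
  by apply: measurableU; exact: measurableD.
have mT' : measurable_fun setT (T' : paths J -> R).
  apply: measurable_funD => //; apply: measurable_funM => //.
  apply: measurable_sum => i; exact: measurable_indic.
have ptw y : (T y - T' y) ^+ 2 <= 2 * B * (h * (1 + \sum_(i < K) \1_(symdiff (A i) (C i)) y)).
  pose x := (T y + B) / h.
  have /andP[TB1 TB2] : - B <= T y <= B by rewrite -ler_norml.
  have x0 : 0 <= x by apply: divr_ge0; [lra|exact: ltW].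
  have hE : h * x = T y + B by rewrite /x mulrC divfK// gt_eqF.
  have xK : x <= K%:R.
    rewrite -(ler_pM2l h0) hE /h divfK ?gt_eqF//; lra.
  have [N1 N2] := count_floor K x0.
  set N := (\sum_(i < K) _)%N in N1 N2.
  have NE : \sum_(i < K) \1_(A i) y = N%:R :> R.
    rewrite /N natr_sum; apply: eq_bigr => i _.
    rewrite indicE; congr (_%:R); congr nat_of_bool.
    rewrite /A; apply/idP/idP; rewrite inE/= in_itv/= andbT.
      move=> H; rewrite -(ler_pM2l h0) hE; lra.
    rewrite -(ler_pM2l h0) hE => H; lra.
  have xN : x <= N%:R + 1.
    case: N2 => [->|/ltW]; first by rewrite (le_trans xK)// lerDl.
    by rewrite -natr1.
  have T'B : `|T' y| <= B.
    have S0 : 0 <= \sum_(i < K) \1_(C i) y :> R by apply: sumr_ge0 => i _; rewrite indicE.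
    have SK : \sum_(i < K) \1_(C i) y <= K%:R :> R.
      rewrite -[leRHS]mulr1 -[in leRHS](card_ord K) mulr_natl -sumr_const.
      by apply: ler_sum => i _; rewrite indicE lern1 leq_b1.
    have hK : h * K%:R = 2 * B by rewrite /h divfK// gt_eqF.
    rewrite ler_norml /T'; apply/andP; split.
      by rewrite lerDl mulr_ge0// ltW.
    have := SK; rewrite -(ler_pM2l h0) hK; lra.
  have dB : `|T y - T' y| <= 2 * B.
    by rewrite (le_trans (ler_normB _ _))//; have := TB y; lra.
  rewrite -real_normK ?num_real// expr2 ler_pM//.
  have -> : T y - T' y = h * (x - N%:R) + h * (\sum_(i < K) (\1_(A i) y - \1_(C i) y)).
    rewrite sumrB NE /T' mulrBr mulrBr hE; ring.
  rewrite (le_trans (ler_normD _ _))// [leRHS]mulrDr mulr1 lerD//.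
    rewrite normrM gtr0_norm// ger_pMr// ler_norml; apply/andP; split; lra.
  rewrite normrM gtr0_norm// ler_pM2l// (le_trans (ler_norm_sum _ _ _))//.
  apply: ler_sum => i _; rewrite !indicE /symdiff in_setU !in_setD.
  by case: (y \in A i); case: (y \in C i); rewrite /= ?subrr ?subr0 ?sub0r ?normrN ?normr0 ?normr1.
have mI i : measurable_fun setT (\1_(symdiff (A i) (C i)) : paths J -> R).
  exact: measurable_indic.
have mR : measurable_fun setT (fun y : paths J => 1 + \sum_(i < K) \1_(symdiff (A i) (C i)) y : R).
  by apply: measurable_funD => //; apply: measurable_sum => i; exact: mI.
apply: (@le_trans _ _ (\int[nu]_y (2 * B * h * (1 + \sum_(i < K) \1_(symdiff (A i) (C i))
  y))%:E)%E).
  apply: ge0_le_integral => //=.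
  - by move=> y _; rewrite lee_fin sqr_ge0.
  - by apply/measurable_EFinP; apply: measurable_funX; exact: measurable_funB.
  - by apply/measurable_EFinP; exact: measurable_funM.
  - by move=> y _; rewrite lee_fin -mulrA.
have Bh0 : 0 <= 2 * B * h by rewrite !mulr_ge0// ltW.
under eq_integral do rewrite EFinM.
rewrite ge0_integralZl_EFin//=; last 2 first.
- by move=> y _; rewrite lee_fin addr_ge0// sumr_ge0// => i _; rewrite indicE.
- exact/measurable_EFinP.
have E1 : (\int[nu]_y (1 + \sum_(i < K) \1_(symdiff (A i) (C i)) y)%:E =
    1 + \sum_(i < K) nu (symdiff (A i) (C i)))%E.
  under eq_integral do rewrite EFinD -sumEFin.
  rewrite ge0_integralD//=; last 2 first.
  - by move=> y _; apply: sume_ge0 => i _; rewrite lee_fin indicE.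
  - by apply: emeasurable_sum => i; exact/measurable_EFinP.
  congr (_ + _)%E; first exact: integral_prob_cst.
  rewrite ge0_integral_sum//=; last by move=> i; exact/measurable_EFinP.
  by apply: eq_bigr => i _; rewrite integral_indic// setIT.
rewrite E1.
apply: (@le_trans _ _ ((2 * B * h)%:E * 2%:E)%E).
  apply: lee_wpmul2l; rewrite ?lee_fin//.
  rewrite (_ : 2%:E = 1 + 1)%E// leeD//.
  apply: (@le_trans _ _ (\sum_(i < K) (K%:R^-1)%:E)%E).
    by apply: lee_sum => i _; case: (fP i).
  rewrite sumEFin lee_fin sumr_const card_ord -[leLHS]mulr_natr mulVf ?gt_eqF//.
rewrite -EFinM lee_fin (le_trans _ Ke)// /h le_eqVlt; apply/orP; left; apply/eqP.
by field; rewrite gt_eqF.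
Qed.

End approximation.

(** * From grid observations to the whole path *)

Section bayes.
Context (R : realType) d (T : measurableType d) (P : probability T R)
  (W : R -> T -> R).
Hypothesis hW : standard_brownian P W.

Lemma le_of_perturbation (v : R) (I : \bar R) : (0 <= I)%E ->
  (forall e : R, 0 < e -> e <= 1 -> (v%:E <= (1 + e)%:E * I + e%:E)%E) ->
  (v%:E <= I)%E.
Proof.
case: I => [x| |]//; last by move=> _ _; rewrite leey.
rewrite lee_fin => x0 H; rewrite lee_fin; apply/ler_addgt0Pr => e e0.
pose de := Order.min 1 (e / (x + 1)).
have x1 : 0 < x + 1 by rewrite ltr_wpDl.
have de0 : 0 < de by rewrite lt_min ltr01 divr_gt0.
have := H de de0; rewrite ge_min lexx => /(_ isT).
rewrite -EFinM -EFinD lee_fin => /le_trans; apply.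
have : de * (x + 1) <= e by rewrite -ler_pdivlMr// ge_min lexx orbT.
lra.
Qed.

(** The time 0 is adjoined because [bayes_grid] requires a grid that starts there. *)
Lemma sorted_grid (a : R) (sq : seq R) : 0 <= a -> [set` sq] `<=` `[0, a] ->
  exists (N : nat) (t : nat -> R), [/\ t 0%N = 0,
    (forall i, (i < N)%N -> t i < t i.+1), t N <= a &
    [set` sq] `<=` [set t i | i in [set i | (i <= N)%N]]].
Proof.
move=> a0 sa; pose s := sort <=%R (undup (0 :: sq)).
have sE x : (x \in s) = (x \in 0 :: sq) by rewrite mem_sort mem_undup.
have ss : sorted <%R s.
  by rewrite lt_sorted_uniq_le sort_uniq undup_uniq sort_le_sorted.
have s0 : (0 < size s)%N.
  have : 0 \in s by rewrite sE mem_head.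
  by rewrite -index_mem => /(leq_ltn_trans (leq0n _)).
have sin i : (i < size s)%N -> nth 0 s i \in `[0, a].
  move=> /(mem_nth 0); rewrite sE inE => /orP[/eqP ->|/sa//].
  by rewrite in_itv/= lexx.
exists (size s).-1, (nth 0 s); split.
- apply/eqP; rewrite eq_le; apply/andP; split; last first.
    by have := sin _ s0; rewrite in_itv/= => /andP[].
  have z : 0 \in s by rewrite sE mem_head.
  rewrite -[leRHS](nth_index 0 z).
  apply: (sorted_leq_nth le_trans le_refl) => //.
  - by apply: sort_le_sorted.
  - by rewrite inE index_mem.
- move=> i iN; apply: (sorted_ltn_nth lt_trans) => //.
  + by rewrite inE (ltn_trans iN)// prednK.
  + by rewrite inE -(prednK s0) ltnS.
- have := sin (size s).-1; rewrite prednK// => /(_ (leqnn _)).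
  by rewrite in_itv/= => /andP[].
- move=> x /= xs.
  have z : x \in s by rewrite sE inE xs orbT.
  by exists (index x s); [rewrite /= -ltnS prednK// index_mem|exact: nth_index].
Qed.

(** The condition on [Psi] and [E] is the Cauchy-Schwarz inequality when [E] is a primitive of the
    squared derivative of [Psi]. It bounds the information of every grid by [E a - E 0], so v is a
    lower bound for all grids at once. The statistic is approximated in L^2 under the law of the
    observations averaged over the prior. *)
Lemma bayes_brownian (a : R) (Psi E : R -> R) (T' : paths `[0, a] -> R) (B s v : R) :
  0 <= a -> Psi 0 = 0 ->
  (forall p q, 0 <= p -> p < q -> q <= a ->
    (Psi q - Psi p) ^+ 2 <= (q - p) * (E q - E p)) ->
  0 < B -> measurable_fun setT T' -> (forall y, `|T' y| <= B) ->
  0 < s -> 0 < v -> v^-1 = s ^- 2 + (E a - E 0) ->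
  (v%:E <= \int[normal_prob 0 s]_u \int[P]_w
     ((T' (fun r => (W r w + u * Psi r)%R) - u) ^+ 2)%:E)%E.
Proof.
move=> a0 Psi0 PsiE B0 mT' T'B s0 v0 vE.
pose pth (p : measurableTypeR R * T) : paths `[0, a] := fun r => W r p.2 + p.1 * Psi r.
have mpth : measurable_fun setT pth.
  apply: measurable_to_paths => r /=; rewrite in_itv/= => /andP[r0 _].
  apply: measurable_funD.
    exact: (measurableT_comp (measurable_brownian hW r0) measurable_snd).
  by apply: measurable_funM => //; exact: measurable_fst.
pose mpth' := isMeasurableFun.Build _ _ _ _ pth mpth.
pose pm : {mfun _ >-> _} := HB.pack pth mpth'.
pose nu := distribution (normal_prob 0 s \x P)%E pm.
have m1 : measurable_fun setT (fun p : measurableTypeR R * T => p.1 : R) by exact: measurable_fst.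
pose loss (f : (R -> R) -> R) (p : measurableTypeR R * T) : \bar R :=
  ((f (pth p) - p.1) ^+ 2)%:E.
have mloss (f : paths `[0, a] -> R) : measurable_fun setT f -> measurable_fun setT (loss f).
  move=> mf; apply/measurable_EFinP; apply: measurable_funX.
  by apply: measurable_funB => //; exact: (measurableT_comp mf mpth).
have loss0 f p : (0 <= loss f p)%E by rewrite lee_fin sqr_ge0.
have lossE (f : paths `[0, a] -> R) : measurable_fun setT f ->
    (\int[normal_prob 0 s]_u \int[P]_w
       ((f (fun r => W r w + u * Psi r) - u) ^+ 2)%:E =
     \int[normal_prob 0 s \x P]_p loss f p)%E.
  by move=> mf; rewrite (@fubini_tonelli1 _ _ _ _ R _ _ (loss f))//; exact: mloss.
rewrite lossE//; apply: le_of_perturbation.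
  by apply: integral_ge0.
move=> e e0 e1.
(* In (x - y)^2 <= (1 + e) x^2 + (1 + 1/e) y^2 the weight of the approximation error turns e^2/2
   into (e^2 + e)/2 <= e. *)
have ee0 : 0 < e ^+ 2 / 2 by rewrite divr_gt0// exprn_gt0.
have [sq [T2 [sJ mT2 HT2]]] := approx_fun nu B0 mT' T'B ee0.
have [N [t [t0 tS tN sqt]]] := sorted_grid a0 sJ.
have Et i : (i <= N)%N -> 0 <= t i.
  by apply: grid_ge0 => //; rewrite t0.
have tle i : (i <= N)%N -> t i <= a.
  by move=> iN; rewrite (le_trans _ tN)//; exact: (grid_le tS).
pose c := \sum_(i < N) (Psi (t i.+1) - Psi (t i)) ^+ 2 / (t i.+1 - t i).
have c0 : 0 <= c.
  by apply: sumr_ge0 => i _; rewrite divr_ge0 ?sqr_ge0// subr_ge0 ltW// tS.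
have cE : c <= E a - E 0.
  apply: (@le_trans _ _ (E (t N) - E 0)).
    rewrite -[X in _ - E X]t0.
    rewrite -(telescope_sumr (fun i => E (t i)) (leq0n N)) big_mkord.
    apply: ler_sum => i _; rewrite ler_pdivrMr ?subr_gt0 ?tS// mulrC.
    by apply: PsiE; [exact/Et/ltnW|exact: tS|exact: tle].
  rewrite lerD2r.
  move: tN; rewrite le_eqVlt => /predU1P[-> //|tNa].
  rewrite -subr_ge0 -(@pmulr_rge0 _ (a - t N)) ?subr_gt0//.
  by apply: le_trans (PsiE _ _ (Et N (leqnn N)) tNa (lexx a)); exact: sqr_ge0.
pose v' := (s ^- 2 + c)^-1.
have s20 : 0 < s ^- 2 by rewrite invr_gt0 exprn_gt0.
have v'0 : 0 < v' by rewrite invr_gt0 ltr_wpDr.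
have vv' : v <= v'.
  rewrite -[v]invrK vE lef_pV2 ?posrE; first by rewrite lerD2l.
    by apply: ltr_wpDr => //; exact: le_trans cE.
  exact: ltr_wpDr.
have mT2g : measurable_fun setT (T2 : paths [set t i | i in [set i | (i <= N)%N]] -> R).
  move=> _ A mA; have := mT2 measurableT A mA; rewrite !setTI.
  exact: sub_cyl.
have mT2J : measurable_fun setT (T2 : paths `[0, a] -> R).
  move=> _ A mA; have := mT2 measurableT A mA; rewrite !setTI.
  exact: sub_cyl.
have H1 : (v%:E <= \int[normal_prob 0 s \x P]_p loss T2 p)%E.
  rewrite -lossE//; apply: (@le_trans _ _ v'%:E); first by rewrite lee_fin.
  apply: (bayes_grid hW t0 tS mT2g Psi0 s0 v'0).
  by rewrite /v' invrK.
have H2 : (\int[normal_prob 0 s \x P]_p ((T' (pth p) - T2 (pth p)) ^+ 2)%:E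
    <= (e ^+ 2 / 2)%:E)%E.
  move: HT2; rewrite /nu ge0_integral_distribution//.
    by apply/measurable_EFinP; apply: measurable_funX; exact: measurable_funB.
  by move=> y; rewrite lee_fin sqr_ge0.
apply: (le_trans H1).
have md : measurable_fun setT (fun p => ((T' (pth p) - T2 (pth p)) ^+ 2)%:E).
  apply/measurable_EFinP; apply: measurable_funX; apply: measurable_funB.
    exact: (measurableT_comp mT' mpth).
  exact: (measurableT_comp mT2J mpth).
have ei0 : 0 <= 1 + e^-1 by rewrite addr_ge0// invr_ge0 ltW.
have e10 : 0 <= 1 + e by rewrite addr_ge0// ltW.
apply: (@le_trans _ _ (\int[normal_prob 0 s \x P]_p ((1 + e)%:E * loss T' p +
    (1 + e^-1)%:E * ((T' (pth p) - T2 (pth p)) ^+ 2)%:E))%E).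
  apply: ge0_le_integral => //=.
  - exact: mloss.
  - apply: emeasurable_funD; apply: emeasurable_funM => //; exact: mloss.
  move=> p _; rewrite /loss -!EFinM -EFinD lee_fin.
  set x := T' _ - p.1; set y := T' _ - T2 _.
  have -> : T2 (pth p) - p.1 = x - y by rewrite /x /y; ring.
  rewrite -subr_ge0.
  have -> : (1 + e) * x ^+ 2 + (1 + e^-1) * y ^+ 2 - (x - y) ^+ 2 =
    e * (x + e^-1 * y) ^+ 2.
    by field; rewrite gt_eqF.
  by rewrite mulr_ge0 ?sqr_ge0// ltW.
rewrite ge0_integralD//=; last 4 first.
- by move=> p _; rewrite mule_ge0// lee_fin.
- by apply: emeasurable_funM => //; exact: mloss.
- by move=> p _; rewrite mule_ge0// lee_fin ?sqr_ge0.
- exact: emeasurable_funM.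
rewrite !ge0_integralZl_EFin//=; last 2 first.
- by move=> p _; rewrite lee_fin sqr_ge0.
- exact: mloss.
apply: leeD => //.
apply: (@le_trans _ _ ((1 + e^-1)%:E * (e ^+ 2 / 2)%:E)%E).
  by apply: lee_wpmul2l; rewrite ?lee_fin.
rewrite -EFinM lee_fin.
have -> : (1 + e^-1) * (e ^+ 2 / 2) = (e ^+ 2 + e) / 2 by field; rewrite gt_eqF.
have : e ^+ 2 <= e by rewrite expr2 ger_pMr.
lra.
Qed.

End bayes.

(** * Fourier series and the function class *)

Section square_integrable.
Context (R : realType).
Local Notation mu := (@lebesgue_measure R).
Local Notation I := (`[0%R, 1%R]%classic : set R).

Definition sqint (f : R -> R) := measurable_fun I f /\ (sqnorm f < +oo)%E.

Definition ip (f g : R -> R) : R := \int[mu]_(x in I) (f x * g x).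

Lemma integrable_sq f : sqint f -> mu.-integrable I (fun x => ((f x) ^+ 2)%:E).
Proof.
move=> [mf foo]; apply/integrableP; split.
  by apply/measurable_EFinP; exact: measurable_funX.
under eq_integral do rewrite gee0_abs ?lee_fin ?sqr_ge0//.
exact: foo.
Qed.

Lemma integrable_mul f g : sqint f -> sqint g ->
  mu.-integrable I (fun x => (f x * g x)%:E).
Proof.
move=> qf qg.
apply: (@le_integrable _ _ _ mu I _ _ (fun x => ((f x) ^+ 2)%:E + ((g x) ^+ 2)%:E)%E) => //.
- by apply/measurable_EFinP; apply: measurable_funM; [case: qf|case: qg].
- move=> x _; rewrite -EFinD !abse_EFin lee_fin [leRHS]ger0_norm ?addr_ge0 ?sqr_ge0//.
  rewrite normrM; set a := `|f x|; set b := `|g x|.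
  rewrite -(real_normK (num_real (f x))) -(real_normK (num_real (g x))) -/a -/b.
  have := sqr_ge0 (a - b); have := mulr_ge0 (normr_ge0 (f x)) (normr_ge0 (g x)).
  rewrite -/a -/b; nra.
- by apply: integrableD => //; exact: integrable_sq.
Qed.

Lemma sqnormE f : sqint f -> sqnorm f = (ip f f)%:E.
Proof.
move=> qf; rewrite /sqnorm /ip /Rintegral fineK.
  by apply: eq_integral => x _; rewrite expr2.
exact: integrable_fin_num (integrable_mul qf qf).
Qed.

Lemma ip_ge0 f : 0 <= ip f f.
Proof. by apply: Rintegral_ge0 => x _; rewrite -expr2 sqr_ge0. Qed.

Lemma sqint_lin a f g : sqint f -> sqint g -> sqint (fun x => a * f x + g x).
Proof.
move=> qf qg; have [mf _] := qf; have [mg _] := qg.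
have m : measurable_fun I (fun x => a * f x + g x).
  by apply: measurable_funD => //; exact: measurable_funM.
split => //; apply: (@le_lt_trans _ _
    (\int[mu]_(x in I) ((2 * a ^+ 2)%:E * ((f x) ^+ 2)%:E + 2%:E * ((g x) ^+ 2)%:E))%E).
  apply: ge0_le_integral => //.
  - by move=> x _; rewrite lee_fin sqr_ge0.
  - by apply/measurable_EFinP; exact: measurable_funX.
  - apply: emeasurable_funD; apply: emeasurable_funM => //;
      by apply/measurable_EFinP; exact: measurable_funX.
  - move=> x _; rewrite -!EFinM -EFinD lee_fin.
    by have := sqr_ge0 (a * f x - g x); nra.
have H : mu.-integrable I (fun x => (2 * a ^+ 2)%:E * ((f x) ^+ 2)%:E +
    2%:E * ((g x) ^+ 2)%:E)%E.
  by apply: integrableD => //; apply: integrableZl => //; exact: integrable_sq.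
case/integrableP: H => _; apply: le_lt_trans.
rewrite le_eqVlt; apply/orP; left; apply/eqP; apply: eq_integral => x _.
rewrite gee0_abs//; rewrite -!EFinM -EFinD lee_fin.
exact: (addr_ge0 (mulr_ge0 (mulr_ge0 (ler0n _ 2) (sqr_ge0 _)) (sqr_ge0 _))
  (mulr_ge0 (ler0n _ 2) (sqr_ge0 _))).
Qed.

Lemma sqint_ext f g : {in I, f =1 g} -> sqint f -> sqint g.
Proof.
move=> fg [mf foo]; split; first exact: eq_measurable_fun mf.
suff -> : sqnorm g = sqnorm f by [].
by apply: eq_integral => x xI; rewrite fg.
Qed.

Lemma ipC f g : ip f g = ip g f.
Proof. by apply: eq_Rintegral => x _; rewrite mulrC. Qed.

Lemma ip_lin a f g h : sqint f -> sqint g -> sqint h ->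
  ip (fun x => a * f x + g x) h = a * ip f h + ip g h.
Proof.
move=> qf qg qh; rewrite /ip -RintegralZl//; last exact: integrable_mul.
rewrite -RintegralD//; last 2 first.
- by apply: (@integrableZl _ _ _ mu I _ a (fun x => (f x * h x)%:E)) => //; exact: integrable_mul.
- exact: integrable_mul.
by apply: eq_Rintegral => x _; ring.
Qed.

Lemma sqint_cont f : {within I, continuous f} -> sqint f.
Proof.
move=> cf; split; first exact: subspace_continuous_measurable_fun.
have c2 : {within I, continuous (fun x => f x * f x)}.
  by move=> x; apply: continuousM; exact: cf.
have : mu.-integrable I (EFin \o (fun x => f x * f x)).
  by apply: continuous_compact_integrable => //; exact: segment_compact.
case/integrableP => _; apply: le_lt_trans.
rewrite le_eqVlt; apply/orP; left; apply/eqP; apply: eq_integral => x _ /=.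
by rewrite ger0_norm -expr2 ?sqr_ge0.
Qed.

Lemma sqint_cst c : sqint (fun=> c).
Proof. by apply: sqint_cont => x; exact: cst_continuous. Qed.

Section orthonormal.
Variable phi : nat -> R -> R.
Hypothesis qphi : forall i, sqint (phi i).
Hypothesis ophi : forall i j, ip (phi i) (phi j) = (i == j)%:R.

Definition tsum (c : nat -> R) N (x : R) : R := \sum_(i < N) c i * phi i x.

Lemma tsumS c N x : tsum c N.+1 x = c N * phi N x + tsum c N x.
Proof. by rewrite /tsum big_ord_recr/= addrC. Qed.

Lemma sqint_tsum c N : sqint (tsum c N).
Proof.
elim: N => [|N IH]; first by apply: sqint_ext (sqint_cst 0) => x _; rewrite /tsum big_ord0.
by apply: sqint_ext (sqint_lin (c N) (qphi N) IH) => x _; rewrite tsumS.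
Qed.

Lemma ip_tsum c N g : sqint g -> ip (tsum c N) g = \sum_(i < N) c i * ip (phi i) g.
Proof.
move=> qg; elim: N => [|N IH].
  rewrite big_ord0 /ip (@eq_Rintegral _ _ _ _ _ (fun=> 0)) ?Rintegral_cst ?mul0r//.
  by move=> x _; rewrite /tsum big_ord0 mul0r.
rewrite big_ord_recr/= addrC -IH -ip_lin//; last exact: sqint_tsum.
by apply: eq_Rintegral => x _; rewrite tsumS.
Qed.

Lemma ip_tsum_phi c N j : (j < N)%N -> ip (tsum c N) (phi j) = c j.
Proof.
move=> jN; rewrite ip_tsum// (bigD1 (Ordinal jN))//= ophi eqxx mulr1.
rewrite big1 ?addr0// => i ij; rewrite ophi.
suff /negbTE -> : val i != j by rewrite mulr0.
by apply: contra ij => /eqP ij; apply/eqP/val_inj.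
Qed.

Lemma ip_tsum_tsum c N : ip (tsum c N) (tsum c N) = \sum_(i < N) c i ^+ 2.
Proof.
rewrite ip_tsum; last exact: sqint_tsum.
by apply: eq_bigr => i _; rewrite ipC ip_tsum_phi.
Qed.

Lemma ip_sub f g : sqint f -> sqint g ->
  ip (fun x => f x - g x) (fun x => f x - g x) = ip f f - 2 * ip f g + ip g g.
Proof.
move=> qf qg.
have E (h : R -> R) : sqint h ->
    ip (fun x => f x - g x) h = ip f h - ip g h.
  move=> qh; rewrite -[ip f h - _]addrC -mulN1r -ip_lin//.
  by apply: eq_Rintegral => x _; ring.
have qd : sqint (fun x => f x - g x).
  by apply: sqint_ext (sqint_lin (-1) qg qf) => x _; ring.
by rewrite E// [ip f (fun _ => _)]ipC [ip g (fun _ => _)]ipC !E// (ipC g f); ring.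
Qed.

(** Pythagoras: the errors on the first N coefficients and the part of [f] beyond them are
    orthogonal. The upper bound uses both terms, the lower bound the first. *)
Lemma sqnorm_tsum_sub c N f : sqint f ->
  sqnorm (fun x => tsum c N x - f x) =
  (\sum_(i < N) (c i - ip f (phi i)) ^+ 2 +
   (ip f f - \sum_(i < N) ip f (phi i) ^+ 2))%:E.
Proof.
move=> qf; have qt := sqint_tsum c N.
have qd : sqint (fun x => tsum c N x - f x).
  by apply: sqint_ext (sqint_lin (-1) qf qt) => x _; ring.
rewrite sqnormE// ip_sub// ip_tsum_tsum ip_tsum//; congr EFin.
have -> : \sum_(i < N) (c i - ip f (phi i)) ^+ 2 = \sum_(i < N) c i ^+ 2 -
    2 * (\sum_(i < N) c i * ip (phi i) f) + \sum_(i < N) ip f (phi i) ^+ 2.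
  rewrite mulr_sumr -sumrB -big_split/=; apply: eq_bigr => i _.
  by rewrite (ipC (phi i)); ring.
by ring.
Qed.

Lemma bessel N f : sqint f -> \sum_(i < N) ip f (phi i) ^+ 2 <= ip f f.
Proof.
move=> qf; have qt := sqint_tsum (fun i => ip f (phi i)) N.
have qd : sqint (fun x => tsum (fun i => ip f (phi i)) N x - f x).
  by apply: sqint_ext (sqint_lin (-1) qf qt) => x _; ring.
have := sqnorm_tsum_sub (fun i => ip f (phi i)) N qf.
rewrite sqnormE// => -[].
rewrite big1 ?add0r; last by move=> i _; rewrite subrr expr0n.
by move=> E; rewrite -subr_ge0 -E ip_ge0.
Qed.

Lemma sqnorm_tsum_sub_ge (c : nat -> R) N f : sqint f ->
  ((\sum_(i < N) (c i - ip f (phi i)) ^+ 2)%:E <= sqnorm (fun x => f x - tsum c N x)%R)%E.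
Proof.
move=> qf; rewrite [leRHS](_ : _ = sqnorm (fun x => tsum c N x - f x)).
  by rewrite sqnorm_tsum_sub// lee_fin lerDl subr_ge0 bessel.
by apply: eq_integral => x _; congr EFin; ring.
Qed.

End orthonormal.

End square_integrable.

(** * The trigonometric basis *)

Section trigonometric.
Context (R : realType).
Local Notation mu := (@lebesgue_measure R).
Local Notation I := (`[0%R, 1%R]%classic : set R).
Local Notation omega := (2 * pi : R).

Lemma is_derive_cosM (w x : R) :
  is_derive x 1 (fun y : R => cos (w * y)) (- (w * sin (w * x))).
Proof.
have h : is_derive x 1 (fun y : R => w * y) w.
  apply: (@is_derive_eq _ _ _ _ _ _ _ _ (is_deriveZ w (is_derive_id x (1 : R)))).
  by rewrite /GRing.scale/= mulr1.
apply: (@is_derive_eq _ _ _ _ _ _ _ _ (is_derive1_comp (is_derive_cos (w * x)) h)).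
by rewrite mulNr mulrC.
Qed.

Lemma is_derive_sinM (w x : R) :
  is_derive x 1 (fun y : R => sin (w * y)) (w * cos (w * x)).
Proof.
have h : is_derive x 1 (fun y : R => w * y) w.
  apply: (@is_derive_eq _ _ _ _ _ _ _ _ (is_deriveZ w (is_derive_id x (1 : R)))).
  by rewrite /GRing.scale/= mulr1.
apply: (@is_derive_eq _ _ _ _ _ _ _ _ (is_derive1_comp (is_derive_sin (w * x)) h)).
by rewrite mulrC.
Qed.

Lemma is_derive_continuous (f df : R -> R) : (forall x : R, is_derive x 1 f (df x)) ->
  continuous f.
Proof.
move=> fd x; apply: differentiable_continuous; apply/derivable1_diffP.
by case: (fd x).
Qed.

Lemma continuous_cosM (w : R) : continuous (fun y : R => cos (w * y)).
Proof. exact: is_derive_continuous (is_derive_cosM w). Qed.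

Lemma continuous_sinM (w : R) : continuous (fun y : R => sin (w * y)).
Proof. exact: is_derive_continuous (is_derive_sinM w). Qed.

Lemma derivable_oo_LR (F f : R -> R) a b : (forall x : R, is_derive x 1 F (f x)) ->
  derivable_oo_LRcontinuous F a b.
Proof.
move=> Fd; have cF := is_derive_continuous Fd; split.
- by move=> x _; case: (Fd x).
- exact/cvg_at_right_filter/cF.
- exact/cvg_at_left_filter/cF.
Qed.

Lemma Rintegral_derive (F f : R -> R) a b : a <= b ->
  (forall x : R, is_derive x 1 F (f x)) -> continuous f ->
  \int[mu]_(x in `[a, b]) f x = F b - F a.
Proof.
move=> ab Fd cf; move: ab; rewrite le_eqVlt => /predU1P[<-|ab].
  by rewrite subrr set_itv1 Rintegral_set1.
rewrite /Rintegral (@continuous_FTC2 _ f F)//.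
- exact: continuous_subspaceT.
- exact: derivable_oo_LR Fd.
- by move=> x _; rewrite derive1E; case: (Fd x).
Qed.

Lemma cos_omega (x : R) l : cos (omega * l%:R + x) = cos x.
Proof.
rewrite addrC (_ : omega * l%:R = (pi *+ 2) *+ l); last first.
  by rewrite -[RHS]mulr_natr -[pi *+ 2]mulr_natl.
by rewrite (periodicn (@cosD2pi R)).
Qed.

Lemma sin_omega (x : R) l : sin (omega * l%:R + x) = sin x.
Proof.
rewrite addrC (_ : omega * l%:R = (pi *+ 2) *+ l); last first.
  by rewrite -[RHS]mulr_natr -[pi *+ 2]mulr_natl.
by rewrite (periodicn (@sinD2pi R)).
Qed.

Lemma omega_gt0 : 0 < omega.
Proof. by rewrite mulr_gt0// pi_gt0. Qed.

Lemma Rintegral_cstI (c : R) : \int[mu]_(x in I) c = c.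
Proof.
have muI : mu I = 1%E.
  by rewrite lebesgue_measure_itv/= lte_fin ltr01 oppr0 adde0.
transitivity (c * fine (mu I)); first exact: Rintegral_cst.
by rewrite muI mulr1.
Qed.

Lemma Rintegral_cos l : \int[mu]_(x in I) cos (omega * l%:R * x) = (l == 0%N)%:R.
Proof.
have [->|l0] := eqVneq l 0%N.
  rewrite (@eq_Rintegral _ _ _ _ _ (fun=> 1)).
    exact: Rintegral_cstI.
  by move=> x _; rewrite mulr0 mul0r cos0.
set w := omega * l%:R; have w0 : w != 0.
  by rewrite mulf_neq0 ?pnatr_eq0// gt_eqF// omega_gt0.
transitivity (w^-1 * sin (w * 1) - w^-1 * sin (w * 0)).
  apply: (@Rintegral_derive (fun x => w^-1 * sin (w * x)) (fun x => cos (w * x))) => //.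
    move=> x; apply: (@is_derive_eq _ _ _ _ _ _ _ _ (is_deriveZ w^-1 (is_derive_sinM w x))).
    by rewrite /GRing.scale/= mulKf.
  exact: continuous_cosM.
by rewrite mulr1 mulr0 sin0 mulr0 subr0 -[w in sin w]addr0 /w sin_omega sin0 mulr0.
Qed.

Lemma Rintegral_sin l : \int[mu]_(x in I) sin (omega * l%:R * x) = 0.
Proof.
have [->|l0] := eqVneq l 0%N.
  rewrite (@eq_Rintegral _ _ _ _ _ (fun=> 0)).
    exact: Rintegral_cstI.
  by move=> x _; rewrite mulr0 mul0r sin0.
set w := omega * l%:R; have w0 : w != 0.
  by rewrite mulf_neq0 ?pnatr_eq0// gt_eqF// omega_gt0.
transitivity (- w^-1 * cos (w * 1) - - w^-1 * cos (w * 0)).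
  apply: (@Rintegral_derive (fun x => (- w^-1) * cos (w * x)) (fun x => sin (w * x))) => //.
    move=> x; apply: (@is_derive_eq _ _ _ _ _ _ _ _ (is_deriveZ (- w^-1) (is_derive_cosM w x))).
    by rewrite /GRing.scale/= mulrNN mulKf.
  exact: continuous_sinM.
by rewrite mulr1 mulr0 -[w in cos w]addr0 /w cos_omega subrr.
Qed.

Lemma sqint_continuous (f : R -> R) : continuous f -> sqint f.
Proof. by move=> cf; apply: sqint_cont; exact: continuous_subspaceT. Qed.

Lemma Rintegrable_cont (f : R -> R) : {within I, continuous f} ->
  mu.-integrable I (fun x => (f x)%:E).
Proof. by move=> cf; apply: continuous_compact_integrable => //; exact: segment_compact. Qed.

(** Product-to-sum formula. The second indicator is that of p = q = 0, where the constant function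
    has squared norm 1 instead of 1/2. *)
Lemma ip_cos_cos p q :
  ip (fun x : R => cos (omega * p%:R * x)) (fun x => cos (omega * q%:R * x)) =
  ((p == q)%:R + (p + q == 0)%N%:R) / 2.
Proof.
wlog qp : p q / (q <= p)%N.
  move=> H; have [/H//|/ltnW/H] := leqP q p.
  by rewrite ipC eq_sym addnC.
transitivity (\int[mu]_(x in I)
    (2^-1 * (cos (omega * (p - q)%:R * x) + cos (omega * (p + q)%:R * x)))); last first.
  have i1 n : mu.-integrable I (fun x : R => (cos (omega * n%:R * x))%:E).
    by apply: Rintegrable_cont; apply: continuous_subspaceT; exact: continuous_cosM.
  rewrite RintegralZl//; last first.
    by apply: Rintegrable_cont; apply: continuous_subspaceT => y;
      apply: continuousD; exact: continuous_cosM.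
  rewrite RintegralD; [|by []|exact: i1|exact: i1].
  transitivity (2^-1 * (((p - q)%N == 0%N)%:R + ((p + q)%N == 0%N)%:R) : R).
    by congr (_ * (_ + _)); exact: Rintegral_cos.
  rewrite mulrC subn_eq0; congr ((_%:R + _) / _).
  by rewrite (eqn_leq p) qp andbT.
apply: eq_Rintegral => x _.
have -> : omega * (p - q)%:R * x = omega * p%:R * x - omega * q%:R * x.
  by rewrite natrB//; ring.
have -> : omega * (p + q)%:R * x = omega * p%:R * x + omega * q%:R * x.
  by rewrite natrD; ring.
rewrite cosB cosD.
by field.
Qed.

Lemma ip_sin_sin p q :
  ip (fun x : R => sin (omega * p%:R * x)) (fun x => sin (omega * q%:R * x)) =
  ((p == q)%:R - (p + q == 0)%N%:R) / 2.
Proof.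
wlog qp : p q / (q <= p)%N.
  move=> H; have [/H//|/ltnW/H] := leqP q p.
  by rewrite ipC eq_sym addnC.
transitivity (\int[mu]_(x in I)
    (2^-1 * (cos (omega * (p - q)%:R * x) - cos (omega * (p + q)%:R * x)))); last first.
  have i1 n : mu.-integrable I (fun x : R => (cos (omega * n%:R * x))%:E).
    by apply: Rintegrable_cont; apply: continuous_subspaceT; exact: continuous_cosM.
  rewrite RintegralZl//; last first.
    by apply: Rintegrable_cont; apply: continuous_subspaceT => y;
      apply: continuousB; exact: continuous_cosM.
  rewrite RintegralB; [|by []|exact: i1|exact: i1].
  transitivity (2^-1 * (((p - q)%N == 0%N)%:R - ((p + q)%N == 0%N)%:R) : R).
    by congr (_ * (_ - _)); exact: Rintegral_cos.
  rewrite mulrC subn_eq0; congr ((_%:R - _) / _).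
  by rewrite (eqn_leq p) qp andbT.
apply: eq_Rintegral => x _.
have -> : omega * (p - q)%:R * x = omega * p%:R * x - omega * q%:R * x.
  by rewrite natrB//; ring.
have -> : omega * (p + q)%:R * x = omega * p%:R * x + omega * q%:R * x.
  by rewrite natrD; ring.
rewrite cosB cosD.
by field.
Qed.

Lemma ip_sin_cos p q :
  ip (fun x : R => sin (omega * p%:R * x)) (fun x => cos (omega * q%:R * x)) = 0.
Proof.
have i1 n : mu.-integrable I (fun x : R => (sin (omega * n%:R * x))%:E).
  by apply: Rintegrable_cont; apply: continuous_subspaceT; exact: continuous_sinM.
have [qp|/ltnW qp] := leqP q p.
  transitivity (\int[mu]_(x in I)
    (2^-1 * (sin (omega * (p - q)%:R * x) + sin (omega * (p + q)%:R * x)))); last first.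
    rewrite RintegralZl//; last first.
      by apply: Rintegrable_cont; apply: continuous_subspaceT => y;
        apply: continuousD; exact: continuous_sinM.
    rewrite RintegralD; [|by []|exact: i1|exact: i1].
    transitivity (2^-1 * (0 + 0) : R).
      by congr (_ * (_ + _)); exact: Rintegral_sin.
    by rewrite addr0 mulr0.
  apply: eq_Rintegral => x _.
  have -> : omega * (p - q)%:R * x = omega * p%:R * x - omega * q%:R * x.
    by rewrite natrB//; ring.
  have -> : omega * (p + q)%:R * x = omega * p%:R * x + omega * q%:R * x.
    by rewrite natrD; ring.
  rewrite sinB sinD.
  by field.
transitivity (\int[mu]_(x in I)
    (2^-1 * (sin (omega * (p + q)%:R * x) - sin (omega * (q - p)%:R * x)))); last first.
  rewrite RintegralZl//; last first.
    by apply: Rintegrable_cont; apply: continuous_subspaceT => y;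
      apply: continuousB; exact: continuous_sinM.
  rewrite RintegralB; [|by []|exact: i1|exact: i1].
    transitivity (2^-1 * (0 - 0) : R).
    by congr (_ * (_ - _)); exact: Rintegral_sin.
  by rewrite subr0 mulr0.
apply: eq_Rintegral => x _.
have -> : omega * (q - p)%:R * x = omega * q%:R * x - omega * p%:R * x.
  by rewrite natrB//; ring.
have -> : omega * (p + q)%:R * x = omega * p%:R * x + omega * q%:R * x.
  by rewrite natrD; ring.
rewrite sinB sinD.
by field.
Qed.

(** Indices start from 0, as for ordinals: 0 is the constant, odd indices are cosines, positive even
    ones sines. *)
Definition tb i : R -> R := trig_basis i.+1.

Definition freq i : R := omega * (uphalf i)%:R.

Lemma tb0 : tb 0 = fun x => cos (omega * 0%:R * x).
Proof. by apply/funext => x; rewrite mulr0 mul0r cos0. Qed.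

Lemma tb_cos l : tb l.*2.+1 = fun x => Num.sqrt 2 * cos (omega * l.+1%:R * x).
Proof. by apply/funext => x; rewrite /tb /trig_basis/= odd_double/= doubleK. Qed.

Lemma tb_sin l : tb l.*2.+2 = fun x => Num.sqrt 2 * sin (omega * l.+1%:R * x).
Proof.
by apply/funext => x; rewrite /tb /trig_basis/= odd_double/= uphalf_double.
Qed.

Lemma freq0 : freq 0 = 0. Proof. by rewrite /freq/= mulr0. Qed.

Lemma freq_odd l : freq l.*2.+1 = omega * l.+1%:R.
Proof. by rewrite /freq/= doubleK. Qed.

Lemma freq_even l : freq l.*2.+2 = omega * l.+1%:R.
Proof. by rewrite /freq/= uphalf_double. Qed.

Lemma tb_ind (Q : nat -> Prop) : Q 0%N -> (forall l, Q l.*2.+1) ->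
  (forall l, Q l.*2.+2) -> forall i, Q i.
Proof.
move=> Q0 Qo Qe [//|i]; rewrite -(odd_double_half i).
by case: (odd i); rewrite ?add1n ?add0n.
Qed.

Lemma is_derive_tb_odd l (x : R) : is_derive x 1 (tb l.*2.+1) (- freq l.*2.+1 * tb l.*2.+2 x).
Proof.
rewrite tb_cos tb_sin freq_odd.
apply: (@is_derive_eq _ _ _ _ _ _ _ _ (is_deriveZ (Num.sqrt 2) (is_derive_cosM _ x))).
by rewrite /GRing.scale/=; ring.
Qed.

Lemma is_derive_tb_even l (x : R) : is_derive x 1 (tb l.*2.+2) (freq l.*2.+2 * tb l.*2.+1 x).
Proof.
rewrite tb_cos tb_sin freq_even.
apply: (@is_derive_eq _ _ _ _ _ _ _ _ (is_deriveZ (Num.sqrt 2) (is_derive_sinM _ x))).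
by rewrite /GRing.scale/=; ring.
Qed.

Lemma is_derive_tb0 (x : R) : is_derive x 1 (tb 0) 0.
Proof. exact: is_derive_cst. Qed.

Lemma continuous_tb i : continuous (tb i).
Proof.
elim/tb_ind: i => [|l|l].
- exact: is_derive_continuous is_derive_tb0.
- exact: is_derive_continuous (is_derive_tb_odd l).
- exact: is_derive_continuous (is_derive_tb_even l).
Qed.

Lemma sqint_tb i : sqint (tb i).
Proof. exact/sqint_continuous/continuous_tb. Qed.

Lemma tb_periodic i x : tb i (x + 1) = tb i x.
Proof.
elim/tb_ind: i => [//|l|l].
- by rewrite tb_cos mulrDr mulr1 addrC cos_omega.
- by rewrite tb_sin mulrDr mulr1 addrC sin_omega.
Qed.

Lemma ip_Z (a b : R) f g : sqint f -> sqint g ->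
  ip (fun x => a * f x) (fun x => b * g x) = a * b * ip f g.
Proof.
move=> qf qg; rewrite /ip -RintegralZl//; last exact: integrable_mul.
by apply: eq_Rintegral => x _; ring.
Qed.

Lemma ip_tb i j : ip (tb i) (tb j) = (i == j)%:R.
Proof.
have qc w : sqint (fun y : R => cos (w * y)) by exact/sqint_continuous/continuous_cosM.
have qs w : sqint (fun y : R => sin (w * y)) by exact/sqint_continuous/continuous_sinM.
have s2 : Num.sqrt 2 * Num.sqrt 2 = 2 :> R by rewrite -expr2 sqr_sqrtr.
have Z0 (g : R -> R) b : sqint g -> ip (fun x : R => cos (omega * 0%:R * x))
    (fun x => b * g x) = b * ip (fun x : R => cos (omega * 0%:R * x)) g.
  move=> qg; rewrite -[b in RHS]mul1r -ip_Z//; congr (ip _ _).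
  by apply/funext => x; rewrite mul1r.
wlog : i j / (i <= j)%N => [H|].
  by have [/H//|/ltnW/H] := leqP i j; rewrite ipC eq_sym.
elim/tb_ind: i => [|l|l]; elim/tb_ind: j => [|l'|l'] ij //.
- by rewrite tb0 ip_cos_cos addn0 !eqxx/=; field.
- by rewrite tb0 tb_cos Z0// ip_cos_cos/= addr0 mul0r mulr0.
- by rewrite tb0 tb_sin Z0// ipC ip_sin_cos mulr0.
- rewrite !tb_cos ip_Z// ip_cos_cos s2 addnS eqSS addr0 eqSS.
  by rewrite (inj_eq double_inj) mulrC divfK.
- rewrite tb_cos tb_sin ip_Z// ipC ip_sin_cos mulr0 !eqSS.
  by case: eqP => // /(congr1 odd); rewrite /= !odd_double.
- rewrite tb_cos tb_sin ip_Z// ip_sin_cos mulr0 !eqSS.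
  by case: eqP => // /(congr1 odd); rewrite /= !odd_double.
- rewrite !tb_sin ip_Z// ip_sin_sin s2 addnS eqSS subr0 !eqSS.
  by rewrite (inj_eq double_inj) mulrC divfK.
Qed.

End trigonometric.

(** * The class in terms of Fourier coefficients *)

Section fourier_class.
Context (R : realType).
Local Notation mu := (@lebesgue_measure R).
Local Notation I := (`[0%R, 1%R]%classic : set R).
Implicit Types (theta c : nat -> R) (S f g : R -> R).

(* Differentiation in terms of Fourier coefficients. *)
Definition dcoef theta i : R :=
  if i == 0%N then 0
  else if odd i then freq R i * theta i.+1 else - freq R i * theta i.-1.

Local Notation ts := (tsum (@tb R)).

Lemma tsumE theta N : ts theta N.+1 = (fun x => theta N * tb N x + ts theta N x).
Proof. by apply/funext => x; rewrite tsumS. Qed.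

(** The odd length [L.*2.+1] keeps every cosine together with the sine of the same frequency, so
    that the span is stable under differentiation. *)
Lemma is_derive_tsum theta L (x : R) :
  is_derive x 1 (ts theta L.*2.+1) (ts (dcoef theta) L.*2.+1 x).
Proof.
have Z (a b : R) (f : R -> R) : is_derive x 1 f b -> is_derive x 1 (fun y => a * f y) (a * b).
  by move=> h; exact: (is_deriveZ a h).
have A (a b : R) (f g : R -> R) : is_derive x 1 f a -> is_derive x 1 g b ->
    is_derive x 1 (fun y => f y + g y) (a + b).
  by move=> h1 h2; exact: (is_deriveD h1 h2).
elim: L => [|L IH].
  rewrite !tsumE /dcoef/= mul0r add0r.
  have -> : (fun y => theta 0%N * tb 0 y + ts theta 0 y) = fun=> theta 0%N.
    by apply/funext => y; rewrite /tsum big_ord0 addr0 /tb/= mulr1.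
  by rewrite /tsum big_ord0; exact: is_derive_cst.
rewrite doubleS !(tsumE _ L.*2.+2) !(tsumE _ L.*2.+1).
apply: (is_derive_eq (A _ _ _ _ (Z (theta L.*2.+2) _ _ (is_derive_tb_even L x))
  (A _ _ _ _ (Z (theta L.*2.+1) _ _ (is_derive_tb_odd L x)) IH))).
rewrite /dcoef/= odd_double/= freq_even freq_odd.
by ring.
Qed.

Lemma continuous_tsum theta N : continuous (ts theta N).
Proof.
elim: N => [|N IH].
  have -> : ts theta 0 = fun=> 0 by apply/funext => x; rewrite /tsum big_ord0.
  exact: cst_continuous.
rewrite tsumE => x; apply: cvgD; last exact: IH.
by apply: cvgM; [exact: cvg_cst|exact: continuous_tb].
Qed.

Lemma tsum_periodic theta N x : ts theta N (x + 1) = ts theta N x.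
Proof. by apply: eq_bigr => i _; rewrite tb_periodic. Qed.

(** Weight of the i-th squared coefficient in the sum of the ||S^(q)||^2 for q <= k; these weights
    define the ellipsoid attached to the class. *)
Definition energy k i : R := \sum_(q < k.+1) freq R i ^+ (2 * q).

Lemma sum_dcoef p theta L :
  \sum_(i < L.*2.+1) freq R i ^+ (2 * p) * dcoef theta i ^+ 2 =
  \sum_(i < L.*2.+1) freq R i ^+ (2 * p.+1) * theta i ^+ 2.
Proof.
elim: L => [|L IH].
  by rewrite !big_ord_recr !big_ord0/= freq0 /dcoef/= expr0n/= mulr0 mulnS expr0n/= mul0r.
rewrite doubleS !(big_ord_recr L.*2.+2) !(big_ord_recr L.*2.+1)/= IH.
rewrite /dcoef/= odd_double/= freq_even freq_odd mulnS exprD.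
by ring.
Qed.

Lemma sum_iter_dcoef q p theta L :
  \sum_(i < L.*2.+1) freq R i ^+ (2 * p) * (iter q dcoef theta i) ^+ 2 =
  \sum_(i < L.*2.+1) freq R i ^+ (2 * (p + q)) * theta i ^+ 2.
Proof.
elim: q p => [|q IH] p; first by rewrite addn0.
by rewrite iterS sum_dcoef IH addSnnS.
Qed.

Lemma sum_energy k theta L :
  \sum_(q < k.+1) \sum_(i < L.*2.+1) (iter q dcoef theta i) ^+ 2 =
  \sum_(i < L.*2.+1) energy k i * theta i ^+ 2.
Proof.
under [RHS]eq_bigr do rewrite mulr_suml.
rewrite [RHS]exchange_big/=; apply: eq_bigr => q _.
have := sum_iter_dcoef q 0 theta L; rewrite add0n => <-.
by apply: eq_bigr => i _; rewrite muln0 expr0 mul1r.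
Qed.

(** Source of the parameters of the lower bound. The derivatives are obtained by iterating [dcoef],
    and their squared norms add up to the quadratic form of the ellipsoid. *)
Lemma tsum_function_class k (r : R) theta L :
  \sum_(i < L.*2.+1) energy k i * theta i ^+ 2 <= r ->
  function_class k r (ts theta L.*2.+1).
Proof.
move=> Hr; split; first exact: tsum_periodic.
exists (fun q => ts (iter q dcoef theta) L.*2.+1); split => //.
- by move=> i x _ _; exact: is_derive_tsum.
- by move=> i _; apply: continuous_subspaceT; exact: continuous_tsum.
- by move=> i _; rewrite -[1]add0r tsum_periodic.
rewrite (eq_bigr (fun q => (\sum_(i < L.*2.+1) (iter q dcoef theta i) ^+ 2)%:E)).
  by rewrite big_mkord sumEFin lee_fin sum_energy.
move=> q _; rewrite sqnormE; last by apply: sqint_tsum => i; exact: sqint_tb.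
by rewrite ip_tsum_tsum//; [move=> i; exact: sqint_tb|exact: ip_tb].
Qed.

Lemma ipZr (a : R) f g : sqint f -> sqint g -> ip f (fun x => a * g x) = a * ip f g.
Proof.
move=> qf qg; rewrite -[a in RHS]mul1r -ip_Z//; congr (ip _ _).
by apply/funext => x; rewrite mul1r.
Qed.

(** Integration by parts, where periodicity cancels the boundary terms. *)
Lemma ip_derive f df g dg :
  (forall x : R, x \in `]0, 1[ -> is_derive x 1 f (df x)) ->
  {within I, continuous f} -> {within I, continuous df} -> f 0 = f 1 ->
  (forall x : R, is_derive x 1 g (dg x)) -> continuous dg -> g 0 = g 1 ->
  ip df g = - ip f dg.
Proof.
move=> fd cf cdf f01 gd cdg g01.
have lf : derivable_oo_LRcontinuous f 0 1.
  have [_ c0 c1] := (continuous_within_itvP f ltr01).1 cf.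
  by split => // x xI; case: (fd x xI).
have := @Rintegration_by_parts R f g df dg 0 1 ltr01 cdf lf _ (continuous_subspaceT cdg)
  (derivable_oo_LR 0 1 gd) _.
rewrite /ip => ->.
- by rewrite f01 g01 subrr sub0r opprK.
- by move=> x xI; rewrite derive1E; case: (fd x xI).
- by move=> x _; rewrite derive1E; case: (gd x).
Qed.

Lemma ip_derive_tb f df i :
  (forall x : R, x \in `]0, 1[ -> is_derive x 1 f (df x)) ->
  {within I, continuous f} -> {within I, continuous df} -> f 0 = f 1 ->
  ip df (tb i) = dcoef (fun j => ip f (tb j)) i.
Proof.
move=> fd cf cdf f01; have qf := sqint_cont cf.
have tb01 j : tb j 0 = tb j 1 :> R by rewrite -[1]add0r tb_periodic.
elim/tb_ind: i => [|l|l].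
- rewrite (ip_derive fd cf cdf f01 (@is_derive_tb0 R) _ (tb01 _)); last exact: cst_continuous.
  rewrite /dcoef/= /ip (@eq_Rintegral _ _ _ _ _ (fun=> 0)); last by move=> x _; rewrite mulr0.
  by rewrite Rintegral_cstI oppr0.
- rewrite (ip_derive fd cf cdf f01 (is_derive_tb_odd l) _ (tb01 _)).
    rewrite ipZr//; last exact: sqint_tb.
    by rewrite /dcoef/= odd_double/= mulNr opprK.
  by move=> x; apply: cvgM; [exact: cvg_cst|exact: continuous_tb].
- rewrite (ip_derive fd cf cdf f01 (is_derive_tb_even l) _ (tb01 _)).
    rewrite ipZr//; last exact: sqint_tb.
    by rewrite /dcoef/= odd_double/= mulNr.
  by move=> x; apply: cvgM; [exact: cvg_cst|exact: continuous_tb].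
Qed.

Lemma dcoef_ext theta c i : theta =1 c -> dcoef theta i = dcoef c i.
Proof. by move=> E; rewrite /dcoef !E. Qed.

(** The coefficients of the q-th derivative are those of S transformed q times by [dcoef]; Bessel's
    inequality is then applied to every derivative. *)
Lemma class_bound k (r : R) S L : function_class k r S ->
  \sum_(i < L.*2.+1) energy k i * ip S (tb i) ^+ 2 <= r.
Proof.
move=> [_ [D [D0 Dd Dc D01 Dr]]].
have qD q : (q <= k)%N -> sqint (D q) by move=> qk; apply: sqint_cont; exact: Dc.
have E q : (q <= k)%N -> forall i, ip (D q) (tb i) = iter q dcoef (fun j => ip S (tb j)) i.
  elim: q => [|q IH] qk i /=.
    by apply: eq_Rintegral => x; rewrite inE => xI; rewrite D0.
  have qk' := ltnW qk.
  transitivity (dcoef (fun j => ip (D q) (tb j)) i).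
    apply: (@ip_derive_tb (D q)); [|exact: Dc|exact: Dc|exact: D01].
    by move=> x xI; exact: Dd.
  by apply: dcoef_ext => j; exact: IH.
rewrite -(sum_energy k (fun i => ip S (tb i))) -lee_fin; apply: le_trans Dr.
rewrite big_mkord -sumEFin; apply: lee_sum => q _.
have qk : (q <= k)%N by rewrite -ltnS.
rewrite sqnormE; last exact: qD.
rewrite lee_fin; under eq_bigr do rewrite -E//.
by apply: bessel => //; [exact: sqint_tb|exact: ip_tb|exact: qD].
Qed.

Lemma class_continuous k (r : R) S : function_class k r S ->
  {within I, continuous S} /\ S 0 = S 1.
Proof.
move=> [_ [D [D0 _ Dc D01 _]]]; split.
  have := Dc 0%N (leq0n _); apply: subspace_eq_continuous => x xI.
  by apply: D0; move: xI; rewrite inE.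
by rewrite -!D0 ?D01 // in_itv/= ?lexx ?ler01.
Qed.

End fourier_class.

(** * Completeness of the basis on the class, by de la Vallee-Poussin means *)

Section completeness.
Context (R : realType).
Local Notation mu := (@lebesgue_measure R).
Local Notation I := (`[0%R, 1%R]%classic : set R).
Local Notation omega := (2 * pi : R).
Local Notation ts := (tsum (@tb R)).

Definition trigpoly (g : R -> R) := exists N c, g =1 ts c N.

Lemma trigpoly_ext f g : f =1 g -> trigpoly f -> trigpoly g.
Proof. by move=> fg [N [c fE]]; exists N, c => x; rewrite -fg. Qed.

Lemma trigpoly_Z a f : trigpoly f -> trigpoly (fun x => a * f x).
Proof.
move=> [N [c fE]]; exists N, (fun i => a * c i) => x.
by rewrite fE /tsum mulr_sumr; apply: eq_bigr => i _; rewrite mulrA.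
Qed.

Lemma trigpoly_D f g : trigpoly f -> trigpoly g -> trigpoly (fun x => f x + g x).
Proof.
have pad N M c : (N <= M)%N -> ts c N =1 ts (fun i => if (i < N)%N then c i else 0) M.
  move=> NM x; rewrite /tsum (big_ord_widen M (fun i => c i * tb i x) NM) big_mkcond/=.
  by apply: eq_bigr => i _; case: ifP => // _; rewrite mul0r.
move=> [N [c fE]] [M [c' gE]]; exists (maxn N M).
exists (fun i => (if (i < N)%N then c i else 0) + (if (i < M)%N then c' i else 0)) => x.
rewrite fE gE (pad _ _ _ (leq_maxl N M)) (pad _ _ _ (leq_maxr N M)) /tsum -big_split/=.
by apply: eq_bigr => i _; rewrite mulrDl.
Qed.

Lemma trigpoly_tb i : trigpoly (tb i).
Proof.
exists i.+1, (fun j => (j == i)%:R) => x; rewrite /tsum big_ord_recr/= eqxx mul1r.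
by rewrite big1 ?add0r// => j _; rewrite ltn_eqF// mul0r.
Qed.

Lemma trigpoly_cst a : trigpoly (fun=> a).
Proof.
apply: trigpoly_ext (trigpoly_Z a (trigpoly_tb 0)) => x.
by rewrite /tb/= mulr1.
Qed.

Lemma trigpoly_cos p : trigpoly (fun x => cos (omega * p%:R * x)).
Proof.
case: p => [|l]; first by rewrite -tb0; exact: trigpoly_tb.
apply: trigpoly_ext (trigpoly_Z (Num.sqrt 2)^-1 (trigpoly_tb l.*2.+1)) => x.
by rewrite tb_cos mulKf// gt_eqF// sqrtr_gt0.
Qed.

Lemma trigpoly_sin p : trigpoly (fun x => sin (omega * p%:R * x)).
Proof.
case: p => [|l].
  by apply: trigpoly_ext (trigpoly_cst 0) => x; rewrite mulr0 mul0r sin0.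
apply: trigpoly_ext (trigpoly_Z (Num.sqrt 2)^-1 (trigpoly_tb l.*2.+2)) => x.
by rewrite tb_sin mulKf// gt_eqF// sqrtr_gt0.
Qed.

Let half p (x : R) : omega * p.+1%:R * x = omega * p%:R * x + omega * x.
Proof. by rewrite -natr1; ring. Qed.

(** By the product-to-sum formulas. It allows the factors of a power of the kernel [kr] to be taken
    out one at a time. *)
Lemma trigpoly_mul_cos_sin f : trigpoly f ->
  trigpoly (fun x => cos (omega * x) * f x) /\ trigpoly (fun x => sin (omega * x) * f x).
Proof.
have H i : trigpoly (fun x => cos (omega * x) * tb i x) /\
    trigpoly (fun x => sin (omega * x) * tb i x).
  elim/tb_ind: i => [|l|l].
  - split.
      by apply: trigpoly_ext (trigpoly_cos 1) => x; rewrite /tb/= !mulr1.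
    by apply: trigpoly_ext (trigpoly_sin 1) => x; rewrite /tb/= !mulr1.
  - rewrite tb_cos; split.
      apply: trigpoly_ext (trigpoly_Z (Num.sqrt 2 / 2)
        (trigpoly_D (trigpoly_cos l.+2) (trigpoly_cos l))) => x.
      have -> : omega * l%:R * x = omega * l.+1%:R * x - omega * x by rewrite half addrK.
      by rewrite (half l.+1) cosD cosB; field.
    apply: trigpoly_ext (trigpoly_Z (Num.sqrt 2 / 2)
      (trigpoly_D (trigpoly_sin l.+2) (trigpoly_Z (-1) (trigpoly_sin l)))) => x.
    have -> : omega * l%:R * x = omega * l.+1%:R * x - omega * x by rewrite half addrK.
    by rewrite (half l.+1) sinD sinB; field.
  - rewrite tb_sin; split.
      apply: trigpoly_ext (trigpoly_Z (Num.sqrt 2 / 2)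
        (trigpoly_D (trigpoly_sin l.+2) (trigpoly_sin l))) => x.
      have -> : omega * l%:R * x = omega * l.+1%:R * x - omega * x by rewrite half addrK.
      by rewrite (half l.+1) sinD sinB; field.
    apply: trigpoly_ext (trigpoly_Z (Num.sqrt 2 / 2)
      (trigpoly_D (trigpoly_cos l) (trigpoly_Z (-1) (trigpoly_cos l.+2)))) => x.
    have -> : omega * l%:R * x = omega * l.+1%:R * x - omega * x by rewrite half addrK.
    by rewrite (half l.+1) cosB cosD; field.
move=> [N [c fE]].
suff [H1 H2] : trigpoly (fun x => cos (omega * x) * ts c N x) /\
    trigpoly (fun x => sin (omega * x) * ts c N x).
  by split; [apply: trigpoly_ext H1 => x; rewrite fE|
             apply: trigpoly_ext H2 => x; rewrite fE].
elim: N {fE} => [|N [IH1 IH2]].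
  by split; apply: trigpoly_ext (trigpoly_cst 0) => x; rewrite /tsum big_ord0 mulr0.
have [HN1 HN2] := H N; split.
- apply: trigpoly_ext (trigpoly_D (trigpoly_Z (c N) HN1) IH1) => x.
  by rewrite tsumS; ring.
- apply: trigpoly_ext (trigpoly_D (trigpoly_Z (c N) HN2) IH2) => x.
  by rewrite tsumS; ring.
Qed.

(* [kr x y ^+ m], normalized, is the de la Vallee-Poussin kernel
   cos^(2m) (pi (x - y)). *)
Definition kr (x y : R) : R :=
  (1 + (cos (omega * x) * cos (omega * y) + sin (omega * x) * sin (omega * y))) / 2.

Lemma krE x y : kr x y = cos (pi * (y - x)) ^+ 2.
Proof.
have E : cos (omega * (y - x)) = cos (pi * (y - x)) ^+ 2 *+ 2 - 1.
  by rewrite -cos_mulr2n; congr cos; rewrite -[RHS]mulr_natl mulrA.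
have : cos (omega * (y - x)) = cos (omega * x) * cos (omega * y) + sin (omega * x) * sin (omega
  * y).
  by rewrite mulrBr cosB; ring.
rewrite /kr E => <-.
by rewrite -mulr_natl; field.
Qed.

Lemma kr_ge0 x y : 0 <= kr x y. Proof. by rewrite krE sqr_ge0. Qed.

Lemma continuous_kr x : continuous (kr x).
Proof.
move=> y; apply: cvgM; last exact: cvg_cst.
apply: cvgD; first exact: cvg_cst.
apply: cvgD; (apply: cvgM; first exact: cvg_cst).
  exact: continuous_cosM.
exact: continuous_sinM.
Qed.

Lemma within_mul (f g : R -> R) : {within I, continuous f} -> {within I, continuous g} ->
  {within I, continuous (fun x => f x * g x)}.
Proof. by move=> cf cg x; apply: continuousM; [exact: cf|exact: cg]. Qed.

Lemma within_add (f g : R -> R) : {within I, continuous f} -> {within I, continuous g} ->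
  {within I, continuous (fun x => f x + g x)}.
Proof. by move=> cf cg x; apply: cvgD; [exact: cf|exact: cg]. Qed.

Lemma within_cst (a : R) : {within I, continuous (fun=> a)}.
Proof. by move=> x; exact: cst_continuous. Qed.

Lemma within_kr x m (f : R -> R) : {within I, continuous f} ->
  {within I, continuous (fun y => kr x y ^+ m * f y)}.
Proof.
move=> cf; apply: within_mul => //; apply: continuous_subspaceT.
elim: m => [|m IH]; first exact: cst_continuous.
move=> y; rewrite (_ : (fun y => _) = (fun y => kr x y * kr x y ^+ m)); last first.
  by apply/funext => z; rewrite exprS.
by apply: cvgM; [exact: continuous_kr|exact: IH].
Qed.

Definition conv m (f : R -> R) (x : R) : R := \int[mu]_(y in I) (kr x y ^+ m * f y).

Lemma Rintegral_lin (a : R) (f g : R -> R) : {within I, continuous f} -> {within I, continuous g} ->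
  \int[mu]_(y in I) (a * f y + g y) = a * (\int[mu]_(y in I) f y) + \int[mu]_(y in I) g y.
Proof.
move=> cf cg.
have caf : {within I, continuous (fun x => a * f x)}.
  by apply: within_mul => //; exact: within_cst.
rewrite RintegralD//; [|exact: Rintegrable_cont|exact: Rintegrable_cont].
by rewrite RintegralZl//; exact: Rintegrable_cont.
Qed.

(** One factor of the kernel splits into functions of x times functions of y, which leaves the lower
    power integrated against f, cos f and sin f; hence an induction over all continuous f. *)
Lemma trigpoly_conv m f : {within I, continuous f} -> trigpoly (conv m f).
Proof.
elim: m f => [|m IH] f cf.
  apply: trigpoly_ext (trigpoly_cst (\int[mu]_(y in I) f y)) => x.
  by apply: eq_Rintegral => y _; rewrite mul1r.
have cc : {within I, continuous (fun y => cos (omega * y) * f y)}.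
  by apply: within_mul => //; apply: continuous_subspaceT; exact: continuous_cosM.
have cs : {within I, continuous (fun y => sin (omega * y) * f y)}.
  by apply: within_mul => //; apply: continuous_subspaceT; exact: continuous_sinM.
have [H1 _] := trigpoly_mul_cos_sin (IH _ cc).
have [_ H2] := trigpoly_mul_cos_sin (IH _ cs).
apply: trigpoly_ext (trigpoly_Z 2^-1 (trigpoly_D (IH _ cf) (trigpoly_D H1 H2))) => x.
rewrite /conv.
set A := \int[mu]_(y in I) _; set B := \int[mu]_(y in I) _; set C := \int[mu]_(y in I) _.
transitivity (\int[mu]_(y in I) (2^-1 * (kr x y ^+ m * f y) +
   (2^-1 * cos (omega * x) * (kr x y ^+ m * (cos (omega * y) * f y)) +
   (2^-1 * sin (omega * x) * (kr x y ^+ m * (sin (omega * y) * f y)) + 0)))).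
  have c0 := @within_cst 0.
  have sum a (g h : R -> R) : {within I, continuous g} -> {within I, continuous h} ->
      {within I, continuous (fun x => a * g x + h x)}.
    by move=> cg ch; apply: within_add => //; apply: within_mul => //; exact: within_cst.
  rewrite Rintegral_lin; [|exact: within_kr|].
    rewrite Rintegral_lin; [|exact: within_kr|].
      rewrite Rintegral_lin; [|exact: within_kr|exact: c0].
      by rewrite Rintegral_cstI -/A -/B -/C; ring.
    exact: (@sum (2^-1 * sin (omega * x)) _ _ (@within_kr x m _ cs) c0).
  exact: (@sum (2^-1 * cos (omega * x)) _ _ (@within_kr x m _ cc)
    (@sum (2^-1 * sin (omega * x)) _ _ (@within_kr x m _ cs) c0)).
by apply: eq_Rintegral => y _; rewrite exprS /kr; ring.
Qed.

(** Wallis products, the means of cos^(2m) over a period. *)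
Fixpoint Jc m : R := if m is m'.+1 then (2 * m' + 1)%:R / (2 * m' + 2)%:R * Jc m' else 1.

Lemma Jc_gt0 m : 0 < Jc m.
Proof. by elim: m => //= m IH; rewrite mulr_gt0// divr_gt0// ltr0n ?addn1 ?addn2. Qed.

(** The derivative of cos^(2m+1) u sin u, with u = pi (y - x), integrates to zero over a period,
    which is Wallis' recursion (2m+2) J_(m+1) = (2m+1) J_m. *)
Lemma conv1 m x : conv m (fun=> 1) x = Jc m.
Proof.
have c1 := @within_cst 1.
elim: m => [|m IH].
  rewrite /conv (@eq_Rintegral _ _ _ _ _ (fun=> 1)); first exact: Rintegral_cstI.
  by move=> y _; rewrite mul1r.
pose u (y : R) := pi * (y - x).
have ud (y : R) : is_derive y 1 u pi.
  have h : is_derive y 1 (fun z : R => z - x) 1.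
    have := is_deriveB (is_derive_id y (1 : R)) (is_derive_cst x y (1 : R)).
    by rewrite subr0.
  have := is_deriveZ pi h; rewrite /GRing.scale/= mulr1.
  exact.
pose F (y : R) := pi^-1 * (cos (u y) ^+ (2 * m).+1 * sin (u y)).
pose dF (y : R) := (2 * m + 2)%:R * kr x y ^+ m.+1 - (2 * m + 1)%:R * kr x y ^+ m.
have p0 : pi != 0 :> R by rewrite gt_eqF// pi_gt0.
have Fd (y : R) : is_derive y 1 F (dF y).
  have hc := is_derive1_comp (is_derive_cos (u y)) (ud y).
  have hs := is_derive1_comp (is_derive_sin (u y)) (ud y).
  have hp : is_derive y 1 (fun z => cos (u z) ^+ (2 * m).+1)
      ((2 * m).+1%:R * cos (u y) ^+ (2 * m) * (- sin (u y) * pi)).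
    have := is_deriveX (2 * m).+1 hc.
    have -> // : (cos \o u) ^+ (2 * m).+1 = (fun z => cos (u z) ^+ (2 * m).+1).
    apply/funext => z; elim: (2 * m).+1 => [//|n IHn].
    by rewrite exprS [RHS]exprS -IHn.
  have hm := is_deriveM hp hs.
  apply: (@is_derive_eq _ _ _ _ _ _ _ _ (is_deriveZ pi^-1 hm)).
  have e1 : (cos (u y) ^+ 2) ^+ m = cos (u y) ^+ (2 * m) by rewrite -exprM.
  have e2 : (cos (u y) ^+ 2) ^+ m.+1 = cos (u y) ^+ 2 * cos (u y) ^+ (2 * m).
    by rewrite exprS e1.
  have s2 : sin (u y) * sin (u y) = 1 - cos (u y) ^+ 2 by rewrite -sin2cos2 expr2.
  rewrite /dF !krE -/(u y) e1 e2 exprS -[(2 * m).+1]addn1.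
  set q := cos (u y) ^+ (2 * m); rewrite /GRing.scale/=.
  transitivity (q * (cos (u y) ^+ 2 - (2 * m + 1)%:R * (sin (u y) * sin (u y)))).
    transitivity (pi^-1 * pi * (q * (cos (u y) ^+ 2 -
      (2 * m + 1)%:R * (sin (u y) * sin (u y))))); first by ring.
    by rewrite mulVf// mul1r.
  by rewrite s2 !natrD; ring.
have cdF : continuous dF.
  have ck n : continuous (fun y => kr x y ^+ n).
    elim: n => [|n IHn]; first exact: cst_continuous.
    move=> y; rewrite (_ : (fun y => _) = (fun y => kr x y * kr x y ^+ n)); last first.
      by apply/funext => z; rewrite exprS.
    by apply: cvgM; [exact: continuous_kr|exact: IHn].
  by move=> y; apply: cvgB; (apply: cvgM; [exact: cvg_cst|exact: ck]).
have E : \int[mu]_(y in I) dF y = 0.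
  transitivity (F 1 - F 0); first exact: Rintegral_derive.
  (* From 0 to 1 the angle grows by pi: the odd power of the cosine and the sine both change
     sign. *)
  have u1 : u 1 = u 0 + pi by rewrite /u; ring.
  rewrite /F u1 cosDpi sinDpi exprNn -signr_odd/= oddM/= expr1.
  by ring.
have : (2 * m + 2)%:R * conv m.+1 (fun=> 1) x - (2 * m + 1)%:R * conv m (fun=> 1) x = 0.
  rewrite -[RHS]E -[in LHS]mulNr addrC -[X in _ + X]addr0.
  rewrite /conv.
  transitivity (\int[mu]_(y in I) (- (2 * m + 1)%:R * (kr x y ^+ m * 1) +
    ((2 * m + 2)%:R * (kr x y ^+ m.+1 * 1) + 0))).
    have c0 := @within_cst 0.
    rewrite Rintegral_lin; [|exact: (@within_kr x _ _ c1)|].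
      rewrite Rintegral_lin; [|exact: (@within_kr x _ _ c1)|exact: c0].
      by rewrite Rintegral_cstI.
    apply: within_add; last exact: c0.
    by apply: within_mul; [exact: within_cst|exact: (@within_kr x _ _ c1)].
  by apply: eq_Rintegral => y _; rewrite /dF; ring.
rewrite IH /= => /eqP; rewrite subr_eq0 => /eqP H.
have h0 : (2 * m + 2)%:R != 0 :> R by rewrite pnatr_eq0 addn2.
by apply: (mulfI h0); rewrite H; field.
Qed.

(** The quantity 1 - [kr x y] = sin^2 (pi (y - x)) vanishes only for x = y modulo 1. Where x and y
    are close modulo 1 the Lipschitz bound gives [e]; elsewhere the sine is bounded below and [C]
    absorbs the variation. This form integrates well against the kernel, since J_m - J_(m+1) = J_m /
    (2m+2). *)
Lemma class_modulus k (r : R) (S : R -> R) (e : R) : (0 < k)%N -> function_class k r S ->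
  0 < e -> exists2 C, 0 <= C & forall x y, x \in `[0, 1] -> y \in `[0, 1] ->
    `|S y - S x| <= e + C * (1 - kr x y).
Proof.
move=> k0 SW e0; have [cS S01] := class_continuous SW.
case: SW => _ [D [D0 Dd Dc D01 _]].
have cD1 := Dc 1%N k0.
have [c1 _ M1] := EVT_max ler01 cD1.
have [c2 _ M2] := EVT_min ler01 cD1.
pose M := `|D 1%N c1| + `|D 1%N c2| + 1.
have M0 : 0 < M by rewrite ltr_wpDl// addr_ge0.
have DM (t : R) : t \in `[0, 1] -> `|D 1%N t| <= M.
  move=> tI; have := M1 t tI; have := M2 t tI.
  have := ler_norm (D 1%N c1); have := ler_norm (- D 1%N c2); rewrite normrN => *.
  rewrite ler_norml /M; apply/andP; split.
    have := normr_ge0 (D 1%N c1); lra.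
  have := normr_ge0 (D 1%N c2); lra.
have lip (x y : R) : 0 <= x -> x <= y -> y <= 1 -> `|S y - S x| <= M * (y - x).
  move=> x0 xy y1.
  have xI : x \in `[0, 1] by rewrite in_itv/= x0 (le_trans xy).
  have yI : y \in `[0, 1] by rewrite in_itv/= y1 (le_trans x0).
  rewrite -!D0//.
  have d1 z : z \in `]x, y[ -> is_derive z 1 (D 0%N) (D 1%N z).
    rewrite in_itv/= => /andP[xz zy]; apply: Dd => //.
    by rewrite in_itv/= (le_lt_trans x0 xz) (lt_le_trans zy y1).
  have c0 : {within `[x, y], continuous (D 0%N)}.
    apply: continuous_subspaceW (Dc 0%N (leq0n _)) => z /=.
    by rewrite !in_itv/= => /andP[xz zy]; rewrite (le_trans x0 xz) (le_trans zy y1).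
  have [z zI ->] := @MVT_segment R (D 0%N) (D 1%N) x y xy d1 c0.
  rewrite normrM (ger0_norm (_ : 0 <= y - x)) ?subr_ge0// ler_wpM2r ?subr_ge0//.
  apply: DM; move: zI; rewrite !in_itv/= => /andP[xz zy].
  by rewrite (le_trans x0 xz) (le_trans zy y1).
(* At most 1/2, so that the sine is increasing up to the angles compared, and such that
   [M * de <= e]. *)
pose de := Order.min 2^-1 (e / M).
have de0 : 0 < de by rewrite lt_min invr_gt0 ltr0n divr_gt0.
have de2 : de <= 2^-1 by rewrite ge_min lexx.
have Mde : M * de <= e by rewrite mulrC -ler_pdivlMr// ge_min lexx orbT.
have p0 : (0 : R) < pi by exact: pi_gt0.
have sde0 : 0 < sin (pi * de).
  apply: sin_gt0_pi; rewrite mulr_gt0//= gtr_pMr//.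
  by rewrite (le_lt_trans de2)// invf_lt1// ltr1n.
have smono a : de <= a -> a <= 2^-1 -> sin (pi * de) <= sin (pi * a).
  move=> da a2; have [->//|nda] := eqVneq de a.
  have lt : de < a by rewrite lt_neqAle nda.
  apply/ltW; rewrite ltr_sin ?ltr_pM2l// in_itv/=.
    rewrite (ler_pM2l p0) de2 andbT (le_trans _ (mulr_ge0 (ltW p0) (ltW de0)))//.
    by rewrite oppr_le0 divr_ge0// ltW.
  rewrite (ler_pM2l p0) a2 andbT (le_trans _ (mulr_ge0 (ltW p0) (le_trans (ltW de0) da)))//.
  by rewrite oppr_le0 divr_ge0// ltW.
have smid d : de <= d -> d <= 1 - de -> sin (pi * de) <= sin (pi * d).
  move=> dd d1; have [d2|d2] := leP d 2^-1; first exact: smono.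
  have -> : sin (pi * d) = sin (pi * (1 - d)).
    by rewrite [in RHS]mulrBr mulr1 sinB sinpi cospi; ring.
  by apply: smono; lra.
exists (M / sin (pi * de) ^+ 2); first by rewrite divr_ge0 ?sqr_ge0// ltW.
move=> x y; wlog xy : x y / x <= y => [H|].
  move=> xI yI; have [/H|/ltW/H] := leP x y; first exact.
  rewrite distrC => /(_ yI xI); rewrite (_ : kr y x = kr x y)//.
  by rewrite /kr; congr (_ / _); ring.
rewrite !in_itv/= => /andP[x0 x1] /andP[y0 y1].
have k1 : 0 <= 1 - kr x y by rewrite krE -sin2cos2 sqr_ge0.
have C0 : 0 <= M / sin (pi * de) ^+ 2 * (1 - kr x y).
  by rewrite mulr_ge0// divr_ge0 ?sqr_ge0// ltW.
have [dl|dl] := leP (y - x) de.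
  rewrite (le_trans (lip _ _ x0 xy y1))// (le_trans (ler_wpM2l (ltW M0) dl))//.
  by rewrite (le_trans Mde)// lerDl.
(* Here x and y are close across the endpoints, and the variation passes through S 0 = S 1. *)
have [dr|dr] := leP (1 - (y - x)) de.
  have := lip 0 x (lexx 0) x0 x1; have := lip y 1 y0 y1 (lexx 1); rewrite S01.
  move=> h1 h2; have : `|S y - S x| <= `|S 1 - S y| + `|S x - S 1|.
    have -> : S y - S x = - (S 1 - S y) - (S x - S 1) by ring.
    by rewrite (le_trans (ler_normB _ _))// normrN.
  have := ler_wpM2l (ltW M0) dr; lra.
have s1 : sin (pi * de) <= sin (pi * (y - x)) by apply: smid; lra.
have : M <= M / sin (pi * de) ^+ 2 * (1 - kr x y).
  rewrite krE -sin2cos2 mulrAC ler_pdivlMr ?exprn_gt0//.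
  by rewrite ler_pM2l// ler_pXn2r// nnegrE ltW// (lt_le_trans sde0).
have := lip _ _ x0 xy y1.
have : M * (y - x) <= M by rewrite ler_piMr ?(ltW M0)//; lra.
lra.
Qed.

(** Integrating [class_modulus] against the normalized kernel gives e/2 + C / (2m+2), and the choice
    of m makes the second term at most e/2. *)
Lemma class_approx k (r : R) (S : R -> R) (e : R) : (0 < k)%N -> function_class k r S ->
  0 < e -> exists N c, forall x, x \in `[0, 1] -> `|ts c N x - S x| <= e.
Proof.
move=> k0 SW e0; have [cS S01] := class_continuous SW.
have e2 : 0 < e / 2 by rewrite divr_gt0.
have [C C0 HC] := class_modulus k0 SW e2.
pose m := Num.truncn (C / e).
have mC : C / (2 * m + 2)%:R <= e / 2.
  rewrite ler_pdivrMr ?ltr0n ?addn2// mulrAC.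
  have : C / e < m.+1%:R by exact: truncnS_gt.
  rewrite ltr_pdivrMr// => /ltW; rewrite -(addn2 (2 * m)) natrD natrM -natr1; lra.
have [N [c cE]] := trigpoly_conv m cS.
exists N, (fun i => (Jc m)^-1 * c i) => x xI.
have J0 := Jc_gt0 m.
have -> : ts (fun i => (Jc m)^-1 * c i) N x = (Jc m)^-1 * conv m S x.
  by rewrite cE /tsum mulr_sumr; apply: eq_bigr => i _; rewrite mulrA.
have -> : (Jc m)^-1 * conv m S x - S x = (Jc m)^-1 * (conv m S x - S x * Jc m).
  by field; rewrite gt_eqF.
rewrite normrM gtr0_norm ?invr_gt0// mulrC ler_pdivrMr//.
have cSx : {within I, continuous (fun y => S y - S x)}.
  by apply: within_add => //; exact: within_cst.
have -> : conv m S x - S x * Jc m = \int[mu]_(y in I) (kr x y ^+ m * (S y - S x)).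
  rewrite -(conv1 m x).
  transitivity (\int[mu]_(y in I) (- S x * (kr x y ^+ m * 1) + kr x y ^+ m * S y)).
    rewrite (Rintegral_lin (- S x) (@within_kr x m _ (@within_cst 1)) (@within_kr x m _ cS)).
    by rewrite /conv; ring.
  by apply: eq_Rintegral => y _; ring.
apply: (le_trans (le_normr_Rintegral _ _)) => //.
  exact: Rintegrable_cont (@within_kr x m _ cSx).
pose B (y : R) := (e / 2 + C) * (kr x y ^+ m * 1) + (- C * (kr x y ^+ m.+1 * 1) + 0).
have cB1 : {within I, continuous (fun y => - C * (kr x y ^+ m.+1 * 1) + 0)}.
  apply: within_add; last exact: within_cst.
  by apply: within_mul; [exact: within_cst|exact: (@within_kr x _ _ (@within_cst 1))].
have cB : {within I, continuous B}.
  apply: within_add; last exact: cB1.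
  by apply: within_mul; [exact: within_cst|exact: (@within_kr x _ _ (@within_cst 1))].
apply: (@le_trans _ _ (\int[mu]_(y in I) B y)).
  apply: le_Rintegral => //.
  - exact: (integrable_abse (Rintegrable_cont (@within_kr x m _ cSx))).
  - exact: Rintegrable_cont.
  move=> y yI; rewrite normrM ger0_norm ?exprn_ge0 ?kr_ge0//.
  have := ler_wpM2l (exprn_ge0 m (kr_ge0 x y)) (HC x y xI yI).
  have -> // : B y = kr x y ^+ m * (e / 2 + C * (1 - kr x y)).
  by rewrite /B exprS; ring.
rewrite /B Rintegral_lin; [|exact: (@within_kr x _ _ (@within_cst 1))|exact: cB1].
rewrite Rintegral_lin; [|exact: (@within_kr x _ _ (@within_cst 1))|exact: within_cst].
have J1 : \int[mu]_(y in I) (kr x y ^+ m * 1) = Jc m by exact: (conv1 m x).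
have J2 : \int[mu]_(y in I) (kr x y ^+ m.+1 * 1) = Jc m.+1 by exact: (conv1 m.+1 x).
rewrite J1 J2 Rintegral_cstI addr0 /=.
have h0 : (2 * m + 2)%:R != 0 :> R by rewrite pnatr_eq0 addn2.
have -> : (e / 2 + C) * Jc m + - C * ((2 * m + 1)%:R / (2 * m + 2)%:R * Jc m) =
    (e / 2 + C / (2 * m + 2)%:R) * Jc m.
  have -> : (2 * m + 1)%:R = (2 * m + 2)%:R - 1 :> R by rewrite !natrD; ring.
  by field.
by rewrite ler_pM2r//; lra.
Qed.

(** Partial Fourier sums are the best approximations in L^2, hence do at least as well as the
    uniform approximation of [class_approx]. *)
Lemma class_complete k (r : R) (S : R -> R) (e : R) : (0 < k)%N -> function_class k r S ->
  0 < e -> exists N0, forall N, (N0 <= N)%N ->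
    ip S S - \sum_(i < N) ip S (tb i) ^+ 2 <= e.
Proof.
move=> k0 SW e0; have [cS _] := class_continuous SW; have qS := sqint_cont cS.
pose e' := Num.sqrt e; have e'0 : 0 < e' by rewrite sqrtr_gt0.
have [N0 [c H]] := class_approx k0 SW e'0.
exists N0 => N N0N.
apply: (@le_trans _ _ (ip S S - \sum_(i < N0) ip S (tb i) ^+ 2)).
  rewrite lerD2l lerN2 (big_ord_widen N (fun i => ip S (tb i) ^+ 2) N0N) big_mkcond/=.
  by apply: ler_sum => i _; case: ifP => // _; exact: sqr_ge0.
have := sqnorm_tsum_sub (@sqint_tb R) (@ip_tb R) c N0 qS.
set A := \sum_(i < N0) (c i - _) ^+ 2; set B := ip S S - _ => E.
have A0 : 0 <= A by apply: sumr_ge0 => i _; exact: sqr_ge0.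
suff : (sqnorm (fun x => ts c N0 x - S x)%R <= e%:E)%E by rewrite E lee_fin; lra.
apply: (@le_trans _ _ (\int[mu]_(x in I) e%:E)%E).
  have qd : sqint (fun x => ts c N0 x - S x).
    by apply: sqint_ext (sqint_lin (-1) qS (sqint_tsum (@sqint_tb R) c N0)) => x _; ring.
  apply: ge0_le_integral => //.
  - by move=> x _; rewrite lee_fin sqr_ge0.
  - by apply/measurable_EFinP; apply: measurable_funX; case: qd.
  move=> x xI; rewrite lee_fin -[e in leRHS](@sqr_sqrtr _ e); last exact: ltW.
  rewrite -(@real_normK _ (_ - _)) ?num_real//.
  by rewrite ler_pXn2r ?nnegrE ?sqrtr_ge0//; exact: H.
rewrite integral_cst//= lebesgue_measure_itv/= lte_fin ltr01.
by rewrite oppr0 adde0 mule1.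
Qed.

End completeness.

(** * The upper bound *)

Section predictable.
Context (R : realType) d (T : measurableType d) (P : probability T R)
  (F : R -> set (set T)) (X : R -> T -> R) (m : nat).
Hypothesis FF : filtration F.

(** The Borel sets A whose trace on ]0, m], times the whole space, is predictable form a
    sigma-algebra; for an interval the product is empty or a predictable rectangle. *)
Lemma predictable_det (f : R -> R) : measurable_fun setT f ->
  predictable F m (fun u (_ : T) => f u).
Proof.
move=> mf B mB; rewrite /=.
pose Om : set (T * R) := setT `*` `]0, m%:R].
pose G := <<s Om, predictable_rectangles F m >>.
have [G0 GD GU] : sigma_algebra Om G by exact: smallest_sigma_algebra.
have FT s : 0 <= s -> F s setT.
  by move=> s0; case: FF => /(_ s s0)[F0 FD _] _ _ _; have := FD _ F0; rewrite setD0.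
have H (A : set R) : measurable A -> G (setT `*` (`]0, m%:R] `&` A)).
  move: A; apply: smallest_sub.
    split => /=.
    - by rewrite setI0 setX0.
    - move=> A GA; have := GD _ GA.
      congr G; apply/seteqP; split=> -[w u] /=.
        by move=> [[_ uI] nA]; split => //; split => //; split => // Au; exact: nA.
      by move=> [_ [uI [_ nA]]]; split => // -[_ [_ Au]]; exact: nA.
    - move=> A GA; have := GU _ GA.
      congr G; apply/seteqP; split=> -[w u] /=.
        by move=> [i _ [_ [uI Au]]]; split => //; split => //; exists i.
      by move=> [_ [uI [i _ Au]]]; exists i.
  move=> _ [[a b] _ <-] /=.
  have [ab|ab] := leP (Num.max 0 a) (Num.min m%:R b); last first.
    have -> : setT `*` (`]0, m%:R] `&` `]a, b]) = set0 :> set (T * R).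
      apply/seteqP; split => // -[w u] /= [_]; rewrite !in_itv/=.
      move=> [/andP[u0 um] /andP[ua ub]]; move: ab; rewrite ltNge => /negP; apply.
      rewrite ge_max !le_min (le_trans (ltW u0) um) (le_trans (ltW u0) ub).
      by rewrite (le_trans (ltW ua) um) (le_trans (ltW ua) ub).
    exact: G0.
  apply: (sub_sigma_algebra (D := Om)).
  exists (Num.max 0 a), (Num.min m%:R b), setT; split => //.
  - by rewrite le_max lexx.
  - by rewrite ge_min lexx.
  - by apply: FT; rewrite le_max lexx.
  apply/seteqP; split => -[w u] /= [_]; rewrite !in_itv/=.
    move=> [/andP[u0 um] /andP[ua ub]]; split => //.
    by rewrite gt_max u0 ua le_min um ub.
  rewrite gt_max le_min => /andP[/andP[u0 ua] /andP[um ub]]; split => //.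
  by rewrite u0 um ua ub.
have := H (f @^-1` B); rewrite -[f @^-1` B]setTI => /(_ (mf measurableT B mB)).
congr G; apply/seteqP; split => -[w u] /=.
  by move=> [_ [uI [_ Bf]]].
by move=> [uI Bf].
Qed.

Definition step (a t : nat -> R) N (u : R) : R :=
  \sum_(i < N) a i * \1_(`]t i, t i.+1]) u.

Lemma measurable_step a t N : measurable_fun setT (step a t N).
Proof.
by apply: measurable_sum => i; exact: measurable_funM.
Qed.

Lemma step_bound a t N u : `|step a t N u| <= \sum_(i < N) `|a i|.
Proof.
rewrite (le_trans (ler_norm_sum _ _ _))//; apply: ler_sum => i _.
by rewrite normrM ler_piMr// indicE; case: (_ \in _); rewrite ?normr1 ?normr0 ?ler01.
Qed.

Lemma L2_cst (c : R) : L2 m (fun=> c).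
Proof.
split; first exact: measurable_cst.
rewrite integral_cst//= lebesgue_measure_itv/=; case: ifP => _.
  by rewrite -EFinB -EFinM ltry.
by rewrite mule0.
Qed.

Lemma step_dom a t N : predictable F m (fun u (_ : T) => step a t N u) /\
  (exists2 g, L2 m g & dominated m (fun u (_ : T) => step a t N u) g).
Proof.
split; first by apply: predictable_det; exact: measurable_step.
exists (fun=> \sum_(i < N) `|a i|); first exact: L2_cst.
by move=> s w _; exact: step_bound.
Qed.

(** By linearity from the elementary integrals, one interval at a time. *)
Lemma stochastic_integral_step I a t N : stochastic_integral P F X m I ->
  (forall i, (i < N)%N -> 0 <= t i /\ t i <= t i.+1 /\ t i.+1 <= m%:R) ->
  {ae P, forall w, I (fun u _ => step a t N u) w =
    \sum_(i < N) a i * (X (t i.+1) w - X (t i) w)}.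
Proof.
move=> [_ Iel Ilin _]; elim: N => [|N IH] tN.
  (* The zero function is written - H + H, so that linearity makes its integral vanish almost
     surely. *)
  have := Ilin (-1) _ _ (step_dom a t 0) (step_dom a t 0).
  have -> : (fun u w' => -1 * step a t 0 u + step a t 0 u) = (fun u (_ : T) => step a t 0 u).
    by apply/funext => u; apply/funext => w; rewrite /step big_ord0 mulr0 addr0.
  by apply: filterS => w; rewrite big_ord0 mulN1r addNr.
have {}IH := IH (fun i iN => tN i (ltnW iN)).
have [t0 [tt tm]] := tN N (ltnSn N).
have FT : F (t N) setT.
  by case: FF => /(_ _ t0)[F0 FD _] _ _ _; have := FD _ F0; rewrite setD0.
have E1 := Iel _ _ _ t0 tt tm FT.
(* The indicator becomes a step function with one interval, which [step_dom] places in the domain of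
   the integral. *)
have e1 : (fun u w' => \1_setT w' * \1_(`]t N, t N.+1]) u) =
    (fun u (_ : T) => step (fun=> 1) (fun i => t (i + N)%N) 1 u).
  apply/funext => u; apply/funext => w; rewrite /step big_ord_recr big_ord0/= add0r.
  by rewrite indicT !mul1r add0n add1n.
rewrite e1 in E1.
have := Ilin (a N) _ _ (step_dom (fun=> 1) (fun i => t (i + N)%N) 1) (step_dom a t N).
have -> : (fun u w' => a N * step (fun=> 1) (fun i => t (i + N)%N) 1 u + step a t N u) =
    (fun u (_ : T) => step a t N.+1 u).
  apply/funext => u; apply/funext => w; rewrite /step !big_ord_recr big_ord0/= add0r.
  by rewrite mul1r add0n add1n addrC.
move=> E2; near=> w.
rewrite (near E2 w)// (near E1 w)// (near IH w)// big_ord_recr/=.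
by rewrite indicT mul1r addrC.
Unshelve. all: by end_near.
Qed.

End predictable.

Section noise.
Context (R : realType) (Q : probability (skorohod R) R) (sigma : R) (n : nat).
Hypotheses (n0 : (0 < n)%N) (hQ : noise_class sigma n Q).

(** [Iint] picks an unspecified filtration and integral, but on step functions every choice agrees
    almost surely with the sum of increments. *)
Lemma Iint_step (a t : nat -> R) N :
  (forall i, (i < N)%N -> 0 <= t i /\ t i <= t i.+1 /\ t i.+1 <= n%:R) ->
  {ae Q, forall w : skorohod R, Iint Q n (step a t N) w =
    \sum_(i < N) a i * (Defs.coord (t i.+1) w - Defs.coord (t i) w)}.
Proof.
move=> tN; case: hQ => -[F FQ] _.
have [I hI] : exists I, stochastic_integral Q F (@Defs.coord R) n I by case: FQ => _; exact.
have [F' [I' [FQ' hI' ->]]] : [set Y | exists F I,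
    [/\ integrable_law Q F, stochastic_integral Q F (@Defs.coord R) n I
      & Y = I (fun s _ => step a t N s)]] (Iint Q n (step a t N)).
  by apply: xgetPex; exists (I (fun s _ => step a t N s)), F, I.
have FF : filtration F' by case: FQ' => -[].
exact: (stochastic_integral_step FF a hI' tN).
Qed.

Lemma measurable_coord (t : R) : 0 <= t -> measurable_fun setT (fun w : skorohod R =>
  Defs.coord t w).
Proof.
move=> t0 _ B mB; rewrite setTI; apply: sub_sigma_algebra.
by exists t, B; split => //=; rewrite in_itv/= t0.
Qed.

Lemma step_moments (a t : nat -> R) N (V : R) :
  (forall i, (i < N)%N -> 0 <= t i /\ t i <= t i.+1 /\ t i.+1 <= n%:R) ->
  (\int[lebesgue_measure]_(s in (`[0%R, n%:R] : set R)) ((step a t N s) ^+ 2)%:E <= V%:E)%E ->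
  let Y w := \sum_(i < N) a i * (Defs.coord (t i.+1) w - Defs.coord (t i) w) in
  [/\ measurable_fun setT (Y : skorohod R -> R), (\int[Q]_w (Y w)%:E = 0)%E
    & (\int[Q]_w ((Y w) ^+ 2)%:E <= (sigma * V)%:E)%E].
Proof.
move=> tN HV Y.
have mY : measurable_fun setT (Y : skorohod R -> R).
  apply: measurable_sum => i; have [t0 [tt _]] := tN i (ltn_ord i).
  apply: measurable_funM => //; apply: measurable_funB; apply: measurable_coord => //.
  exact: le_trans tt.
have L : L2 n (step a t N).
  split; first exact: measurable_funTS (measurable_step a t N).
  exact: le_lt_trans HV (ltry _).
have ae := Iint_step a tN.
case: hQ => _ /(_ _ L)[E1 E2].
have mI : measurable_fun setT (Iint Q n (step a t N)).
  case: hQ => -[F FQ] _.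
  have [I hI] : exists I, stochastic_integral Q F (@Defs.coord R) n I by case: FQ => _; exact.
  have [F' [I' [FQ' hI' ->]]] : [set Y | exists F I,
      [/\ integrable_law Q F, stochastic_integral Q F (@Defs.coord R) n I
        & Y = I (fun s _ => step a t N s)]] (Iint Q n (step a t N)).
    by apply: xgetPex; exists (I (fun s _ => step a t N s)), F, I.
  case: hI' => + _ _ _; apply; apply: step_dom.
  by case: FQ' => -[].
split => //.
  rewrite -E1 unlock; apply: ae_eq_integral => //.
  - exact/measurable_EFinP.
  - exact/measurable_EFinP.
  by apply: filterS ae => w Ew _ /=; rewrite Ew.
(* [V] only bounds the squared norm, so the sign of sigma matters. It comes from the function 1,
   whose integral has a nonnegative second moment. *)
have s0 : 0 <= sigma.
  rewrite leNgt; apply/negP => sl.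
  pose one : R -> R := fun=> 1.
  have L1 : L2 n one by exact: L2_cst.
  case: hQ => _ /(_ _ L1)[_]; rewrite unlock.
  rewrite leNgt => /negP; apply.
  apply: (@lt_le_trans _ _ 0%E); last first.
    by apply: integral_ge0 => w _; rewrite lee_fin sqr_ge0.
  rewrite (_ : (\int[_]_(s in _) _ = n%:R%:E)%E).
    by rewrite -EFinM lte_fin nmulr_rlt0// ltr0n.
  rewrite (eq_integral (cst 1%E)); last by move=> x _; rewrite /one expr1n.
  rewrite integral_cst//= lebesgue_measure_itv/= lte_fin ltr0n n0.
  by rewrite mul1e -EFinB subr0.
apply: (@le_trans _ _ (\int[Q]_w ((Iint Q n (step a t N) w) ^+ 2)%:E)%E).
  rewrite le_eqVlt; apply/orP; left; apply/eqP; apply: ae_eq_integral => //.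
  - by apply/measurable_EFinP; exact: measurable_funX.
  - by apply/measurable_EFinP; exact: measurable_funX.
  by apply: filterS ae => w Ew _; rewrite Ew.
move: E2; rewrite unlock => /le_trans; apply.
by rewrite EFinM lee_wpmul2l// lee_fin.
Qed.

End noise.

(** * Regularity of the class, step functions and periodicity *)

Section upper.
Context (R : realType).
Local Notation mu := (@lebesgue_measure R).
Local Notation I := (`[0%R, 1%R]%classic : set R).
Local Notation ts := (tsum (@tb R)).
Local Notation omega := (2 * pi : R).

Lemma periodic_int (f : R -> R) : (forall x, f (x + 1) = f x) ->
  forall (z : int) x, f (x + z%:~R) = f x.
Proof.
move=> fp.
have fn n x : f (x + n%:R) = f x.
  by elim: n => [|n IH]; rewrite ?addr0// -natr1 addrA fp.
case=> n x; first exact: fn.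
by rewrite NegzE mulrNz -(fn n.+1 (x - n.+1%:R)) subrK.
Qed.

(** The class gives continuity on [0, 1] only. On the line S is a uniform limit of periodic
    continuous functions, which also covers the integers. *)
Lemma class_continuousT k (r : R) (S : R -> R) : (0 < k)%N -> function_class k r S ->
  continuous S.
Proof.
move=> k0 SW x; apply/cvgrPdist_le => /= e e0.
have e3 : 0 < e / 3 by rewrite divr_gt0.
have [N [c cE]] := class_approx k0 SW e3.
have H y : `|ts c N y - S y| <= e / 3.
  rewrite -(periodic_int (tsum_periodic c N) (- Num.floor y)).
  have [Sp _] := SW; rewrite -(periodic_int Sp (- Num.floor y)).
  apply: cE; rewrite in_itv/= rmorphN/= subr_ge0 floor_le_tmp/=.
  have := floorD1_gt y; rewrite intrD => /ltW; rewrite lerBlDl; exact.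
have := @continuous_tsum R c N x => /cvgrPdist_le /(_ _ e3).
apply: filterS => y Hy.
have -> : S x - S y = - (ts c N x - S x) + (ts c N x - ts c N y) + (ts c N y - S y) by ring.
rewrite (le_trans (ler_normD _ _))// [leRHS](_ : _ = e / 3 + e / 3 + e / 3); last by field.
by rewrite lerD// (le_trans (ler_normD _ _))// lerD// normrN.
Qed.

Lemma class_ip k (r : R) (S : R -> R) : function_class k r S -> ip S S <= r.
Proof.
move=> SW; have [cS _] := class_continuous SW; have qS := sqint_cont cS.
case: SW => _ [D [D0 _ _ _]]; rewrite big_nat_recl//= => Dr.
rewrite -lee_fin -sqnormE//; apply: le_trans Dr.
rewrite (_ : sqnorm S = sqnorm (D 0%N)); first by rewrite leeDl// sume_ge0// => i _;
  apply: integral_ge0 => x _; rewrite lee_fin sqr_ge0.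
by apply: eq_integral => x; rewrite inE => xI; rewrite D0.
Qed.

Lemma tb_lipschitz j : exists2 L : R, 0 <= L & forall x y : R, `|tb j x - tb j y| <= L * `|x - y|.
Proof.
have H (f df : R -> R) (L : R) : (forall x : R, is_derive x 1 f (df x)) -> (forall x, `|df x|
  <= L) ->
    forall x y : R, `|f x - f y| <= L * `|x - y|.
  move=> fd fL x y; wlog yx : x y / y <= x => [h|].
    have [/h//|/ltW/h] := leP y x; by rewrite distrC (distrC x).
  have [z _ ->] := MVT_segment yx (fun z _ => fd z)
    (continuous_subspaceT (is_derive_continuous fd)).
  by rewrite normrM ler_wpM2r.
have s0 : 0 <= Num.sqrt 2 :> R by exact: sqrtr_ge0.
elim/tb_ind: j => [|l|l].
- by exists 0 => // x y; rewrite /tb/= subrr normr0 mul0r.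
- have f0 : 0 <= freq R l.*2.+1 by rewrite /freq mulr_ge0// mulr_ge0// pi_ge0.
  exists (freq R l.*2.+1 * Num.sqrt 2); first exact: mulr_ge0.
  apply: (H _ _ _ (is_derive_tb_odd l)) => x.
  rewrite normrM normrN (ger0_norm f0) ler_wpM2l// tb_sin normrM ger0_norm//.
  by rewrite ler_piMr// sin_max.
- have f0 : 0 <= freq R l.*2.+2 by rewrite /freq mulr_ge0// mulr_ge0// pi_ge0.
  exists (freq R l.*2.+2 * Num.sqrt 2); first exact: mulr_ge0.
  apply: (H _ _ _ (is_derive_tb_even l)) => x.
  rewrite normrM (ger0_norm f0) ler_wpM2l// tb_cos normrM ger0_norm//.
  by rewrite ler_piMr// cos_max.
Qed.

Section steps.
Variables (t : nat -> R) (N : nat).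
Hypothesis tS : forall i, (i < N)%N -> t i <= t i.+1.

Let t_le i j : (i <= j)%N -> (j <= N)%N -> t i <= t j.
Proof.
elim: j => [|j IH]; first by rewrite leqn0 => /eqP ->.
rewrite leq_eqVlt => /predU1P[-> //|]; rewrite ltnS => ij jN.
by apply: (le_trans (IH ij (ltnW jN))); exact: tS.
Qed.

Lemma step_at a u i : (i < N)%N -> t i < u <= t i.+1 -> step a t N u = a i.
Proof.
move=> iN /andP[u1 u2]; rewrite /step (bigD1 (Ordinal iN))//=.
rewrite indicE mem_set ?mulr1; last by rewrite /= in_itv/= u1 u2.
rewrite big1 ?addr0// => j ji; rewrite indicE memNset ?mulr0//= in_itv/=.
move=> /andP[v1 v2].
have [jli|ilj|jEi] := ltngtP j i.
- by have := le_lt_trans (le_trans v2 (t_le jli (ltnW iN))) u1; rewrite ltxx.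
- by have := le_lt_trans (le_trans u2 (t_le ilj (ltnW (ltn_ord j)))) v1; rewrite ltxx.
- by move: ji; rewrite -(inj_eq val_inj)/= jEi eqxx.
Qed.

Lemma step_out a u : ~ (t 0%N < u <= t N) -> step a t N u = 0.
Proof.
move=> nu; rewrite /step big1// => j _; rewrite indicE memNset ?mulr0//= in_itv/=.
move=> /andP[v1 v2]; apply: nu.
rewrite (le_lt_trans (t_le (leq0n j) (ltnW (ltn_ord j))) v1)/=.
by rewrite (le_trans v2)// t_le.
Qed.

Lemma step_find u : t 0%N < u <= t N -> exists2 i, (i < N)%N & t i < u <= t i.+1.
Proof.
elim: {-2}N (leqnn N) => [|M IH] MN.
  by move=> /andP[u0 u1]; have := lt_le_trans u0 u1; rewrite ltxx.
move=> /andP[u0 u1]; have [uM|uM] := leP u (t M).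
  have [|i iM H] := IH (ltnW MN); first by rewrite u0.
  by exists i => //; exact: ltnW.
by exists M => //; rewrite uM.
Qed.

Lemma step_sq a u : step a t N u ^+ 2 = step (fun i => a i ^+ 2) t N u.
Proof.
have [H|/negP H] := boolP (t 0%N < u <= t N).
  by have [i iN ti] := step_find H; rewrite !(step_at _ iN ti).
by rewrite !step_out// expr0n.
Qed.

Lemma integral_step_sq a b : 0 <= t 0%N -> t N <= b ->
  (\int[mu]_(s in (`[0%R, b] : set R)) ((step a t N s) ^+ 2)%:E =
   (\sum_(i < N) a i ^+ 2 * (t i.+1 - t i))%:E)%E.
Proof.
move=> t0 tb.
under eq_integral do rewrite step_sq /step -sumEFin.
rewrite ge0_integral_sum//=; last 2 first.
- by move=> i; apply/measurable_EFinP; apply: measurable_funM.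
- by move=> i s _; rewrite lee_fin mulr_ge0 ?sqr_ge0.
rewrite -sumEFin; apply: eq_bigr => i _.
under eq_integral => s _ do rewrite [(_ * \1_(_) _)%:E](EFinM (a i ^+ 2)).
rewrite ge0_integralZl_EFin//=; last 2 first.
- exact/measurable_EFinP.
- exact: sqr_ge0.
rewrite [RHS](EFinM (a i ^+ 2)) integral_indic//= setIidl; last first.
  move=> x /=; rewrite !in_itv/= => /andP[x1 x2].
  rewrite (le_trans t0 (le_trans (t_le (leq0n i) (ltnW (ltn_ord i))) (ltW x1)))/=.
  exact: (le_trans x2 (le_trans (t_le (ltn_ord i) (leqnn N)) tb)).
congr (_ * _)%E; rewrite lebesgue_measure_itv/= lte_fin.
case: ltP => [_|h]; first by rewrite EFinB.
by congr EFin; apply/esym/eqP; rewrite subr_eq0 eq_le h tS.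
Qed.

End steps.

Lemma integral_translation (f : R -> \bar R) b : measurable_fun [set: R] f ->
  (\int[mu]_x f (x + b)%R = \int[mu]_x f x)%E.
Proof.
move=> mf; rewrite [LHS]integralE [RHS]integralE; congr (_ - _)%E.
  rewrite -(ge0_integral_translation b (measurable_funepos mf)); last exact: funepos_ge0.
  by apply: eq_integral => x _; rewrite !funeposE.
rewrite -(ge0_integral_translation b (measurable_funeneg mf)); last exact: funeneg_ge0.
by apply: eq_integral => x _; rewrite !funenegE.
Qed.

Lemma Rintegral_period (S : R -> R) a b : continuous S -> (forall x, S (x + 1) = S x) ->
  \int[mu]_(x in `]a + 1, b + 1]) S x = \int[mu]_(x in `]a, b]) S x.
Proof.
move=> cS Sp; rewrite /Rintegral; congr fine.
rewrite [LHS]integral_mkcond [RHS]integral_mkcond.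
have mS : measurable_fun [set: R] S by exact: continuous_measurable_fun.
rewrite -(@integral_translation _ 1).
  apply: eq_integral => x _; rewrite !patchE.
  have -> : (x + 1 \in `]a + 1, b + 1]%classic) = (x \in `]a, b]%classic).
    by apply/idP/idP; rewrite !inE/= !in_itv/= ltrD2r lerD2r.
  by rewrite Sp.
apply/(measurable_restrictT _ _).1 => //.
by apply: measurable_funTS; exact/measurable_EFinP.
Qed.

Lemma sum_periodic (f : nat -> R) n M : (forall i, f (i + M)%N = f i) ->
  \sum_(i < n * M) f i = n%:R * \sum_(i < M) f i.
Proof.
move=> fp; elim: n => [|n IH]; first by rewrite mul0n big_ord0 mul0r.
rewrite mulSnr big_split_ord/= IH -natr1 mulrDl mul1r; congr (_ + _).
have H q i : f (i + q * M)%N = f i.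
  by elim: q => [|q IHq]; rewrite ?addn0// mulSnr addnA fp.
by apply: eq_bigr => i _; rewrite addnC H.
Qed.

Lemma integrable_itv (S : R -> R) a b : continuous S ->
  mu.-integrable `[a, b] (fun x => (S x)%:E).
Proof.
move=> cS; apply: continuous_compact_integrable; first exact: segment_compact.
exact: continuous_subspaceT.
Qed.

Lemma observation_diff (S : R -> R) (w : cadlag_path R) s t : continuous S -> 0 <= s -> s <= t ->
  observation S w t - observation S w s = \int[mu]_(x in `]s, t]) S x + (w t - w s).
Proof.
move=> cS s0 st; rewrite /observation opprD addrACA; congr (_ + _).
rewrite (@Rintegral_itvB R S (BLeft 0) (BRight t) s)//.
exact: integrable_itv.
Qed.

(** Bias and variance; [X] is integrable because |X| <= 1 + X^2. *)
Lemma ge0_mean0_sq d (T : measurableType d) (P : probability T R) (X : T -> R) (a b v : R) :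
  measurable_fun setT X -> (\int[P]_w (X w)%:E = 0)%E ->
  (\int[P]_w ((X w) ^+ 2)%:E <= v%:E)%E ->
  (\int[P]_w ((a + b * X w) ^+ 2)%:E <= (a ^+ 2 + b ^+ 2 * v)%:E)%E.
Proof.
move=> mX X0 Xv.
have mX2 : measurable_fun setT (fun w => ((X w) ^+ 2)%:E).
  by apply/measurable_EFinP; exact: measurable_funX.
have iX2 : P.-integrable setT (fun w => ((X w) ^+ 2)%:E).
  apply/integrableP; split => //.
  under eq_integral do rewrite gee0_abs ?lee_fin ?sqr_ge0//.
  exact: le_lt_trans Xv (ltry _).
have i1 c : P.-integrable setT (fun=> c%:E).
  apply/integrableP; split; first exact: measurable_cst.
  by rewrite (@integral_prob_cst _ _ _ P) ltry.
have iX : P.-integrable setT (fun w => (X w)%:E).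
  apply: (@le_integrable _ _ _ P setT _ _ (fun w => 1 + ((X w) ^+ 2)%:E)%E) => //.
  - exact/measurable_EFinP.
  - move=> w _; rewrite -EFinD !abse_EFin lee_fin [leRHS]ger0_norm ?addr_ge0 ?sqr_ge0//.
    rewrite -(real_normK (num_real (X w))); set y := `|X w|.
    by have := sqr_ge0 (y - 1); have := normr_ge0 (X w); rewrite -/y; nra.
  - by apply: integrableD => //; exact: i1.
under eq_integral.
  move=> w _.
  have -> : ((a + b * X w) ^+ 2)%:E =
      ((a ^+ 2)%:E + ((2 * a * b)%:E * (X w)%:E + (b ^+ 2)%:E * ((X w) ^+ 2)%:E))%E.
    by rewrite -!EFinM -!EFinD; congr EFin; ring.
  over.
rewrite integralD//=; last by apply: integrableD => //; exact: integrableZl.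
rewrite integralD//=; [|exact: integrableZl|exact: integrableZl].
rewrite !integralZl// X0 mule0 add0e (@integral_prob_cst _ _ _ P) EFinD leeD2l//.
by rewrite (EFinM (b ^+ 2)) lee_wpmul2l// lee_fin sqr_ge0.
Qed.

(** From the nonnegativity of ||f + g/e||^2 and ||f - g/e||^2, multiplied by e. *)
Lemma ip_young (f g : R -> R) (e : R) : sqint f -> sqint g -> 0 < e ->
  2 * `|ip f g| <= e * ip f f + e^-1 * ip g g.
Proof.
move=> qf qg e0.
have H c : 0 <= ip f f + 2 * c * ip f g + c ^+ 2 * ip g g.
  have q : sqint (fun x => c * g x + f x) by exact: sqint_lin.
  have -> : ip f f + 2 * c * ip f g + c ^+ 2 * ip g g =
    ip (fun x => c * g x + f x) (fun x => c * g x + f x).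
    rewrite (ip_lin c qg qf q) (ipC g (fun x => c * g x + f x)) (ipC f (fun x => c * g x + f x)).
    by rewrite (ip_lin c qg qf qg) (ip_lin c qg qf qf) (ipC g f); ring.
  exact: ip_ge0.
have ei0 : 0 < e^-1 by rewrite invr_gt0.
have e1 : e * e^-1 = 1 by rewrite divff// gt_eqF.
have := mulr_ge0 (ltW e0) (H e^-1); have := mulr_ge0 (ltW e0) (H (- e^-1)).
have -> : e * (ip f f + 2 * e^-1 * ip f g + e^-1 ^+ 2 * ip g g) =
  e * ip f f + 2 * (e * e^-1) * ip f g + (e * e^-1) * e^-1 * ip g g by ring.
have -> : e * (ip f f + 2 * - e^-1 * ip f g + (- e^-1) ^+ 2 * ip g g) =
  e * ip f f - 2 * (e * e^-1) * ip f g + (e * e^-1) * e^-1 * ip g g by ring.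
rewrite e1 => h1 h2.
rewrite !mulr1 mul1r in h1 h2.
case: ger0P => _; lra.
Qed.

End upper.

(** * Riemann-sum estimators of the coefficients *)

Section linear_estimator.
Context (R : realType).
Local Notation mu := (@lebesgue_measure R).
Local Notation I := (`[0%R, 1%R]%classic : set R).
Local Notation ts := (tsum (@tb R)).

Lemma ip_le_bound (f : R -> R) c : sqint f -> (forall x : R, 0 < x <= 1 -> `|f x| <= c) ->
  ip f f <= c ^+ 2.
Proof.
move=> qf fc; rewrite -lee_fin -sqnormE// /sqnorm -integral_itv_obnd_cbnd; last first.
  apply/measurable_EFinP/measurable_funX; apply: measurable_funS qf.1 => //.
  by apply: subset_itvr; rewrite bnd_simp.
apply: (@le_trans _ _ (\int[mu]_(x in `]0%R, 1%R]) (c ^+ 2)%:E)%E).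
  apply: ge0_le_integral => //.
  - by move=> x _; rewrite lee_fin sqr_ge0.
  - apply/measurable_EFinP/measurable_funX; apply: measurable_funS qf.1 => //.
    by apply: subset_itvr; rewrite bnd_simp.
  - by move=> x /=; rewrite in_itv/= => /fc h; rewrite lee_fin -real_normK ?num_real//
    lerXn2r// nnegrE (le_trans _ h).
rewrite integral_cst//= lebesgue_measure_itv/= lte_fin ltr01 oppr0 adde0.
by rewrite mule1.
Qed.

(** [ip_young] applied to f and g - h, with a weight [e] of the size of g - h: both terms are then
    of order e. *)
Lemma ip_close (f g h : R -> R) (e rho c : R) : sqint f -> sqint g -> sqint h -> 0 < e ->
  ip f f <= rho -> ip (fun x => g x - h x) (fun x => g x - h x) <= (c * e) ^+ 2 ->
  `|ip f g - ip f h| <= (rho + c ^+ 2) / 2 * e.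
Proof.
move=> qf qg qh e0 frho ghc.
have qd : sqint (fun x => g x - h x).
  by apply: sqint_ext (sqint_lin (-1) qh qg) => x _; ring.
have -> : ip f g - ip f h = ip f (fun x => g x - h x).
  rewrite (ipC f (fun x => g x - h x)) (ipC f g) (ipC f h) addrC -mulN1r -ip_lin//.
  - by apply: eq_Rintegral => x _; ring.
have := ip_young qf qd e0.
have : e^-1 * ip (fun x => g x - h x) (fun x => g x - h x) <= c ^+ 2 * e.
  rewrite -(ler_pM2l e0) mulrA divff ?gt_eqF// mul1r (le_trans ghc)//.
  by rewrite [leRHS](_ : _ = (c * e) ^+ 2)//; ring.
have : e * ip f f <= e * rho by rewrite ler_pM2l.
by set u := ip f (fun _ => _); lra.
Qed.

Section mesh.
Variables (n M : nat).
Hypotheses (n0 : (0 < n)%N) (M0 : (0 < M)%N).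

Definition mesh (i : nat) : R := i%:R / M%:R.

Let Mp : 0 < M%:R :> R. Proof. by rewrite ltr0n. Qed.

Lemma meshS i : mesh i.+1 - mesh i = M%:R^-1.
Proof. by rewrite /mesh -mulrBl -natr1 addrAC subrr add0r mul1r. Qed.

Lemma mesh_le i : mesh i <= mesh i.+1.
Proof. by rewrite -subr_ge0 meshS invr_ge0 ltW. Qed.

Lemma mesh_ge0 i : 0 <= mesh i. Proof. by rewrite divr_ge0. Qed.

Lemma mesh0 : mesh 0 = 0. Proof. by rewrite /mesh mul0r. Qed.

Lemma meshM q : mesh (q * M) = q%:R.
Proof. by rewrite /mesh natrM mulfK// gt_eqF. Qed.

Lemma mesh_shift i : mesh (i + M) = mesh i + 1.
Proof. by rewrite /mesh natrD mulrDl divff// gt_eqF. Qed.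

(** The function against which the Riemann sum [ctheta] integrates the signal over one period. *)
Definition psi j : R -> R := step (fun i => tb j (mesh i)) mesh M.

(* A Riemann sum rather than an integral against [dy]: the noise then enters only
   through integrals of step functions, which are elementary. *)
Definition ctheta j (y : R -> R) : R :=
  n%:R^-1 * \sum_(i < n * M) tb j (mesh i) * (y (mesh i.+1) - y (mesh i)).

Lemma sqint_indic (a b : R) : sqint (\1_(`]a, b]) : R -> R).
Proof.
split; first exact: measurable_funTS.
apply: (@le_lt_trans _ _ (\int[mu]_(x in I) 1)%E).
  apply: ge0_le_integral => //.
  - by apply/measurable_EFinP; apply: measurable_funTS; apply: measurable_funX.
  - move=> x _; rewrite lee_fin indicE; case: (_ \in _); by rewrite ?expr1n// expr0n.
by rewrite integral_cst//= mul1e lebesgue_measure_itv/= lte_fin ltr01 -EFinB ltry.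
Qed.

Lemma sqint_psi j : sqint (psi j).
Proof.
exact: (@sqint_tsum R (fun i => \1_(`]mesh i, mesh i.+1]) : R -> R)
  (fun i => sqint_indic _ _)).
Qed.

Lemma psi_close j (L : R) : (forall x y : R, `|tb j x - tb j y| <= L * `|x - y|) -> 0 <= L ->
  forall x : R, 0 < x <= 1 -> `|psi j x - tb j x| <= L * M%:R^-1.
Proof.
move=> HL L0 x x01; have tS i : (i < M)%N -> mesh i <= mesh i.+1 by move=> _; exact: mesh_le.
have [|i iM xi] := @step_find R mesh M x; first by rewrite mesh0 -[M]mul1n meshM.
rewrite /psi (step_at tS _ iM xi) (le_trans (HL _ _))// ler_wpM2l//.
case/andP: xi => x1 x2; rewrite distrC ger0_norm; last by rewrite subr_ge0 ltW.
by rewrite -(meshS i) lerB.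
Qed.

Lemma ip_psi j (S : R -> R) : continuous S ->
  ip S (psi j) = \sum_(i < M) tb j (mesh i) * \int[mu]_(x in `]mesh i, mesh i.+1]) S x.
Proof.
move=> cS; have qS : sqint S by exact/sqint_cont/continuous_subspaceT.
rewrite ipC (@ip_tsum R (fun i => \1_(`]mesh i, mesh i.+1]))); last 2 first.
- by move=> i; exact: sqint_indic.
- exact: qS.
apply: eq_bigr => i _; congr (_ * _).
rewrite /ip [LHS]Rintegral_mkcond [RHS]Rintegral_mkcond; congr fine.
apply: eq_integral => x _; congr EFin; rewrite !patchE indicE.
have [xi|xi] := boolP (x \in `]mesh i, mesh i.+1]%classic).
  rewrite ifT ?mul1r//; move: xi; rewrite !inE/= !in_itv/= => /andP[x1 x2].
  rewrite (le_trans (mesh_ge0 i) (ltW x1))/= (le_trans x2)//.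
  rewrite -[leRHS](meshM 1) mul1n ler_pM2r ?invr_gt0// ler_nat; exact: ltn_ord.
by rewrite mul0r; case: ifP.
Qed.

(** Each of the n periods contributes the same inner product with the signal, and the noise enters
    through increments on [0, n]. *)
Lemma ctheta_observation j (S : R -> R) (w : cadlag_path R) : continuous S ->
  (forall x, S (x + 1) = S x) ->
  ctheta j (observation S w) = ip S (psi j) +
    n%:R^-1 * \sum_(i < n * M) tb j (mesh i) * (Defs.coord (mesh i.+1) w - Defs.coord (mesh i) w).
Proof.
move=> cS Sp; rewrite /ctheta ip_psi//.
under eq_bigr do rewrite (observation_diff w cS (mesh_ge0 _) (mesh_le _)) mulrDr.
rewrite big_split/= mulrDr; congr (_ + _).
rewrite (@sum_periodic R (fun i => tb j (mesh i) * \int[mu]_(x in `]mesh i, mesh i.+1]) S x)).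
  by rewrite mulrA mulVf ?mul1r// pnatr_eq0 -lt0n.
by move=> i; rewrite -addSn !mesh_shift tb_periodic Rintegral_period.
Qed.

Lemma measurable_ctheta j : measurable_fun setT (fun y : observed R n => ctheta j y).
Proof.
apply: measurable_funM => //; apply: measurable_sum => i.
apply: measurable_funM => //.
have H q : (q <= n * M)%N -> measurable_fun setT (fun y : observed R n => (y : R -> R) (mesh q)).
  move=> qn; apply: (@measurable_coord_paths R `[0, n%:R]%classic).
  by rewrite /= in_itv/= mesh_ge0/= -(meshM n) ler_pM2r ?invr_gt0// ler_nat.
by apply: measurable_funB; apply: H => //; exact: ltnW.
Qed.

Lemma measurable_linear_estimator (lam : nat -> R) m :
  estimator n (fun y => ts (fun j => lam j * ctheta j y) m).
Proof.
rewrite /estimator/=; apply: measurable_funTS; apply: measurable_sum => j.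
apply: measurable_funM.
  apply: measurable_funM => //.
  exact: (measurableT_comp (measurable_ctheta j) measurable_fst).
apply: (measurableT_comp _ measurable_snd).
exact: continuous_measurable_fun (@continuous_tb R j).
Qed.

(** Expand ||psi - tb||^2 <= (L/M)^2, where the inner product of psi and tb is at most 1 + (1 + L^2)
    / (2M). *)
Lemma ip_psi_psi_le j (L : R) : (forall x y : R, `|tb j x - tb j y| <= L * `|x - y|) -> 0 <= L ->
  ip (psi j) (psi j) <= 1 + (1 + 2 * L ^+ 2) * M%:R^-1.
Proof.
move=> HL L0; have qp := sqint_psi j; have qt := @sqint_tb R j.
have qd : sqint (fun x => psi j x - tb j x).
  by apply: sqint_ext (sqint_lin (-1) qt qp) => x _; ring.
have := ip_le_bound qd (psi_close HL L0) => hd.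
have ei0 : 0 < M%:R^-1 :> R by rewrite invr_gt0.
have e1 : M%:R^-1 <= 1 :> R by rewrite invf_le1// ler1n.
have tt : ip (tb j) (tb j) = 1 :> R by rewrite ip_tb eqxx.
have := @ip_close (@tb R j) _ _ _ _ _ qt qp qt ei0 (lexx _) hd.
rewrite tt; move: hd; rewrite ip_sub// tt (ipC (tb j)).
set a := ip _ _; set b := ip _ _; set e := M%:R^-1 in ei0 e1 *.
rewrite ler_norml => h /andP[_ h2].
have : (L * e) ^+ 2 <= L ^+ 2 * e.
  by rewrite exprMn ler_wpM2l ?sqr_ge0// expr2 ler_piMr// ltW.
nra.
Qed.

Lemma noise_moments (sigma : R) (Q : probability (skorohod R) R) j (L : R) : 0 < sigma ->
  noise_class sigma n Q ->
  (forall x y : R, `|tb j x - tb j y| <= L * `|x - y|) -> 0 <= L ->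
  let Y w := \sum_(i < n * M) tb j (mesh i) * (Defs.coord (mesh i.+1) w - Defs.coord (mesh i) w) in
  [/\ measurable_fun setT (Y : skorohod R -> R), (\int[Q]_w (Y w)%:E = 0)%E
    & (\int[Q]_w ((Y w) ^+ 2)%:E <= (sigma * (n%:R * (1 + (1 + 2 * L ^+ 2) * M%:R^-1)))%:E)%E].
Proof.
move=> s0 hQ HL L0.
have tN i : (i < n * M)%N -> 0 <= mesh i /\ mesh i <= mesh i.+1 /\ mesh i.+1 <= n%:R.
  move=> iN; rewrite mesh_ge0 mesh_le; split => //; split => //.
  by rewrite -(meshM n) ler_pM2r ?invr_gt0// ler_nat.
have HV : (\int[lebesgue_measure]_(s in (`[0%R, n%:R] : set R))
    ((step (fun i => tb j (mesh i)) mesh (n * M) s) ^+ 2)%:E <=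
    (n%:R * (1 + (1 + 2 * L ^+ 2) * M%:R^-1))%:E)%E.
  rewrite integral_step_sq//; last 3 first.
  - by move=> i _; exact: mesh_le.
  - by rewrite mesh0.
  - by rewrite meshM.
  rewrite lee_fin (@sum_periodic R (fun i => tb j (mesh i) ^+ 2 * (mesh i.+1 - mesh i))).
    rewrite ler_wpM2l//; apply: le_trans (ip_psi_psi_le HL L0).
    rewrite -lee_fin -sqnormE; last exact: sqint_psi.
    rewrite /sqnorm /psi integral_step_sq//.
    - by move=> i _; exact: mesh_le.
    - by rewrite mesh0.
    - by rewrite -[M]mul1n meshM.
  by move=> i; rewrite -addSn !mesh_shift tb_periodic; congr (_ * _); ring.
exact: (step_moments n0 hQ tN HV).
Qed.

End mesh.
End linear_estimator.

(** * Risk of the Pinsker estimator *)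

Section upper_bound.
Context (R : realType).
Local Notation ts := (tsum (@tb R)).

(** The term of the top derivative alone, with frequency at least pi j. *)
Lemma energy_ge k j : ((pi : R) * j%:R) ^+ (2 * k) <= energy R k j.
Proof.
rewrite /energy big_ord_recr/= -[leLHS]add0r lerD//.
  by apply: sumr_ge0 => q _; rewrite exprn_even_ge0// oddM.
have pj : 0 <= (pi : R) * j%:R by rewrite mulr_ge0// pi_ge0.
have jf : pi * j%:R <= freq R j.
  rewrite /freq [2 * _]mulrC -mulrA ler_wpM2l ?pi_ge0// -natrM ler_nat; lia.
by rewrite lerXn2r// nnegrE (le_trans pj).
Qed.

(** For j < m the weight (j/m)^(2k) is (pi j)^(2k) / (pi m)^(2k), and for j >= m the energy is at
    least (pi m)^(2k): both ranges are charged to the same ellipsoid. Completeness makes what lies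
    beyond N at most e. *)
Lemma bias_le k r m (S : R -> R) : (0 < k)%N -> (0 < m)%N -> function_class k r S ->
  \sum_(j < m) (j%:R / m%:R) ^+ (2 * k) * ip S (tb j) ^+ 2 +
  (ip S S - \sum_(j < m) ip S (tb j) ^+ 2) <= r / (pi * m%:R) ^+ (2 * k).
Proof.
move=> k0 m0 SW; apply/ler_addgt0Pr => e e0.
have pm0 : 0 < pi * m%:R :> R by rewrite mulr_gt0// ?pi_gt0// ltr0n.
have P0 : 0 < (pi * m%:R) ^+ (2 * k) :> R by rewrite exprn_gt0.
have [N0 HN] := class_complete k0 SW e0.
pose L := maxn N0 m; pose N := L.*2.+1.
have NL : (L <= N)%N by rewrite /N -addnn; lia.
have := HN _ (leq_trans (leq_maxl N0 m) NL); rewrite -/N.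
have mN : (m <= N)%N := leq_trans (leq_maxr N0 m) NL.
have splitN (f : nat -> R) : \sum_(j < N) f j = \sum_(j < m) f j + \sum_(m <= j < N) f j.
  by rewrite -!(big_mkord xpredT f) (big_cat_nat (n := m)).
rewrite (splitN (fun j => ip S (tb j) ^+ 2)) => HT.
suff H : \sum_(j < m) (j%:R / m%:R) ^+ (2 * k) * ip S (tb j) ^+ 2 +
    \sum_(m <= j < N) ip S (tb j) ^+ 2 <= r / (pi * m%:R) ^+ (2 * k) by lra.
rewrite ler_pdivlMr//; apply: le_trans (class_bound L SW); rewrite -/N (splitN (fun j => energy
  R k j * ip S (tb j) ^+ 2)) mulrDl !mulr_suml.
apply: lerD.
  apply: ler_sum => j _; rewrite mulrAC ler_wpM2r ?sqr_ge0// -exprMn.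
  rewrite (_ : _ / _ * _ = pi * j%:R); first exact: energy_ge.
  by rewrite mulrCA mulrVK// unitfE pnatr_eq0 -lt0n.
rewrite big_nat [leRHS]big_nat; apply: ler_sum => j /andP[mj _].
rewrite mulrC ler_wpM2r ?sqr_ge0// (le_trans _ (energy_ge k j))//.
by rewrite lerXn2r ?nnegrE ?mulr_ge0 ?pi_ge0// ler_wpM2l ?pi_ge0// ler_nat.
Qed.

(** Separates the squared bias for the exact coefficient from the effect of the mesh size [e]. *)
Lemma square_perturb (lam theta d D e r : R) : 0 <= lam <= 1 -> 0 <= e <= 1 -> theta ^+ 2 <= r ->
  `|d - theta| <= D * e ->
  (lam * d - theta) ^+ 2 <= (1 - lam) ^+ 2 * theta ^+ 2 + (D ^+ 2 + 2 * (1 + r) * D) * e.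
Proof.
move=> /andP[l0 l1] /andP[e0 e1] tr dD.
set z := d - theta in dD; have -> : lam * d - theta = lam * z - (1 - lam) * theta by rewrite
  /z; ring.
have z0 := normr_ge0 z; have t0 := normr_ge0 theta.
have r1 : `|theta| <= 1 + r.
  by move: tr; rewrite -real_normK ?num_real//; set u := `|theta| in t0 *; nra.
have -> : (lam * z - (1 - lam) * theta) ^+ 2 =
  (1 - lam) ^+ 2 * theta ^+ 2 + (lam ^+ 2 * z ^+ 2 - 2 * (lam * (1 - lam)) * (z * theta)) by ring.
rewrite lerD2l; apply: le_trans (ler_norm _) _; apply: le_trans (ler_normB _ _) _.
rewrite [leRHS]mulrDl; apply: lerD.
  rewrite normrM !normrX (ger0_norm l0) -exprMn.
  have h : lam * `|z| <= D * e by rewrite (le_trans _ dD)// ler_piMl.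
  have h0 : 0 <= lam * `|z| by exact: mulr_ge0.
  have := lerXn2r 2 h0 (le_trans h0 h) h => /le_trans; apply.
  by rewrite exprMn ler_wpM2l ?sqr_ge0// expr2 ler_piMl.
rewrite !normrM (ger0_norm (ler0n _ 2)) -!mulrA ler_wpM2l// mulrA.
have l2 : 0 <= `|lam| * `|1 - lam| <= 1.
  by rewrite mulr_ge0//= !ger0_norm ?subr_ge0//; nra.
case/andP: l2 => l20 l21; set c := _ * `|1 - lam| in l20 l21 *.
have zt : 0 <= `|z| * `|theta| by exact: mulr_ge0.
rewrite (le_trans (ler_piMl zt l21))// mulrC.
by apply: ler_pM.
Qed.

(** By [sqnorm_tsum_sub] the loss is a sum of squared errors on m coefficients plus the tail, and
    each error is a bias plus centred noise. All effects of the mesh are gathered in the last sum,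
    divided by [M]. *)
Lemma risk_linear_le k r n m M (S : R -> R) (sigma : R) (Q : probability (skorohod R) R)
    (lam L : nat -> R) :
  (0 < k)%N -> (0 < n)%N -> (0 < M)%N -> 0 < sigma -> function_class k r S ->
  noise_class sigma n Q -> (forall j, 0 <= lam j <= 1) ->
  (forall j, 0 <= L j) -> (forall j (x y : R), `|tb j x - tb j y| <= L j * `|x - y|) ->
  (\int[Q]_w sqnorm (fun x => ts (fun j => lam j * ctheta n M j (observation S w)) m x - S x)%R <=
   (\sum_(j < m) (1 - lam j) ^+ 2 * ip S (tb j) ^+ 2 + (ip S S - \sum_(j < m) ip S (tb j) ^+ 2) +
    sigma / n%:R * \sum_(j < m) lam j ^+ 2 +
    M%:R^-1 * \sum_(j < m) (((r + L j ^+ 2) / 2) ^+ 2 + 2 * (1 + r) * ((r + L j ^+ 2) / 2) +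
       sigma / n%:R * (1 + 2 * L j ^+ 2)))%:E)%E.
Proof.
move=> k0 n0 M0 s0 SW hQ lam01 L0 HL.
have cS := class_continuousT k0 SW; have [Sp _] := SW.
have qS : sqint S by exact/sqint_cont/continuous_subspaceT.
have Sr := class_ip SW.
pose theta j := ip S (tb j); pose d j := ip S (@psi R M j).
pose Y j (w : skorohod R) := \sum_(i < n * M) tb j (@mesh R M i) *
  (Defs.coord (@mesh R M i.+1) w - Defs.coord (@mesh R M i) w).
pose tail := ip S S - \sum_(j < m) theta j ^+ 2.
have tail0 : 0 <= tail by rewrite subr_ge0; exact: (bessel (@sqint_tb R) (@ip_tb R)).
have ei0 : 0 < M%:R^-1 :> R by rewrite invr_gt0 ltr0n.
have ei1 : M%:R^-1 <= 1 :> R by rewrite invf_le1 ?ltr0n// ler1n.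
have theta2 j : theta j ^+ 2 <= r.
  apply: le_trans Sr; apply: le_trans (bessel (@sqint_tb R) (@ip_tb R) j.+1 qS).
  by rewrite big_ord_recr/= lerDr sumr_ge0// => i _; exact: sqr_ge0.
have dD j : `|d j - theta j| <= (r + L j ^+ 2) / 2 * M%:R^-1.
  have qp : sqint (@psi R M j) by exact: sqint_psi.
  have qt := @sqint_tb R j.
  apply: ip_close => //; apply: (@ip_le_bound R _ (L j * M%:R^-1)).
    by apply: sqint_ext (sqint_lin (-1) qt qp) => x _; ring.
  exact: psi_close.
pose a j := lam j * d j - theta j; pose b j := lam j / n%:R.
have E w : sqnorm (fun x => ts (fun j => lam j * ctheta n M j (observation S w)) m x - S x) =
    ((\sum_(j < m) (((a j + b j * Y j w) ^+ 2)%:E)) + tail%:E)%E.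
  rewrite (sqnorm_tsum_sub (@sqint_tb R) (@ip_tb R))// EFinD; congr (_ + _)%E.
  rewrite sumEFin; congr EFin; apply: eq_bigr => j _.
  by rewrite ctheta_observation// /a /b /d /theta /Y; congr (_ ^+ 2); ring.
rewrite (eq_integral (fun w : skorohod R =>
  (\sum_(j < m) ((a j + b j * Y j w) ^+ 2)%:E + tail%:E)%E)); last by move=> w _; exact: E.
have YM j := noise_moments n0 M0 s0 hQ (HL j) (L0 j).
have mY j : measurable_fun setT (fun w => ((a j + b j * Y j w) ^+ 2)%:E).
  apply/measurable_EFinP/measurable_funX/measurable_funD => //.
  by apply: measurable_funM => //; case: (YM j).
rewrite ge0_integralD//=; last 2 first.
- by move=> w _; apply: sume_ge0 => j _; rewrite lee_fin sqr_ge0.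
- by apply: emeasurable_sum => j _; exact: mY.
rewrite ge0_integral_sum//; last by move=> j w _; rewrite lee_fin sqr_ge0.
rewrite (@integral_prob_cst _ _ _ Q).
pose vj j := sigma * (n%:R * (1 + (1 + 2 * L j ^+ 2) * M%:R^-1)).
have H j : (\int[Q]_w ((a j + b j * Y j w) ^+ 2)%:E <= (a j ^+ 2 + b j ^+ 2 * vj j)%:E)%E.
  by case: (YM j) => m1 m2 m3; exact: ge0_mean0_sq.
apply: (@le_trans _ _ ((\sum_(j < m) (a j ^+ 2 + b j ^+ 2 * vj j)%:E) + tail%:E)%E).
  by rewrite leeD2r// lee_sum.
rewrite sumEFin -EFinD lee_fin -/tail.
rewrite [X in _ <= X](_ : _ = \sum_(j < m) ((1 - lam j) ^+ 2 * theta j ^+ 2 +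
  ((((r + L j ^+ 2) / 2) ^+ 2 + 2 * (1 + r) * ((r + L j ^+ 2) / 2)) * M%:R^-1 +
  sigma / n%:R * (lam j ^+ 2 + M%:R^-1 * (1 + 2 * L j ^+ 2)))) + tail); last first.
  rewrite !mulr_sumr -[LHS]addrA [LHS]addrAC -!big_split/=; congr (_ + tail).
  by apply: eq_bigr => j _; rewrite /theta; ring.
rewrite lerD2r; apply: ler_sum => j _; rewrite addrA lerD//.
  by apply: square_perturb => //; rewrite ltW.
have nn : n%:R != 0 :> R by rewrite pnatr_eq0 -lt0n.
rewrite /b /vj [leLHS](_ : _ = sigma / n%:R * (lam j ^+ 2 + lam j ^+ 2 * (M%:R^-1 * (1 + 2 * L
  j ^+ 2)))).
  have /andP[l0 l1] := lam01 j.
  have sn0 : 0 <= sigma / n%:R by rewrite divr_ge0// ltW.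
  rewrite ler_wpM2l// lerD2l ler_piMl ?expr_le1//.
  by rewrite mulr_ge0 ?invr_ge0// addr_ge0// mulr_ge0// sqr_ge0.
have MM : M%:R != 0 :> R by rewrite pnatr_eq0 -lt0n.
by field; rewrite nn MM.
Qed.

Lemma minimax_upper k r n m (sigma : R) (Qs : set (probability (skorohod R) R)) :
  (0 < k)%N -> (0 < n)%N -> (0 < m)%N -> 0 < sigma -> Qs `<=` noise_class sigma n ->
  (minimax_risk k r n Qs <= (r / (pi * m%:R) ^+ (2 * k) +
     sigma / n%:R * \sum_(j < m) (1 - (j%:R / m%:R) ^+ k) ^+ 2)%:E)%E.
Proof.
move=> k0 n0 m0 s0 QsP.
have [j|L HL] := @boolp.choice nat R (fun j Lj => 0 <= Lj /\
    forall x y : R, `|tb j x - tb j y| <= Lj * `|x - y|).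
  by have [Lj Lj0 H] := @tb_lipschitz R j; exists Lj.
set K := \sum_(j < m) (((r + L j ^+ 2) / 2) ^+ 2 + 2 * (1 + r) * ((r + L j ^+ 2) / 2) +
       sigma / n%:R * (1 + 2 * L j ^+ 2)).
apply/lee_addgt0Pr => e e0.
(* The mesh is refined with n and m fixed: its contribution K/M to the risk is at most e. *)
pose M := (Num.truncn (K / e)).+1.
have KM : M%:R^-1 * K <= e.
  rewrite mulrC ler_pdivrMr ?ltr0n// mulrC -ler_pdivrMr//; apply: ltW; exact: truncnS_gt.
pose lam j := if (j < m)%N then 1 - (j%:R / m%:R) ^+ k else 0 : R.
have lam01 j : 0 <= lam j <= 1.
  rewrite /lam; case: ifP => [jm|_]; last by rewrite lexx ler01.
  have h : 0 <= (j%:R / m%:R : R) <= 1.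
    by rewrite divr_ge0//= ler_pdivrMr ?ltr0n// mul1r ler_nat ltnW.
  case/andP: h => h0 h1; rewrite subr_ge0 exprn_ile1//= gerBl exprn_ge0//.
apply: (@le_trans _ _ (ereal_sup [set robust_risk Qs
   (fun y => ts (fun j => lam j * ctheta n M j y) m) S | S in function_class k r])).
  apply: ereal_inf_lbound; exists (fun y => ts (fun j => lam j * ctheta n M j y) m) => //.
  exact: measurable_linear_estimator.
apply: ge_ereal_sup => _ [S SW <-]; apply: ge_ereal_sup => _ [Q QQ <-].
have := risk_linear_le m k0 n0 (isT : (0 < M)%N) s0 SW (QsP _ QQ) lam01
  (fun j => (HL j).1) (fun j => (HL j).2).
move/le_trans; apply; rewrite -EFinD lee_fin -/K lerD// lerD//.
  apply: le_trans (bias_le k0 m0 SW); rewrite lerD2r.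
  apply: ler_sum => j _; rewrite /lam ltn_ord opprB addrCA subrr addr0.
  by rewrite -exprM mulnC.
by rewrite le_eqVlt; apply/orP; left; apply/eqP; congr (_ * _);
  apply: eq_bigr => j _; rewrite /lam ltn_ord.
Qed.

End upper_bound.

(** * The lower bound *)

Section parametrized_integrals.
Context (R : realType) d (T : measurableType d).
Local Notation mu := (@lebesgue_measure R).
Local Notation I := (`[0%R, 1%R]%classic : set R).

Let mTI : measurable (setT `*` I : set (T * measurableTypeR R)).
Proof. exact: measurableX. Qed.

Lemma measurable_ge0_section_integral (f : T * measurableTypeR R -> \bar R) :
  measurable_fun (setT `*` I) f -> (forall p, 0 <= f p)%E ->
  measurable_fun setT (fun y => \int[mu]_(x in I) f (y, x))%E.
Proof.
move=> mf f0.
rewrite (_ : (fun y => _) = fubini_F mu (f \_ (setT `*` I))).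
  apply: measurable_fun_fubini_tonelli_F.
    exact/(measurable_restrictT _ _).1.
  by move=> p; rewrite patchE; case: ifP.
apply/funext => y; rewrite /fubini_F [LHS]integral_mkcond.
have H x : ((fun x => f (y, x)) \_ I) x = (f \_ (setT `*` I)) (y, x).
  rewrite !patchE; congr (if _ then _ else _).
  by apply/idP/idP; rewrite !inE/= => // -[].
exact: (@eq_integral _ (measurableTypeR R) R mu setT _ _ (fun x _ => H x)).
Qed.

(** Sections need not be integrable: the extended integral is measurable, and so is [fine], which
    sends infinite values to 0. *)
Lemma measurable_section_integral (f : T * measurableTypeR R -> R) :
  measurable_fun (setT `*` I) f ->
  measurable_fun setT (fun y => \int[mu]_(x in I) f (y, x)).
Proof.
move=> mf; apply: (measurableT_comp (fine_measurable measurableT)).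
have mE : measurable_fun (setT `*` I) (EFin \o f) by exact/measurable_EFinP.
rewrite (_ : (fun y => _) = (fun y => (\int[mu]_(x in I) (EFin \o f)^\+ (y, x) -
    \int[mu]_(x in I) (EFin \o f)^\- (y, x))%E)).
  apply: emeasurable_funB; apply: measurable_ge0_section_integral => //.
  - exact: measurable_funepos.
  - exact: measurable_funeneg.
apply/funext => y; rewrite integralE; congr (_ - _)%E; apply: eq_integral => x _.
  by rewrite !funeposE.
by rewrite !funenegE.
Qed.

Lemma measurable_section (f : T * measurableTypeR R -> R) y :
  measurable_fun (setT `*` I) f -> measurable_fun I (fun x : R => f (y, x)).
Proof.
move=> mf; apply: (@measurable_comp _ _ _ _ _ _ (setT `*` I) f I (pair y)) => //.
  by move=> _ [x xI <-].
by apply: measurable_funTS; exact: measurable_pair1.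
Qed.

End parametrized_integrals.

Section clipping.
Context (R : realType).

(* Clipping does not increase the loss at parameters bounded by [B], and keeps it
   bounded at the others. *)
Definition clip (B x : R) : R := Num.max (- B) (Num.min B x).

Lemma clip_le (B x : R) : 0 <= B -> `|clip B x| <= B.
Proof.
move=> B0; rewrite ler_norml /clip le_max lexx/= ge_max ge_min lexx/= andbT.
by rewrite (le_trans _ B0)// oppr_le0.
Qed.

Lemma clip_sq (B x theta : R) : `|theta| <= B -> (clip B x - theta) ^+ 2 <= (x - theta) ^+ 2.
Proof.
rewrite ler_norml /clip => /andP[b1 b2]; rewrite maxEle minEle.
case: (leP B x) => h1; [case: (leP (- B) B)|case: (leP (- B) x)] => h2; nra.
Qed.

Lemma measurable_clip B : measurable_fun [set: R] (clip B).
Proof.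
by apply: measurable_maxr => //; apply: measurable_minr.
Qed.

End clipping.

(** * Drift and information of one coefficient *)

Section drift.
Context (R : realType).
Local Notation mu := (@lebesgue_measure R).

Definition prim (f : R -> R) (t : R) : R := \int[mu]_(x in `[0, t]) f x.

Lemma continuous_sq (f : R -> R) : continuous f -> continuous (fun x => f x ^+ 2).
Proof.
move=> cf; rewrite (_ : (fun x => _) = (fun x => f x * f x)).
  by move=> x; exact: continuousM (cf x) (cf x).
by apply/funext => x; rewrite expr2.
Qed.

Lemma prim_sub (f : R -> R) (p q : R) : continuous f -> 0 <= p -> p <= q ->
  prim f q - prim f p = \int[mu]_(x in `]p, q]) f x.
Proof.
move=> cf p0 pq; rewrite /prim (@Rintegral_itvB R f (BLeft 0) (BRight q) p)//.
exact: integrable_itv.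
Qed.

(** Cauchy-Schwarz on ]p, q], from the nonnegative integral of (f - c)^2 with c the mean of f. It
    provides the condition on the drift in [bayes_brownian]. *)
Lemma prim_sq_le (f : R -> R) (p q : R) : continuous f -> 0 <= p -> p < q ->
  (prim f q - prim f p) ^+ 2 <=
  (q - p) * (prim (fun x => f x ^+ 2) q - prim (fun x => f x ^+ 2) p).
Proof.
move=> cf p0 pq; have cf2 : continuous (fun x => f x ^+ 2).
  exact: continuous_sq.
rewrite !(prim_sub _ p0 (ltW pq))//; set D := `]p, q]%classic.
have iD (g : R -> R) : continuous g -> mu.-integrable D (EFin \o g).
  move=> cg; apply: (@integrableS _ _ _ mu `[p, q]) => //; last exact: integrable_itv.
    exact: measurable_itv.
  by rewrite /D; apply: subset_itvr; rewrite bnd_simp.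
have H (c : R) : 0 <= \int[mu]_(x in D) (f x ^+ 2) + (- (2 * c) * \int[mu]_(x in D) f x + c ^+
  2 * (q - p)).
  have -> : c ^+ 2 * (q - p) = \int[mu]_(x in D) (c ^+ 2).
    rewrite Rintegral_cst; last exact: measurable_itv.
    have muD : mu `]p, q] = (q - p)%:E by rewrite lebesgue_measure_itv/= lte_fin pq -EFinB.
    by congr (_ * _); apply/esym; exact: (congr1 fine muD).
  rewrite -RintegralZl; [|exact: measurable_itv|exact: iD].
  have c1 : continuous (fun x : R => - (2 * c) * f x) by move=> x; apply: cvgM; [exact:
    cvg_cst|exact: cf].
  have c2 : continuous (fun _ : R => c ^+ 2) by move=> x; exact: cst_continuous.
  rewrite -RintegralD; [|exact: measurable_itv|exact: iD|exact: iD].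
  rewrite -RintegralD; [|exact: measurable_itv|exact: iD|].
    apply: Rintegral_ge0 => x _.
    rewrite (_ : _ + _ = (f x - c) ^+ 2) ?sqr_ge0//; ring.
  by apply: iD => x; apply: cvgD; [exact: c1|exact: c2].
have d0 : 0 < q - p by rewrite subr_gt0.
set u := \int[mu]_(x in D) f x in H *; set v := \int[mu]_(x in D) _ in H *.
have := mulr_ge0 (ltW d0) (H (u / (q - p))).
have -> : (q - p) * (v + (- (2 * (u / (q - p))) * u + (u / (q - p)) ^+ 2 * (q - p))) =
  (q - p) * v - u ^+ 2 by field; rewrite gt_eqF.
by rewrite subr_ge0.
Qed.

(** Up to the factor 1/sigma, this is the information on one coefficient carried by the observation
    on [0, n]. *)
Lemma prim_tb_sq i n : prim (fun x => tb i x ^+ 2) n%:R = n%:R :> R.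
Proof.
have cf : continuous (fun x : R => tb i x ^+ 2).
  exact/continuous_sq/continuous_tb.
have P0 : prim (fun x => tb i x ^+ 2) 0 = 0 :> R.
  by rewrite /prim set_itv1 Rintegral_set1.
elim: n => // n IH; apply/eqP; rewrite -[n.+1%:R in X in _ == X]natr1 -subr_eq0 opprD addrA.
rewrite -{1}IH prim_sub//; last by rewrite ler_nat.
rewrite subr_eq0; apply/eqP.
have -> : \int[mu]_(x in `]n%:R, n.+1%:R]) (tb i x ^+ 2) = \int[mu]_(x in `]0, 1]) (tb i x ^+ 2).
  elim: n {IH} => [//|n IH].
  rewrite -[n.+2%:R]natr1 -[in `]n.+1%:R, _]]natr1 Rintegral_period// ?natr1// => x.
  by rewrite tb_periodic.
rewrite -prim_sub// P0 subr0; transitivity (ip (@tb R i) (tb i)).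
  by apply: eq_Rintegral => x _; rewrite expr2.
by rewrite ip_tb eqxx.
Qed.

End drift.

(** * Bayes risk against the minimax risk *)

Section lower_bound.
Context (R : realType).
Local Notation mu := (@lebesgue_measure R).
Local Notation I := (`[0%R, 1%R]%classic : set R).
Local Notation ts := (tsum (@tb R)).

Lemma observation_tsum theta N (w : cadlag_path R) t :
  observation (ts theta N) w t = \sum_(j < N) theta j * prim (@tb R j) t + w t.
Proof.
rewrite /observation; congr (_ + _).
elim: N => [|N IH].
  rewrite big_ord0 (_ : ts theta 0 = fun=> 0); last by apply/funext => x; rewrite /tsum big_ord0.
  by rewrite Rintegral_cst ?mul0r.
rewrite big_ord_recr/= -IH addrC /prim -RintegralZl//; last exact/integrable_itv/continuous_tb.
rewrite -RintegralD//.
- by apply: eq_Rintegral => x _; rewrite tsumS.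
- by apply: (@integrableZl _ _ _ mu `[0, t] _ (theta N) (fun x => (tb N x)%:E)) => //;
    exact/integrable_itv/continuous_tb.
- exact/integrable_itv/continuous_tsum.
Qed.

Lemma energy_ge1 k i : 1 <= energy R k i.
Proof.
rewrite /energy big_ord_recl/= muln0 expr0 lerDl.
by apply: sumr_ge0 => q _; rewrite exprn_even_ge0// oddM.
Qed.

Section estimator.
Variables (n : nat) (est : (R -> R) -> R -> R).
Hypothesis est_meas : estimator n est.

Definition coef (B : R) i (y : R -> R) : R := clip B (ip (est y) (tb i)).

Lemma measurable_coef B i : measurable_fun setT (fun y : observed R n => coef B i y).
Proof.
apply: (measurableT_comp (measurable_clip B)).
apply: (measurable_section_integral (f := fun p : observed R n * measurableTypeR R =>
  est p.1 p.2 * tb i p.2)).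
apply: measurable_funM; first exact: est_meas.
apply: measurable_funTS; apply: (measurableT_comp _ measurable_snd).
exact: continuous_measurable_fun (@continuous_tb R i).
Qed.

(** Bessel's inequality passes from the functional loss to the coefficients. Clipping at sqrt r does
    not increase the loss, because energies are at least 1 and so |theta_i| <= sqrt r. *)
Lemma coef_sq_le k (r : R) (theta : nat -> R) L (y : R -> R) :
  \sum_(i < L.*2.+1) energy R k i * theta i ^+ 2 <= r ->
  ((\sum_(i < L.*2.+1) (coef (Num.sqrt r) i y - theta i) ^+ 2)%:E <=
   sqnorm (fun x => est y x - ts theta L.*2.+1 x)%R)%E.
Proof.
move=> Hr; set N := L.*2.+1 in Hr *.
(* The estimate is an arbitrary measurable function; it is square integrable once the loss is
   finite. *)
have [->|] := eqVneq (sqnorm (fun x => est y x - ts theta N x)) +oo%E; first exact: leey.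
rewrite -ltey => fin.
have qt : sqint (ts theta N) by apply: sqint_tsum; exact: sqint_tb.
have me : measurable_fun I (est y).
  exact: (measurable_section (f := fun p : observed R n * measurableTypeR R => est p.1 p.2) y
    est_meas).
have qd : sqint (fun x => est y x - ts theta N x).
  by split => //; apply: measurable_funB => //; case: qt.
have qe : sqint (est y) by apply: sqint_ext (sqint_lin 1 qd qt) => x _; ring.
apply: le_trans (sqnorm_tsum_sub_ge (@sqint_tb R) (@ip_tb R) theta N qe).
rewrite lee_fin; apply: ler_sum => i _; rewrite -[leRHS]sqrrN opprB.
apply: clip_sq; rewrite -sqrtr_sqr ler_wsqrtr//; apply: le_trans Hr.
rewrite (bigD1 i)//= (@le_trans _ _ (energy R k i * theta i ^+ 2))//.
  by rewrite ler_peMl ?sqr_ge0// energy_ge1.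
rewrite lerDl sumr_ge0// => j _; rewrite mulr_ge0 ?sqr_ge0//.
exact: le_trans ler01 (energy_ge1 _ _).
Qed.

Lemma measurable_observation d (T : measurableType d) (g : T -> seqR R) (z : T -> skorohod R) N :
  measurable_fun setT g -> measurable_fun setT z ->
  measurable_fun setT (fun p => observation (ts (g p) N) (z p) : observed R n).
Proof.
move=> mg mz; apply: measurable_to_paths => t /=; rewrite in_itv/= => /andP[t0 _].
rewrite (_ : (fun w => _) = fun p =>
  \sum_(j < N) (g p : nat -> R) j * prim (@tb R j) t + Defs.coord t (z p)); last first.
  by apply/funext => p; rewrite observation_tsum.
apply: measurable_funD; last exact: (measurableT_comp (measurable_coord t0) mz).
apply: measurable_sum => j; apply: measurable_funM => //.
exact: (measurableT_comp (@measurable_coord_seqR R j) mg).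
Qed.

Definition loss B N i (p : seqR R * skorohod R) : R :=
  (coef B i (observation (ts p.1 N) p.2) - p.1 i) ^+ 2.

Lemma measurable_loss B N i : measurable_fun setT (loss B N i).
Proof.
apply: measurable_funX; apply: measurable_funB.
  exact: (measurableT_comp (measurable_coef B i) (measurable_observation N measurable_fst
    measurable_snd)).
exact: (measurableT_comp (@measurable_coord_seqR R i) measurable_fst).
Qed.

(** With the other coefficients fixed, their drift [h] is known and the observed path is [h] plus
    sqrt sigma times W + u Psi. Composing with [sh] yields a statistic of the latter, to which
    [bayes_brownian] applies with information n / sigma. *)
Lemma bayes_coordinate (Q : probability (skorohod R) R) (sigma B s v : R) N i (x : seqR R) :
  (i < N)%N -> brownian_noise sigma Q -> 0 < sigma -> 0 < B -> 0 < s -> 0 < v ->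
  v^-1 = s ^- 2 + n%:R / sigma ->
  (v%:E <= \int[normal_prob 0 s]_u \int[Q]_w (loss B N i (upd i (u, x), w))%:E)%E.
Proof.
move=> iN [W hW WE] s0 B0 ss v0 vE.
pose sg := Num.sqrt sigma; have sg0 : 0 < sg by rewrite sqrtr_gt0.
pose h t := \sum_(j < N | j != Ordinal iN) x j * prim (@tb R j) t.
pose sh (z : paths `[0%R, n%:R]) : observed R n := fun t => h t + sg * z t.
have msh : measurable_fun setT sh.
  apply: measurable_to_paths => t tn; apply: measurable_funD => //.
  by apply: measurable_funM => //; exact: measurable_coord_paths.
pose Psi t := prim (@tb R i) t / sg.
pose E t := prim (fun z => @tb R i z ^+ 2) t / sigma.
have prim0 f : prim f 0 = 0 :> R by rewrite /prim set_itv1 Rintegral_set1.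
have Psi0 : Psi 0 = 0 by rewrite /Psi prim0 mul0r.
have PsiE p q : 0 <= p -> p < q -> q <= n%:R -> (Psi q - Psi p) ^+ 2 <= (q - p) * (E q - E p).
  move=> p0 pq _; rewrite /Psi /E -!mulrBl exprMn exprVn sqr_sqrtr ?(ltW s0)//.
  by rewrite mulrA ler_pM2r ?invr_gt0// prim_sq_le//; exact: continuous_tb.
have vE' : v^-1 = s ^- 2 + (E n%:R - E 0) by rewrite vE /E prim_tb_sq prim0 mul0r subr0.
have mT : measurable_fun setT (fun z => coef B i (sh z)).
  exact: (measurableT_comp (measurable_coef B i) msh).
have TB z : `|coef B i (sh z)| <= B by apply: clip_le; exact: ltW.
apply: le_trans (bayes_brownian hW (ler0n _ n) Psi0 PsiE B0 mT TB ss v0 vE') _.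
rewrite le_eqVlt; apply/orP; left; apply/eqP; apply: eq_integral => u _.
apply: eq_integral => w _; rewrite /loss/= /upd/= eqxx; congr ((_ - _) ^+ 2)%:E.
apply: (measurable_paths_local (measurable_coef B i)) => t /=; rewrite in_itv/= => /andP[t0 _].
rewrite observation_tsum (bigD1 (Ordinal iN))//= eqxx /sh /Psi.
have -> : w t = sg * W t w by rewrite -WE.
have -> : \sum_(j < N | j != Ordinal iN) (if val j == i then u else x j) * prim (tb j) t = h t.
  by apply: eq_bigr => j ji; rewrite -(inj_eq val_inj)/= in ji; rewrite (negbTE ji).
by field; rewrite gt_eqF.
Qed.

End estimator.

(** A Chernoff bound weighted by A: write A = r + (A - r) and bound both parts by means of 1 + t (A
    - r) <= exp (t (A - r)). *)
Lemma tail_le (t r A : R) : 0 < t -> 0 < r -> r < A -> A <= (r + t^-1) * (expR (- (t * r)) *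
  expR (t * A)).
Proof.
move=> t0 r0 rA; rewrite -expRD; have := expR_ge1Dx (- (t * r) + t * A).
set e := expR _; have -> : - (t * r) + t * A = t * (A - r) by ring.
move=> He; have u0 : 0 < A - r by rewrite subr_gt0.
have e1 : 1 <= e by rewrite (le_trans _ He)// lerDl mulr_ge0// ltW.
have : t^-1 * (1 + t * (A - r)) <= t^-1 * e by rewrite ler_pM2l ?invr_gt0.
rewrite mulrDr mulr1 mulrA mulVf ?gt_eqF// mul1r.
have : r <= r * e by rewrite ler_peMr// ltW.
have : 0 < t^-1 by rewrite invr_gt0.
lra.
Qed.

(* The last term pays for the prior N(0, s_i^2) charging parameters outside the
   ball; [t] is the parameter of the Chernoff bound. *)
Lemma minimax_lower k (r : R) n L (sigma t : R) (s : nat -> R) (Qs : set (probability (skorohod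
  R) R)) Q :
  (0 < n)%N -> 0 < r -> 0 < sigma -> Qs Q -> brownian_noise sigma Q -> 0 < t ->
  (forall i, (i < L.*2.+1)%N -> 0 < s i /\ 2 * t * (energy R k i * s i ^+ 2) < 1) ->
  ((\sum_(i < L.*2.+1) (s i ^+ 2 * (sigma / n%:R)) / (s i ^+ 2 + sigma / n%:R))%:E <=
   minimax_risk k r n Qs +
   ((2 * (L.*2.+1)%:R + 2) * (r + t^-1) * expR (- (t * r)) *
    \prod_(i < L.*2.+1) (Num.sqrt (1 - 2 * t * (energy R k i * s i ^+ 2)))^-1)%:E)%E.
Proof.
move=> n0 r0 sig0 QsQ hQ t0 Hs; set N := L.*2.+1 in Hs *.
rewrite -leeBlDr//; apply: le_ereal_inf_tmp => _ [est est_meas <-].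
rewrite leeBlDr//; set rho := ereal_sup _.
have rho_ge S : function_class k r S -> (\int[Q]_w sqnorm (fun x => est (observation S w) x - S
  x)%R <= rho)%E.
  move=> SW; apply: (@le_trans _ _ (robust_risk Qs est S)).
    by apply: ereal_sup_ubound; exists Q.
  by apply: ereal_sup_ubound; exists S.
pose A (theta : nat -> R) := \sum_(i < N) energy R k i * theta i ^+ 2.
pose B := Num.sqrt r; have B0 : 0 < B by rewrite sqrtr_gt0.
have mobs theta : measurable_fun setT (fun w : skorohod R => observation (ts theta N) w :
  observed R n).
  exact: (@measurable_observation n _ _ (fun _ => theta : seqR R) id).
pose F i (theta : seqR R) : \bar R := (\int[Q]_w (loss est B N i (theta, w))%:E)%E.
have mF i : measurable_fun setT (F i).
  apply: (@measurable_fun_fubini_tonelli_F _ _ _ _ R Q (fun p => (loss est B N i p)%:E)).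
    by apply/measurable_EFinP; exact: (measurable_loss est_meas B N i).
  by move=> p; rewrite lee_fin sqr_ge0.
have F0 i theta : (0 <= F i theta)%E by apply: integral_ge0 => w _; rewrite lee_fin sqr_ge0.
have ml i theta : measurable_fun setT (fun w => (loss est B N i (theta, w))%:E).
  apply/measurable_EFinP; apply: (measurableT_comp (measurable_loss est_meas B N i)).
  exact: measurable_pair1.
have ms theta : measurable_fun setT (fun y : observed R n => sqnorm (fun x => est y x - ts
  theta N x)).
  apply: (@measurable_ge0_section_integral R _ (observed R n) (fun p =>
    ((est p.1 p.2 - ts theta N p.2) ^+ 2)%:E)).
    apply/measurable_EFinP/measurable_funX; apply: measurable_funB; first exact: est_meas.
    apply: measurable_funTS; apply: (measurableT_comp _ measurable_snd).
    exact: continuous_measurable_fun (@continuous_tsum R _ _).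
  by move=> p; rewrite lee_fin sqr_ge0.
have Fclass theta : A theta <= r -> (\sum_(i < N) F i theta <= rho)%E.
  move=> Ar; apply: le_trans (rho_ge _ (tsum_function_class Ar)).
  rewrite -ge0_integral_sum//; last by move=> i w _; rewrite lee_fin sqr_ge0.
  apply: ge0_le_integral => //.
  - by move=> w _; apply: sume_ge0 => i _; rewrite lee_fin sqr_ge0.
  - by apply: emeasurable_sum => i _; exact: ml.
  - exact: (measurableT_comp (ms theta) (mobs theta)).
  - by move=> w _; rewrite sumEFin; exact: (coef_sq_le est_meas (observation (ts theta N) w) Ar).
have rho0 : (0 <= rho)%E.
  apply: le_trans (Fclass (fun=> 0) _); first exact: sume_ge0.
  by rewrite /A big1 ?ltW// => i _; rewrite expr0n mulr0.
(* For any parameter, clipping bounds each loss by 2 (r + theta_i^2), and since energies are at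
   least 1 the theta_i^2 sum to at most [A theta]. *)
have Foff theta : (\sum_(i < N) F i theta <= (2 * (N%:R * r + A theta))%:E)%E.
  apply: (@le_trans _ _ (\sum_(i < N) (2 * (r + theta i ^+ 2))%:E)%E).
    apply: lee_sum => i _; rewrite -(@integral_prob_cst _ _ _ Q (2 * (r + theta i ^+ 2))%:E).
    apply: ge0_le_integral => //; first by move=> w _; rewrite lee_fin sqr_ge0.
    move=> w _; rewrite lee_fin /loss/=.
    have := clip_le (ip (est (observation (ts theta N) w)) (tb i)) (ltW B0).
    rewrite -/(coef est B i _) => cB.
    have c2 : coef est B i (observation (ts theta N) w) ^+ 2 <= r.
      rewrite -[leRHS](sqr_sqrtr (ltW r0)) -real_normK ?num_real//.
      by rewrite lerXn2r// nnegrE// ltW.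
    by move: c2; set c := coef _ _ _ _ => c2; have := sqr_ge0 (c + theta i); nra.
  rewrite sumEFin lee_fin -mulr_sumr ler_wpM2l// big_split/= sumr_const card_ord mulr_natl lerD2l.
  by apply: ler_sum => i _; rewrite ler_peMl ?sqr_ge0// energy_ge1.
(* When A > r the bound 2 (N r + A) is at most (2N + 2) A, to which [tail_le] applies. *)
pose C := (2 * N%:R + 2) * (r + t^-1) * expR (- (t * r)).
have C0 : 0 <= C by rewrite !mulr_ge0 ?expR_ge0// addr_ge0// ?mulr_ge0// ?invr_ge0// ltW.
have Fall theta : (\sum_(i < N) F i theta <= rho + C%:E * (expR (\sum_(i < N) (t * energy R k
  i) * theta i ^+ 2))%:E)%E.
  have -> : \sum_(i < N) (t * energy R k i) * theta i ^+ 2 = t * A theta.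
    by rewrite mulr_sumr; apply: eq_bigr => i _; rewrite mulrA.
  have [Ar|rA] := leP (A theta) r.
    by rewrite (le_trans (Fclass _ Ar))// leeDl// -EFinM lee_fin mulr_ge0// expR_ge0.
  rewrite (le_trans (Foff theta))// -[leLHS]add0e leeD// -EFinM lee_fin /C.
  have := tail_le t0 r0 rA; set e1 := expR _; set e2 := expR _ => H.
  apply: (@le_trans _ _ ((2 * N%:R + 2) * A theta)).
    by have := ler_wpM2l (ler0n R N) (ltW rA); lra.
  by rewrite -!mulrA ler_wpM2l// addr_ge0// mulr_ge0.
have [->|] := eqVneq rho +oo%E; first by rewrite addye// leey.
move=> rhoy.
have Ebayes : ((\sum_(i < N) s i ^+ 2 * (sigma / n%:R) / (s i ^+ 2 + sigma / n%:R))%:E <=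
    \int[gauss_seq s N]_theta \sum_(i < N) F i theta)%E.
  rewrite ge0_integral_sum// -sumEFin; apply: lee_sum => i _.
  have [si0 _] := Hs i (ltn_ord i).
  have tau0 : 0 < sigma / n%:R by rewrite divr_gt0// ltr0n.
  have s20 : 0 < s i ^+ 2 by rewrite exprn_gt0.
  apply: (@integral_gauss_seq_ge _ s N i) => // x.
  apply: (@bayes_coordinate n est est_meas Q sigma B (s i) _ N i x (ltn_ord i) hQ sig0 B0 si0).
    by apply: divr_gt0; [exact: mulr_gt0|exact: addr_gt0].
  have nn : n%:R != 0 :> R by rewrite pnatr_eq0 -lt0n.
  have ne : [&& sigma != 0, s i ^+ 2 != 0 & s i ^+ 2 + sigma / n%:R != 0].
    by rewrite !gt_eqF// addr_gt0.
  case/and3P: ne => sne s2ne dne; move: tau0 s2ne dne; set z := s i ^+ 2.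
  have -> : n%:R / sigma = (sigma / n%:R)^-1 by rewrite invf_div.
  by set tau := sigma / n%:R => tau0 zne dne; field; rewrite zne dne gt_eqF.
apply: (le_trans Ebayes).
have mE : measurable_fun setT (fun x : seqR R =>
    (expR (\sum_(i < N) (t * energy R k i) * (x i) ^+ 2))%:E).
  apply/measurable_EFinP/measurableT_comp => //; apply: measurable_sum => i.
  apply: measurable_funM => //; apply: measurable_funX; exact: measurable_coord_seqR.
apply: (@le_trans _ _ (\int[gauss_seq s N]_theta
    (rho + C%:E * (expR (\sum_(i < N) (t * energy R k i) * theta i ^+ 2))%:E))%E).
  apply: ge0_le_integral => //.
  - by move=> theta _; apply: sume_ge0.
  - by apply: emeasurable_sum.
  - apply: emeasurable_funD => //; apply: emeasurable_funM => //.
rewrite ge0_integralD//; last 2 first.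
- by move=> theta _; rewrite mule_ge0// lee_fin expR_ge0.
- by apply: emeasurable_funM.
rewrite (@ge0_integralZl_EFin _ _ _ (gauss_seq s N) setT) //.
have rhoE : rho = (fine rho)%:E.
  by rewrite fineK// fin_numE rhoy andbT gt_eqF// (lt_le_trans _ rho0).
rewrite [X in (X + _)%E](_ : _ = rho); last first.
  by rewrite rhoE; exact: (@integral_prob_cst _ _ _ (gauss_seq s N)).
rewrite leeD2l// (@integral_gauss_exp_sq R s (fun i => t * energy R k i)
  (fun i => (s i ^- 2 - (t * energy R k i) *+ 2)^-1) N).
  rewrite -EFinM lee_fin -/C ler_wpM2l//; apply: ler_prod => i _.
  have [si0 si1] := Hs i (ltn_ord i).
  rewrite divr_ge0 ?sqrtr_ge0 ?(ltW si0)//=.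
  have -> : (s i ^- 2 - (t * energy R k i) *+ 2)^-1 =
      s i ^+ 2 * (1 - 2 * t * (energy R k i * s i ^+ 2))^-1.
    rewrite -[s i ^+ 2 in RHS]invrK -invfM; congr (_^-1).
    by rewrite -mulr_natl; field; rewrite gt_eqF.
  rewrite sqrtrM ?sqr_ge0// sqrtr_sqr gtr0_norm// mulrAC divff ?gt_eqF// mul1r.
  by rewrite sqrtrV// subr_ge0 ltW.
move=> i iN; have [si0 si1] := Hs i iN.
rewrite si0 invrK; split => //; rewrite invr_gt0.
rewrite subr_gt0 -mulr_natl -(ltr_pM2r (exprn_gt0 2 si0)) mulVf; first by lra.
by rewrite expf_neq0// gt_eqF.
Qed.

End lower_bound.

(** * Asymptotics of the two bounds *)

Section power_sums.
Context (R : realType).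

Lemma pow_diff_ge (a : R) p : 0 <= a -> p.+1%:R * a ^+ p <= (a + 1) ^+ p.+1 - a ^+ p.+1.
Proof.
move=> a0; elim: p => [|p IH]; first by rewrite !expr1 expr0 mulr1 addrAC subrr add0r.
rewrite [leRHS](_ : _ = (a + 1) ^+ p.+1 + a * ((a + 1) ^+ p.+1 - a ^+ p.+1)).
  rewrite -[p.+2%:R]natr1 mulrDl mul1r addrC lerD//.
    by rewrite lerXn2r ?nnegrE ?addr_ge0// lerDl.
  by apply: (le_trans _ (ler_wpM2l a0 IH)); rewrite exprS mulrCA.
by rewrite !(exprS _ p.+1); ring.
Qed.

Lemma pow_diff_le (a : R) p : 0 <= a -> (a + 1) ^+ p.+1 - a ^+ p.+1 <= p.+1%:R * (a + 1) ^+ p.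
Proof.
move=> a0; elim: p => [|p IH]; first by rewrite !expr1 expr0 mulr1 addrAC subrr add0r.
rewrite [leLHS](_ : _ = (a + 1) ^+ p.+1 + a * ((a + 1) ^+ p.+1 - a ^+ p.+1)).
  rewrite -[p.+2%:R]natr1 [leRHS]mulrDl mul1r [leRHS]addrC lerD2l.
  apply: (le_trans (ler_wpM2l a0 IH)); rewrite mulrCA [(a + 1) ^+ p.+1]exprS ler_wpM2l//.
  by rewrite ler_wpM2r ?lerDl// exprn_ge0// addr_ge0.
by rewrite !(exprS _ p.+1); ring.
Qed.

Lemma sum_pow_le p m : \sum_(j < m) j%:R ^+ p <= m%:R ^+ p.+1 / p.+1%:R :> R.
Proof.
elim: m => [|m IH]; first by rewrite big_ord0 expr0n mul0r.
rewrite big_ord_recr/= -[m.+1%:R]natr1.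
have G (q S x y z : R) : 0 < q -> S <= x / q -> q * z <= y - x -> S + z <= y / q.
  by move=> q0; rewrite !ler_pdivlMr// mulrDl; lra.
exact: G (ltr0Sn R p) IH (pow_diff_ge p (ler0n R m)).
Qed.

Lemma sum_pow_ge p m : m%:R ^+ p.+1 / p.+1%:R - m%:R ^+ p <= \sum_(j < m) j%:R ^+ p :> R.
Proof.
elim: m => [|m IH]; first by rewrite big_ord0 expr0n mul0r sub0r oppr_le0 exprn_ge0.
rewrite big_ord_recr/= -[m.+1%:R]natr1.
have G (q S x y z z' : R) : 0 < q -> x / q - z' <= S -> y - x <= q * z -> y / q - z <= S + z'.
  by move=> q0; rewrite !lerBlDr !ler_pdivrMr// !mulrDl; lra.
exact: G (ltr0Sn R p) IH (pow_diff_le p (ler0n R m)).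
Qed.

(** The main term is m times the integral of (1 - x^k)^2 over [0, 1]. After expansion of the square
    only the cross term costs something, namely the 2, through [sum_pow_ge]. *)
Lemma sum_weights_le k m : (0 < m)%N ->
  \sum_(j < m) (1 - (j%:R / m%:R) ^+ k) ^+ 2 <=
  m%:R * (1 - 2 / k.+1%:R + (2 * k).+1%:R^-1) + 2 :> R.
Proof.
move=> m0; have M0 : 0 < m%:R :> R by rewrite ltr0n.
set M : R := m%:R in M0 *.
have Mk p : M ^+ p != 0 by rewrite expf_neq0// gt_eqF.
have -> : \sum_(j < m) (1 - (j%:R / M) ^+ k) ^+ 2 =
    M - 2 * (M ^+ k)^-1 * (\sum_(j < m) j%:R ^+ k) +
    (M ^+ (2 * k))^-1 * \sum_(j < m) j%:R ^+ (2 * k).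
  rewrite !mulr_sumr -[M in LHS]/(m%:R) -[X in X - _](_ : \sum_(j < m) 1 = M); last first.
    by rewrite sumr_const card_ord.
  rewrite -sumrB -big_split/=; apply: eq_bigr => j _.
  by rewrite -/M expr_div_n [(2 * k)%N]mulnC !exprM; field; rewrite Mk.
have h1 : (M ^+ k)^-1 * (M ^+ k.+1 / k.+1%:R - M ^+ k) <= (M ^+ k)^-1 * \sum_(j < m) j%:R ^+ k.
  by apply: ler_wpM2l; [rewrite invr_ge0 exprn_ge0// ltW|exact: sum_pow_ge].
have h2 : (M ^+ (2 * k))^-1 * (\sum_(j < m) j%:R ^+ (2 * k)) <=
    (M ^+ (2 * k))^-1 * (M ^+ (2 * k).+1 / (2 * k).+1%:R).
  by apply: ler_wpM2l; [rewrite invr_ge0 exprn_ge0// ltW|exact: sum_pow_le].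
have e1 : (M ^+ k)^-1 * (M ^+ k.+1 / k.+1%:R - M ^+ k) = M / k.+1%:R - 1.
  have : k.+1%:R != 0 :> R by rewrite pnatr_eq0.
  by move: (k.+1%:R : R) => q q0; rewrite exprSr; field; rewrite Mk q0.
have e2 : (M ^+ (2 * k))^-1 * (M ^+ (2 * k).+1 / (2 * k).+1%:R) = M / (2 * k).+1%:R.
  have : (2 * k).+1%:R != 0 :> R by rewrite pnatr_eq0.
  by move: ((2 * k).+1%:R : R) => q q0; rewrite exprSr; field; rewrite Mk q0.
rewrite e1 in h1; rewrite e2 in h2; rewrite -mulrA mulrDr mulrBr mulr1 [M * (2 / _)]mulrCA.
move: h1 h2; set A := M ^- k * _; set B := M ^- (2 * k) * _.
by move: (M / k.+1%:R) (M / (2 * k).+1%:R) => c1 c2; lra.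
Qed.

(** From exp z >= z at z = c x / (p+1), raised to the power p + 1: one power more than x^p, which
    leaves the decay 1/x. *)
Lemma expR_pow_le (c x : R) p : 0 < c -> 0 < x ->
  expR (- (c * x)) * x ^+ p <= (p.+1%:R / c) ^+ p.+1 / x.
Proof.
move=> c0 x0; have p0 : 0 < p.+1%:R :> R by rewrite ltr0n.
have y0 : 0 < c * x / p.+1%:R by rewrite divr_gt0// mulr_gt0.
have H : (c * x / p.+1%:R) ^+ p.+1 <= expR (c * x).
  have -> : expR (c * x) = expR (c * x / p.+1%:R) ^+ p.+1.
    by rewrite -expRM_natl; congr expR; rewrite [RHS]mulrC divfK ?gt_eqF.
  rewrite lerXn2r ?nnegrE ?expR_ge0 ?(ltW y0)//.
  by rewrite (le_trans _ (expR_ge1Dx _))// lerDr.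
rewrite ler_pdivlMr// -mulrA -exprSr expRN mulrC ler_pdivrMr ?expR_gt0//.
apply: (le_trans _ (ler_wpM2l _ H)); last by rewrite exprn_ge0// divr_ge0 ?ltW.
rewrite -exprMn (_ : _ / c * _ = x)//; field; by rewrite !gt_eqF.
Qed.

(** The powers x^q, q <= k, sum to at most (1 + x)^k with x = freq^2, and freq + 1 <= pi (j + 1) + 1
    <= pi (j + 2); hence the shift by 2. *)
Lemma energy_le k j : energy R k j <= pi ^+ (2 * k) * j.+2%:R ^+ (2 * k).
Proof.
rewrite -exprMn.
have f0 : 0 <= freq R j by rewrite /freq !mulr_ge0// pi_ge0.
have f1 : freq R j + 1 <= pi * j.+2%:R.
  have h : freq R j <= pi * j.+1%:R.
    rewrite /freq [2 * _]mulrC -mulrA ler_wpM2l ?pi_ge0// -natrM ler_nat; lia.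
  rewrite -[j.+2%:R]natr1 mulrDr mulr1 lerD// (le_trans _ (@pi_ge2 R))//; lra.
apply: (@le_trans _ _ ((freq R j ^+ 2 + 1) ^+ k)).
  rewrite /energy; under eq_bigr do rewrite exprM; set x := _ ^+ 2.
  have x0 : 0 <= x by exact: sqr_ge0.
  elim: k => [|p IH]; first by rewrite big_ord_recl big_ord0 addr0.
  rewrite big_ord_recr/= [leRHS]exprSr mulrDr mulr1 addrC lerD// exprSr.
  by rewrite ler_wpM2r// lerXn2r ?nnegrE ?addr_ge0// lerDl.
rewrite exprM; apply: lerXn2r; rewrite ?nnegrE ?addr_ge0 ?sqr_ge0//.
apply: (@le_trans _ _ ((freq R j + 1) ^+ 2)); first by nra.
by rewrite lerXn2r ?nnegrE ?addr_ge0// mulr_ge0// pi_ge0.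
Qed.

(** Squared, this is 1 / (1 - x) <= 1 + x / (1 - d) <= exp (x / (1 - d)). *)
Lemma inv_sqrt_le (x d : R) : 0 <= x -> x <= d -> d < 1 ->
  (Num.sqrt (1 - x))^-1 <= expR (x / (2 * (1 - d))).
Proof.
move=> x0 xd d1; have x1 : 0 < 1 - x by lra.
have d10 : 0 < 1 - d by lra.
have e : x / (2 * (1 - d)) = x / (1 - d) / 2 by field; rewrite gt_eqF.
have s0 : 0 < Num.sqrt (1 - x) by rewrite sqrtr_gt0.
rewrite -(@ler_pXn2r _ 2)// ?nnegrE ?invr_ge0 ?sqrtr_ge0 ?expR_ge0//.
rewrite exprVn sqr_sqrtr ?(ltW x1)//.
rewrite -expRM_natl e (_ : _ * _ = x / (1 - d)); last by field; rewrite gt_eqF.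
apply: (le_trans _ (expR_ge1Dx _)); rewrite -(ler_pM2r x1) mulVf ?gt_eqF//.
have : x <= x / (1 - d) * (1 - x).
  by rewrite mulrAC ler_pdivlMr// ler_wpM2l//; lra.
lra.
Qed.

End power_sums.

(** * The upper bound against the sharp rate *)

Section ratios.
Context (R : realType) (k : nat) (r : R).
Hypotheses (k0 : (0 < k)%N) (r0 : 0 < r).
Local Notation K := (2 * k).+1.

Let kR0 : 0 < k%:R :> R. Proof. by rewrite ltr0n. Qed.
Let k10 : 0 < k.+1%:R :> R. Proof. by rewrite ltr0n. Qed.
Let KR0 : 0 < K%:R :> R. Proof. by rewrite ltr0n. Qed.
Let a := (pi : R) ^+ (2 * k).
Let a0 : 0 < a. Proof. by rewrite exprn_gt0// pi_gt0. Qed.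

(** At m = w the squared bias and the main term of the variance are the fractions 1/(2k+1) and
    2k/(2k+1) of tau w k / (k+1). The quotient w/m is the price of an integer bandwidth, the last
    term that of the 2 in [sum_weights_le]. *)
Lemma upper_ratio (tau w : R) m : 0 < tau -> 0 < w -> (0 < m)%N -> m%:R <= w ->
  w ^+ K * (k%:R * a * tau) = r * k.+1%:R * K%:R ->
  r / (pi * m%:R) ^+ (2 * k) + tau * \sum_(j < m) (1 - (j%:R / m%:R) ^+ k) ^+ 2 <=
  tau * w * k%:R / k.+1%:R *
  ((w / m%:R) ^+ (2 * k) / K%:R + (2 * k)%:R / K%:R + 2 * k.+1%:R / (k%:R * w)).
Proof.
move=> tau0 w0 m0 mw wE.
have M0 : 0 < m%:R :> R by rewrite ltr0n.
have rE : r = w ^+ K * (k%:R * a * tau) / (k.+1%:R * K%:R).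
  by rewrite wE; field; rewrite !gt_eqF.
have -> : r / (pi * m%:R) ^+ (2 * k) =
    tau * w * k%:R / k.+1%:R * ((w / m%:R) ^+ (2 * k) / K%:R).
  rewrite rE exprMn -/a expr_div_n exprSr; set M := m%:R ^+ _; set v := w ^+ _.
  by field; rewrite /M expf_neq0 ?gt_eqF.
rewrite -addrA mulrDr lerD2l.
have := ler_wpM2l (ltW tau0) (sum_weights_le R k m0) => /le_trans; apply.
have KE : K%:R = 2 * k%:R + 1 :> R by rewrite -natr1 natrM.
have k1E : k.+1%:R = k%:R + 1 :> R by rewrite -natr1.
have -> : tau * w * k%:R / k.+1%:R * ((2 * k)%:R / K%:R + 2 * k.+1%:R / (k%:R * w)) =
    tau * (w * (1 - 2 / k.+1%:R + K%:R^-1) + 2).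
  rewrite natrM KE k1E; field.
  by rewrite -natrM natr1 natr1 !gt_eqF// -natr1 natrM; move: kR0; rewrite pmulrn; lra.
rewrite ler_wpM2l ?(ltW tau0)// lerD2r ler_wpM2r// k1E KE.
have -> : 1 - 2 / (k%:R + 1) + (2 * k%:R + 1)^-1 = 2 * k%:R ^+ 2 / ((k%:R + 1) * (2 * k%:R +
  1)) :> R.
  by field; rewrite -k1E -KE !gt_eqF.
by rewrite divr_ge0// ?mulr_ge0 ?sqr_ge0// -?k1E -?KE// ltW.
Qed.

End ratios.

(** * The lower bound against the sharp rate *)

Section lower_ratio.
Context (R : realType) (k : nat) (r delta : R).
Hypotheses (k0 : (0 < k)%N) (r0 : 0 < r) (d0 : 0 < delta) (d1 : delta <= 2^-1).
Local Notation K := (2 * k).+1.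

Let kR0 : 0 < k%:R :> R. Proof. by rewrite ltr0n. Qed.
Let k10 : 0 < k.+1%:R :> R. Proof. by rewrite ltr0n. Qed.
Let KR0 : 0 < K%:R :> R. Proof. by rewrite ltr0n. Qed.

Section fixed.
(** [M] is the integer bandwidth, [U] the target rate, and the Chernoff parameter [t] is chosen so
    that 2 t r C2 / M = delta. Constants are variables with equations so as to stay opaque in the
    algebra. *)
Variables (a C2 q w tau M U t c : R) (L : nat).
Let N := L.*2.+1.
Hypotheses (aE : a = pi ^+ (2 * k)) (a0 : 0 < a).
Hypotheses (C2E : C2 = k.+1%:R * K%:R / k%:R) (C20 : 0 < C2).
Hypotheses (qE : q = (1 - delta) ^+ 2) (q0 : 0 < q) (q1 : q <= 1).
Hypotheses (ME : M = N.+2%:R) (UE : U = tau * w * k%:R / k.+1%:R).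
Hypotheses (tE : t = delta * M / (2 * C2 * r)) (cE : c = delta ^+ 2 / (4 * C2)).
Hypotheses (tau0 : 0 < tau) (wE : w ^+ K * (k%:R * a * tau) = r * k.+1%:R * K%:R).
Hypotheses (Mw : M <= w) (wM : w <= M + 2) (CM : 2 * C2 <= delta * M).

Let M0 : 0 < M. Proof. by rewrite ME ltr0n. Qed.
Let w0 : 0 < w. Proof. exact: lt_le_trans M0 Mw. Qed.
Let U0 : 0 < U. Proof. by rewrite UE divr_gt0// !mulr_gt0. Qed.

Let y (i : nat) : R := (i%:R / M) ^+ k.

Let y_itv i : (0 < i)%N -> (i < N.+2)%N -> 0 < y i /\ y i < 1.
Proof.
move=> i0 iN; have h0 : 0 < i%:R / M by rewrite divr_gt0// ltr0n.
split; first exact: exprn_gt0.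
by rewrite exprn_ilt1 ?(ltW h0)// -?lt0n// ltr_pdivrMr// mul1r ME ltr_nat.
Qed.

(* Pinsker's least favourable variances, shrunk by [q] to give the prior an energy
   below [r] by a fixed factor; the index is shifted by 2 so that
   [energy k j <= (pi (j + 2))^(2k)]. *)
Definition prior_sd (j : nat) : R := Num.sqrt (q * tau * ((y j.+2)^-1 - 1)).

Let sd_arg j : (j < N)%N -> 0 < q * tau * ((y j.+2)^-1 - 1).
Proof.
move=> jN; have [y0 y1] := @y_itv j.+2 isT jN.
by apply: mulr_gt0; [exact: mulr_gt0|rewrite subr_gt0 invf_gt1].
Qed.

Let sd_sq j : (j < N)%N -> prior_sd j ^+ 2 = q * tau * ((y j.+2)^-1 - 1).
Proof. by move=> /sd_arg /ltW h; rewrite sqr_sqrtr. Qed.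

(** The equation for [w] and M <= w bound tau a M^(2k+1) by r C2. Every coordinate of the prior thus
    has energy of order 1/M only. *)
Let aM : tau * a * M ^+ (2 * k) <= r * C2 / M.
Proof.
rewrite ler_pdivlMr// -[_ * M]mulrA -exprSr.
have -> : r * C2 = tau * a * w ^+ K.
  by rewrite C2E mulrA mulrA -wE; field; rewrite gt_eqF.
have ta0 : 0 <= tau * a by rewrite mulr_ge0// ltW.
by rewrite ler_wpM2l// lerXn2r// nnegrE ltW.
Qed.

Let energy_sd j : (j < N)%N ->
  energy R k j * prior_sd j ^+ 2 <=
  q * (tau * a) * (j.+2%:R ^+ k * M ^+ k - j.+2%:R ^+ (2 * k)).
Proof.
move=> jN; rewrite sd_sq// (le_trans (ler_wpM2r (ltW (sd_arg jN)) (energy_le R k j)))//.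
rewrite le_eqVlt; apply/orP; left; apply/eqP.
rewrite -aE /y expr_div_n [(2 * k)%N]mulnC !exprM.
by field; rewrite !expf_neq0 ?pnatr_eq0// gt_eqF.
Qed.

Let energy_sd_le j : (j < N)%N -> energy R k j * prior_sd j ^+ 2 <= r * C2 / M.
Proof.
move=> jN; apply: (le_trans (energy_sd jN)); apply: le_trans aM.
have ta0 : 0 <= tau * a by rewrite mulr_ge0// ltW.
have jM : j.+2%:R ^+ k <= M ^+ k by rewrite lerXn2r ?nnegrE ?ler0n ?(ltW M0)// ME ler_nat ltnW.
have jk0 : 0 <= j.+2%:R ^+ k :> R by rewrite exprn_ge0.
have -> : q * (tau * a) * (j.+2%:R ^+ k * M ^+ k - j.+2%:R ^+ (2 * k)) =
    q * (tau * a * (j.+2%:R ^+ k * M ^+ k - j.+2%:R ^+ (2 * k))) by rewrite !mulrA.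
rewrite (@le_trans _ _ (1 * (tau * a * M ^+ (2 * k))))//; last by rewrite mul1r.
apply: ler_pM => //; first exact: ltW.
  rewrite mulr_ge0// subr_ge0 [(2 * k)%N]mulnC exprM expr2 ler_wpM2l//.
rewrite ler_wpM2l// [(2 * k)%N]mulnC !exprM; move: jM jk0.
by set u := _ ^+ k; set v := M ^+ k; nra.
Qed.

Let sum_shift (f : nat -> R) : \sum_(i < N.+2) f i = f 0%N + (f 1%N + \sum_(j < N) f j.+2).
Proof. by rewrite big_ord_recl big_ord_recl. Qed.

(** The sum of i^k M^k - i^(2k) is at most M^(2k+1) k / ((k+1) (2k+1)) + M^(2k). Multiplied by tau
    a, the first term is at most r by the equation for [w], and [aM] bounds the second. *)
Let sum_energy_sd : \sum_(j < N) energy R k j * prior_sd j ^+ 2 <= q * r * (1 + C2 / M).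
Proof.
pose f i : R := i%:R ^+ k * M ^+ k - i%:R ^+ (2 * k).
apply: (@le_trans _ _ (q * (tau * a) * \sum_(j < N) f j.+2)).
  by rewrite mulr_sumr; apply: ler_sum => j _; exact: energy_sd.
rewrite -[_ * \sum_(j < N) _]mulrA -[_ * (1 + _)]mulrA ler_wpM2l ?(ltW q0)//.
have : \sum_(j < N) f j.+2 <= \sum_(i < N.+2) f i.
  have f0 : f 0%N = 0 by rewrite /f mulr0n !expr0n muln_eq0 (gtn_eqF k0)/= mul0r subrr.
  have f1 : 0 <= f 1%N by rewrite /f !expr1n mul1r subr_ge0 exprn_ege1// ME ler1n.
  by rewrite sum_shift f0 add0r lerDr.
have : \sum_(i < N.+2) f i <= M ^+ K * (k%:R / (k.+1%:R * K%:R)) + M ^+ (2 * k).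
  rewrite /f sumrB -mulr_suml.
  have := sum_pow_ge R (2 * k) N.+2; rewrite -ME.
  have := ler_wpM2r (exprn_ge0 k (ltW M0)) (sum_pow_le R k N.+2); rewrite -ME.
  have -> : M ^+ k.+1 / k.+1%:R * M ^+ k = M ^+ K / k.+1%:R.
    by rewrite mulrAC -exprD addSn addnn mul2n.
  have -> : M ^+ K * (k%:R / (k.+1%:R * K%:R)) = M ^+ K / k.+1%:R - M ^+ K / K%:R.
    have KE : K%:R = 2 * k%:R + 1 :> R by rewrite -natr1 natrM.
    have k1E : k.+1%:R = k%:R + 1 :> R by rewrite -natr1.
    have n1 : k%:R + 1 != 0 :> R by rewrite -k1E gt_eqF.
    have n2 : 2 * k%:R + 1 != 0 :> R by rewrite -KE gt_eqF.
    by rewrite KE k1E; move: n1 n2; move: (k%:R : R) (M ^+ K) => z v n1 n2; field; rewrite n1 n2.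
  by move: (M ^+ K / k.+1%:R) (M ^+ K / K%:R) => z1 z2; lra.
have ta0 : 0 <= tau * a by rewrite mulr_ge0// ltW.
move=> h1 h2; have := ler_wpM2l ta0 (le_trans h2 h1).
rewrite mulrDr; have := aM; rewrite -[r * C2 / M]mulrA => h3 h4.
apply: (le_trans h4); rewrite mulrDr mulr1 lerD//.
have -> : r = tau * a * (w ^+ K * (k%:R / (k.+1%:R * K%:R))).
  transitivity (w ^+ K * (k%:R * a * tau) / (k.+1%:R * K%:R)); last by ring.
  by rewrite wE; field; rewrite !gt_eqF.
have kK0 : 0 <= k%:R / (k.+1%:R * K%:R) :> R by rewrite divr_ge0// mulr_ge0.
by rewrite ler_wpM2l// ler_wpM2r// lerXn2r// nnegrE ltW.
Qed.

(** With z = ((j+2)/M)^k the Bayes risk of a coordinate is q tau (1 - z) / (q (1 - z) + z), whose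
    denominator is at most 1. Without the two missing indices, the 1 - z would sum to at least M k /
    (k+1). *)
Let bayes_sum : (q - 8 / M) * U <=
  \sum_(j < N) (prior_sd j ^+ 2 * tau) / (prior_sd j ^+ 2 + tau).
Proof.
apply: (@le_trans _ _ (q * tau * \sum_(j < N) (1 - y j.+2))); last first.
  rewrite mulr_sumr; apply: ler_sum => j _; rewrite sd_sq//.
  have [y0 y1] := @y_itv j.+2 isT (ltn_ord j); set z := y _ in y0 y1 *.
  have den0 : 0 < q * (1 - z) + z by rewrite addr_gt0// mulr_gt0// subr_gt0.
  have den1 : q * (1 - z) + z <= 1 by have := ler_wpM2r (_ : 0 <= 1 - z) q1; rewrite subr_ge0
    => /(_ (ltW y1)); lra.
  have -> : q * tau * (z^-1 - 1) * tau / (q * tau * (z^-1 - 1) + tau) =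
      q * tau * (1 - z) / (q * (1 - z) + z).
    have nz : q * tau * (z^-1 - 1) + tau != 0.
      rewrite gt_eqF// addr_gt0//; apply: mulr_gt0; first exact: mulr_gt0.
      by rewrite subr_gt0 invf_gt1.
    have -> : q * tau * (z^-1 - 1) + tau = tau * (q * (1 - z) + z) / z by field; rewrite gt_eqF.
    by field; rewrite !gt_eqF.
  have qt0 : 0 <= q * tau by rewrite mulr_ge0 ?ltW.
  by rewrite ler_pdivlMr// ler_piMr// mulr_ge0// subr_ge0 ltW.
have h1 : M - M / k.+1%:R - 2 <= \sum_(j < N) (1 - y j.+2).
  have : \sum_(i < N.+2) (1 - y i) <= 2 + \sum_(j < N) (1 - y j.+2).
    rewrite (sum_shift (fun i => 1 - y i)) addrA lerD2r.
    have yp i : 0 <= y i by rewrite exprn_ge0// divr_ge0// ltW.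
    by have := yp 0%N; have := yp 1%N; lra.
  rewrite sumrB sumr_const card_ord -ME.
  have : \sum_(i < N.+2) y i <= M / k.+1%:R.
    have -> : \sum_(i < N.+2) y i = (\sum_(i < N.+2) i%:R ^+ k) / M ^+ k.
      by rewrite mulr_suml; apply: eq_bigr => i _; rewrite /y expr_div_n.
    rewrite ler_pdivrMr ?exprn_gt0// mulrAC -exprS ME; exact: sum_pow_le.
  by move: (M / k.+1%:R) => z; lra.
have k1E : k.+1%:R = k%:R + 1 :> R by rewrite -natr1.
have k1 : 1 <= k%:R :> R by rewrite ler1n.
(* The 4 is 2 for the missing indices plus 2 for w - M <= 2. *)
have h2 : w * k%:R / k.+1%:R - 4 <= M - M / k.+1%:R - 2.
  have -> : M - M / k.+1%:R = M * k%:R / k.+1%:R by rewrite k1E; field; rewrite -k1E gt_eqF.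
  have : (w - M) * k%:R / k.+1%:R <= 2.
    rewrite ler_pdivrMr// k1E; have : w - M <= 2 by rewrite lerBlDl.
    have : 0 <= w - M by rewrite subr_ge0.
    nra.
  by rewrite !mulrBl; move: (w * _ / _) (M * _ / _) => u v; lra.
(* From M <= w and k / (k+1) >= 1/2, which give U >= tau M / 2. *)
have h3 : 4 * tau <= 8 / M * U.
  rewrite UE mulrAC ler_pdivlMr// mulrA ler_pdivlMr//.
  apply: (@le_trans _ _ (4 * tau * w * k.+1%:R)).
    by rewrite ler_pM2r// ler_wpM2l// mulr_ge0// ltW.
  have : 0 < tau * w by exact: mulr_gt0.
  rewrite k1E -!mulrA [tau * (w * (_ + _))]mulrA [tau * (w * _)]mulrA.
  by move: (tau * w) k1 => z; nra.
have h4 : q * tau * (w * k%:R / k.+1%:R - 4) <= q * tau * \sum_(j < N) (1 - y j.+2).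
  by apply: ler_wpM2l; [rewrite mulr_ge0// ltW|exact: le_trans h2 h1].
apply: le_trans h4.
have -> : q * tau * (w * k%:R / k.+1%:R - 4) = q * U - q * (4 * tau) by rewrite UE; ring.
by rewrite mulrBl lerD2l lerN2 (le_trans _ h3)// ler_piMl// mulr_ge0// ltW.
Qed.

Let t0 : 0 < t. Proof. by rewrite tE divr_gt0 ?mulr_gt0. Qed.

Let sd_small j : (j < N)%N -> 2 * t * (energy R k j * prior_sd j ^+ 2) <= delta.
Proof.
move=> jN; apply: (le_trans (ler_wpM2l _ (energy_sd_le jN))).
  by rewrite mulr_ge0// ltW.
rewrite le_eqVlt; apply/orP; left; apply/eqP; rewrite tE; field.
by rewrite !gt_eqF.
Qed.

(** Each factor is at most exp (t e_j / (1 - delta)), where e_j is the energy of the coordinate. As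
    q = (1 - delta)^2 and C2 / M <= delta / 2, the exponents sum to at most t r (1 - delta) (1 +
    delta/2) <= t r (1 - delta/2), and t r delta / 2 = c M. *)
Let product_le :
  expR (- (t * r)) *
    \prod_(j < N) (Num.sqrt (1 - 2 * t * (energy R k j * prior_sd j ^+ 2)))^-1 <=
  expR (- (c * M)).
Proof.
have d2 : 0 < 1 - delta by move: d1; lra.
apply: (@le_trans _ _ (expR (- (t * r)) *
    \prod_(j < N) expR (2 * t * (energy R k j * prior_sd j ^+ 2) / (2 * (1 - delta))))).
  rewrite ler_wpM2l ?expR_ge0//; apply: ler_prod => j _.
  rewrite invr_ge0 sqrtr_ge0/=; apply: inv_sqrt_le.
  - have e0 : 0 <= energy R k j by exact: le_trans ler01 (energy_ge1 _ _ _).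
    by rewrite mulr_ge0//; [rewrite mulr_ge0// ltW|rewrite mulr_ge0// sqr_ge0].
  - exact: sd_small.
  - by move: d1; lra.
rewrite -expR_sum -expRD ler_expR.
rewrite -mulr_suml -mulr_sumr; set X := \sum_(j < N) _.
have XE : X <= q * r * (1 + C2 / M) by exact: sum_energy_sd.
have CdM : C2 / M <= delta / 2 by rewrite ler_pdivrMr//; move: CM; lra.
have -> : 2 * t * X / (2 * (1 - delta)) = t / (1 - delta) * X by field; rewrite gt_eqF.
have h : t / (1 - delta) * X <= t * r * (1 - delta / 2).
  have td : 0 <= t / (1 - delta) by rewrite divr_ge0// ltW.
  apply: (le_trans (ler_wpM2l td XE)).
  have -> : t / (1 - delta) * (q * r * (1 + C2 / M)) = t * r * ((1 - delta) * (1 + C2 / M)).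
    have dn : 1 - delta != 0 by rewrite gt_eqF.
    by rewrite qE; move: (C2 / M) => z; field.
  have tr : 0 <= t * r by rewrite mulr_ge0// ltW.
  rewrite ler_wpM2l//.
  have := ler_wpM2l (ltW d2) CdM; move: d0; nra.
have -> : c * M = t * r * (delta / 2).
  by rewrite cE tE; field; rewrite !gt_eqF.
lra.
Qed.

(** [U] decays only like M^(-2k), so 1 is at most a constant times U M^(2k). The exponential of
    [product_le] absorbs the resulting power M^(2k+1) and one factor M more, which leaves a relative
    error of order 1/M. *)
Let remainder_le :
  (2 * N%:R + 2) * (r + t^-1) * expR (- (t * r)) *
    (\prod_(j < N) (Num.sqrt (1 - 2 * t * (energy R k j * prior_sd j ^+ 2)))^-1) <=
  2 * (r + 2 * C2 * r / delta) * (a * 3 ^+ (2 * k) / (r * K%:R)) * (K.+1%:R / c) ^+ K.+1 / M * U.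
Proof.
have c0 : 0 < c by rewrite cE divr_gt0 ?exprn_gt0 ?mulr_gt0.
have M1 : 1 <= M by rewrite ME ler1n.
have P0 : 0 <= (2 * N%:R + 2) * (r + t^-1).
  by apply: mulr_ge0; [rewrite addr_ge0// mulr_ge0|rewrite addr_ge0// ?invr_ge0 ltW].
rewrite -mulrA (le_trans (ler_wpM2l P0 product_le))//.
have rt : r + t^-1 <= r + 2 * C2 * r / delta.
  rewrite lerD2l tE invf_div ler_pM2l ?mulr_gt0// lef_pV2 ?posrE ?mulr_gt0//.
  by rewrite ler_peMr// ltW.
have NM : 2 * N%:R + 2 <= 2 * M.
  by rewrite ME -[N.+2%:R]natr1 -[N.+1%:R]natr1; lra.
have E := expR_pow_le K c0 M0.
have UwE : U * (a * w ^+ (2 * k)) = r * K%:R.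
  rewrite UE; transitivity (w ^+ K * (k%:R * a * tau) / k.+1%:R).
    by rewrite exprSr; move: (w ^+ (2 * k)) => z; field; rewrite gt_eqF.
  by rewrite wE; field; rewrite gt_eqF.
have one : 1 <= U * (a * 3 ^+ (2 * k) / (r * K%:R)) * M ^+ (2 * k).
  rewrite -UwE; have -> : U * (a * 3 ^+ (2 * k) / (U * (a * w ^+ (2 * k)))) * M ^+ (2 * k) =
    (3 * M) ^+ (2 * k) / w ^+ (2 * k).
    by rewrite exprMn; field; rewrite expf_neq0 !gt_eqF.
  rewrite ler_pdivlMr ?exprn_gt0// mul1r lerXn2r ?nnegrE ?(ltW w0) ?mulr_ge0 ?(ltW M0)//.
  by move: wM M1; lra.
set D := a * 3 ^+ (2 * k) / (r * K%:R) in one *.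
have D0 : 0 < D by rewrite divr_gt0 ?mulr_gt0 ?exprn_gt0.
set B := r + 2 * C2 * r / delta in rt *.
have B0 : 0 < B by rewrite addr_gt0 ?divr_gt0 ?mulr_gt0.
set e := expR _ in E *.
have e0 : 0 <= e by exact: expR_ge0.
clearbody D B e.
apply: (@le_trans _ _ (2 * M * B * e)).
  apply: ler_wpM2r => //; apply: ler_pM => //.
  by rewrite addr_ge0// ?invr_ge0 ltW.
have BM : 0 <= 2 * M * B * e by rewrite !mulr_ge0 ?(ltW M0) ?(ltW B0).
rewrite -[leLHS]mulr1; apply: (le_trans (ler_wpM2l BM one)).
have -> : 2 * M * B * e * (U * D * M ^+ (2 * k)) = 2 * B * D * U * (e * M ^+ K).
  by rewrite exprS; ring.
have BD : 0 <= 2 * B * D * U by rewrite !mulr_ge0 ?(ltW B0) ?(ltW D0) ?(ltW U0).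
apply: (le_trans (ler_wpM2l BD E)); rewrite le_eqVlt; apply/orP; left; apply/eqP.
by ring.
Qed.

Lemma lower_ratio_fixed : exists s : nat -> R, [/\ 0 < t,
  forall i, (i < N)%N -> 0 < s i /\ 2 * t * (energy R k i * s i ^+ 2) < 1 &
  (q - (8 + 2 * (r + 2 * C2 * r / delta) * (a * 3 ^+ (2 * k) / (r * K%:R)) *
      (K.+1%:R / c) ^+ K.+1) / M) * U <=
  \sum_(i < N) (s i ^+ 2 * tau) / (s i ^+ 2 + tau) -
  (2 * N%:R + 2) * (r + t^-1) * expR (- (t * r)) *
    \prod_(i < N) (Num.sqrt (1 - 2 * t * (energy R k i * s i ^+ 2)))^-1].
Proof.
exists prior_sd; split => //.
  move=> i iN; split; first by rewrite sqrtr_gt0 sd_arg.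
  by rewrite (le_lt_trans (sd_small iN))//; move: d1; lra.
have := bayes_sum; have := remainder_le.
set X := _ * (K.+1%:R / c) ^+ K.+1; set S1 := \sum_(i < N) _; set S2 := _ * \prod_(i < N) _ =>
  h1 h2.
have -> : (q - (8 + X) / M) * U = (q - 8 / M) * U - X / M * U by field; rewrite gt_eqF.
exact: lerB.
Qed.

End fixed.

Lemma lower_ratio : exists2 C : R, 0 <= C & forall (w tau : R) L, 0 < tau ->
  w ^+ K * (k%:R * pi ^+ (2 * k) * tau) = r * k.+1%:R * K%:R ->
  L.*2.+3%:R <= w -> w <= L.*2.+3%:R + 2 -> C <= L.*2.+3%:R ->
  exists (s : nat -> R) (t : R), [/\ 0 < t,
  forall i, (i < L.*2.+1)%N -> 0 < s i /\ 2 * t * (energy R k i * s i ^+ 2) < 1 &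
  ((1 - delta) ^+ 2 - C / L.*2.+3%:R) * (tau * w * k%:R / k.+1%:R) <=
  \sum_(i < L.*2.+1) (s i ^+ 2 * tau) / (s i ^+ 2 + tau) -
  (2 * (L.*2.+1)%:R + 2) * (r + t^-1) * expR (- (t * r)) *
    \prod_(i < L.*2.+1) (Num.sqrt (1 - 2 * t * (energy R k i * s i ^+ 2)))^-1].
Proof.
have a0 : 0 < (pi : R) ^+ (2 * k) by rewrite exprn_gt0// pi_gt0.
pose C2 : R := k.+1%:R * K%:R / k%:R.
have C20 : 0 < C2 by rewrite divr_gt0// mulr_gt0.
have q0 : 0 < (1 - delta) ^+ 2 by rewrite exprn_gt0// subr_gt0; move: d1 d0; lra.
have q1 : (1 - delta) ^+ 2 <= 1 by rewrite expr2; move: d1 d0; nra.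
pose D := 8 + 2 * (r + 2 * C2 * r / delta) * (pi ^+ (2 * k) * 3 ^+ (2 * k) / (r * K%:R)) *
      (K.+1%:R / (delta ^+ 2 / (4 * C2))) ^+ K.+1.
have h0 : 0 <= 2 * C2 / delta by rewrite divr_ge0 ?mulr_ge0 ?(ltW C20) ?(ltW d0).
have D0 : 0 <= D.
  have p1 : 0 <= r + 2 * C2 * r / delta.
    by rewrite addr_ge0 ?(ltW r0)// divr_ge0 ?(ltW d0)// mulr_ge0 ?(ltW r0)// mulr_ge0 ?(ltW C20).
  have p2 : 0 <= pi ^+ (2 * k) * 3 ^+ (2 * k) / (r * K%:R) :> R.
    by rewrite divr_ge0 ?(mulr_ge0 (ltW r0))// mulr_ge0 ?(ltW a0)// exprn_ge0.
  have p3 : 0 <= (K.+1%:R / (delta ^+ 2 / (4 * C2))) ^+ K.+1.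
    rewrite exprn_ge0// divr_ge0// divr_ge0 ?sqr_ge0// mulr_ge0// ltW//.
  by rewrite addr_ge0// mulr_ge0// mulr_ge0// mulr_ge0.
(* [D] collects the errors of relative order 1/M, and the second term ensures
   [2 * C2 <= delta * M]. *)
exists (D + 2 * C2 / delta); first exact: addr_ge0.
move=> w tau L tau0 wE Mw wM CM; set M : R := L.*2.+3%:R in Mw wM CM *.
have M0 : 0 < M by rewrite ltr0n.
have CM' : 2 * C2 <= delta * M.
  by rewrite -ler_pdivrMl// mulrC (le_trans _ CM)// lerDr.
have [s [t0 sP H]] := @lower_ratio_fixed _ C2 _ w tau M _ _ _ L erefl a0 erefl C20 erefl q0 q1
  erefl erefl erefl erefl tau0 wE Mw wM CM'.
exists s, (delta * M / (2 * C2 * r)); split => //.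
apply: le_trans H; rewrite -/D.
have w0 : 0 < w by exact: lt_le_trans Mw.
apply: ler_wpM2r; first by rewrite divr_ge0// !mulr_ge0// ltW.
by rewrite lerD2l lerN2 ler_pM2r ?invr_gt0// lerDl.
Qed.

End lower_ratio.

(** * Passage to the limit *)

Section asymptotics.
Context (R : realType).

Lemma limn_esup_bounded (u : nat -> R) : (limn_esup (fun n => (u n)%:E) < +oo)%E ->
  exists (B : R) N, 0 < B /\ forall n, (N <= n)%N -> u n <= B.
Proof.
move=> /ereal_inf_ltP[_ [V [N _ NV] <-]] h.
exists (Num.max 1 (fine (ereal_sup [set (u n)%:E | n in V]))), N; split.
  by rewrite lt_max ltr01.
move=> n Nn; rewrite le_max; apply/orP; right.
have un : ((u n)%:E <= ereal_sup [set (u n)%:E | n in V])%E.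
  by apply: ereal_sup_ubound; exists n => //; exact: NV.
rewrite -lee_fin fineK//; apply: fin_real.
by rewrite h andbT (lt_le_trans _ un)// ltNyr.
Qed.

Lemma cvge_approx (u : nat -> \bar R) (x : R) :
  (forall e : R, 0 < e -> exists N, forall n, (N <= n)%N ->
    ((x - e)%:E <= u n <= (x + e)%:E)%E) -> u n @[n --> \oo] --> x%:E.
Proof.
move=> H; have fin n e : ((x - e)%:E <= u n <= (x + e)%:E)%E -> u n \is a fin_num.
  by move=> /andP[h1 h2]; rewrite fin_real// (lt_le_trans _ h1) ?ltNyr//= (le_lt_trans h2)// ltry.
apply/fine_cvgP; split.
  by have [N HN] := H 1 ltr01; exists N => // n /= Nn; exact: fin (HN n Nn).
apply/cvgrPdist_le => /= e e0; have [N HN] := H e e0.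
exists N => // n /= Nn; have h := HN n Nn; have fn := fin _ _ h.
move: h; rewrite -{1 2}[u n]fineK// !lee_fin => /andP[h1 h2].
by rewrite ler_norml; lra.
Qed.

Section rate.
Variables (k : nat) (r : R).
Hypotheses (k0 : (0 < k)%N) (r0 : 0 < r).
Local Notation K := (2 * k).+1.

Let kR0 : 0 < k%:R :> R. Proof. by rewrite ltr0n. Qed.
Let k10 : 0 < k.+1%:R :> R. Proof. by rewrite ltr0n. Qed.
Let KR0 : 0 < K%:R :> R. Proof. by rewrite ltr0n. Qed.

Lemma powR_exp (x z : R) p (q : R) : 0 <= x -> z * p%:R = q -> (x `^ z) ^+ p = x `^ q.
Proof. by move=> x0 <-; rewrite -powR_mulrn ?powR_ge0// powRrM. Qed.

(* Chosen so that [r / (pi w)^(2k) + tau * \int_0^w (1 - (x / w)^k)^2 dx] is equal to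
   [tau w k / (k + 1)], which is the sharp rate. *)
Definition bandwidth (tau : R) : R :=
  (r * k.+1%:R * K%:R / (k%:R * pi ^+ (2 * k) * tau)) `^ K%:R^-1.

Lemma bandwidthE (tau : R) : 0 < tau ->
  bandwidth tau ^+ K = r * k.+1%:R * K%:R / (k%:R * pi ^+ (2 * k) * tau).
Proof.
move=> tau0; have p0 : 0 < pi ^+ (2 * k) :> R by rewrite exprn_gt0// pi_gt0.
have d0 : 0 < r * k.+1%:R * K%:R / (k%:R * pi ^+ (2 * k) * tau).
  by rewrite divr_gt0// !mulr_gt0.
by rewrite /bandwidth (powR_exp (q := 1)) ?ltW// ?powRr1 ?ltW// mulVf// gt_eqF.
Qed.

Lemma bandwidth_gt0 (tau : R) : 0 < tau -> 0 < bandwidth tau.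
Proof.
move=> tau0; have p0 : 0 < pi ^+ (2 * k) :> R by rewrite exprn_gt0// pi_gt0.
by rewrite powR_gt0// divr_gt0// !mulr_gt0.
Qed.

(** Both sides are nonnegative and are compared through their (2k+1)-th powers, where all real
    exponents become integers. *)
Lemma pinsker_scale n (sigma : R) : (0 < n)%N -> 0 < sigma ->
  n%:R `^ rate_exponent R k * (pinsker_constant k r sigma)^-1 =
  (sigma / n%:R * bandwidth (sigma / n%:R) * k%:R / k.+1%:R)^-1.
Proof.
move=> n0 s0; have nR0 : 0 < n%:R :> R by rewrite ltr0n.
have p0 : 0 < pi ^+ (2 * k) :> R by rewrite exprn_gt0// pi_gt0.
have tau0 : 0 < sigma / n%:R by rewrite divr_gt0.
have w0 := bandwidth_gt0 tau0.
have P0 : 0 <= pinsker_constant k r sigma by rewrite mulr_ge0 ?powR_ge0.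
apply/eqP; rewrite -(@eqrXn2 _ K)//; last 2 first.
- by rewrite mulr_ge0 ?powR_ge0 ?invr_ge0.
- rewrite invr_ge0; apply/ltW; exact: divr_gt0 (mulr_gt0 (mulr_gt0 tau0 w0) kR0) k10.
have rateK : rate_exponent R k * K%:R = (2 * k)%:R.
  by rewrite /rate_exponent addn1 divfK// gt_eqF.
apply/eqP; rewrite exprMn !exprVn (powR_exp (ltW nR0) rateK) powR_mulrn ?(ltW nR0)//.
have x0 : 0 < sigma * k%:R / ((k + 1)%:R * pi).
  by rewrite divr_gt0 ?mulr_gt0// ?pi_gt0// addn1.
rewrite /pinsker_constant addn1 exprMn (powR_exp (q := 1)); last 2 first.
- by rewrite mulr_ge0 ?ltW.
- by rewrite mulVf// gt_eqF.
rewrite powRr1 ?mulr_ge0 ?(ltW r0)// (powR_exp (ltW x0) rateK) powR_mulrn ?(ltW x0)//.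
rewrite addn1 !(exprMn, exprVn) bandwidthE// !exprS.
have : (pi : R) ^+ (2 * k) != 0 by rewrite gt_eqF.
have : n%:R ^+ (2 * k) != 0 :> R by rewrite expf_neq0// gt_eqF.
have : sigma ^+ (2 * k) != 0 by rewrite expf_neq0// gt_eqF.
have : k%:R ^+ (2 * k) != 0 :> R by rewrite expf_neq0// gt_eqF.
have : k.+1%:R ^+ (2 * k) != 0 :> R by rewrite expf_neq0// gt_eqF.
have : k.+1%:R != 0 :> R by rewrite gt_eqF.
have : K%:R != 0 :> R by rewrite gt_eqF.
have : k%:R != 0 :> R by rewrite gt_eqF.
have : n%:R != 0 :> R by rewrite gt_eqF.
have : sigma != 0 by rewrite gt_eqF.
have : r != 0 by rewrite gt_eqF.
move: (pi ^+ _ : R) (n%:R ^+ _ : R) (sigma ^+ _) (k%:R ^+ _ : R) (k.+1%:R ^+ _ : R)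
  => x1 x2 x3 x4 x5.
move: (k.+1%:R : R) (K%:R : R) (k%:R : R) (n%:R : R) => y1 y2 y3 y4 z1 z2 z3 z4 z5 z6 z7 z8 z9
  z10 z11.
by field; rewrite ?z1 ?z2 ?z3 ?z4 ?z5 ?z6 ?z7 ?z8 ?z9 ?z10 ?z11.
Qed.

(** The induction proves the bound by the chord over [0, 1], of slope 2^p - 1. *)
Lemma exp_le_linear (x : R) p : 0 <= x <= 1 -> (1 + x) ^+ p <= 1 + 2 ^+ p * x.
Proof.
move=> /andP[x0 x1]; suff : (1 + x) ^+ p <= 1 + (2 ^+ p - 1) * x by rewrite mulrBl; lra.
elim: p => [|p IH]; first by rewrite !expr0 subrr mul0r addr0.
rewrite exprSr; apply: (le_trans (ler_wpM2r _ IH)); first by rewrite addr_ge0.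
have : 1 <= 2 ^+ p :> R by rewrite exprn_ege1// ler1n.
rewrite exprS; move: {IH} (2 ^+ p : R) => y y1.
have := mulr_ge0 (mulr_ge0 (_ : 0 <= y - 1) x0) (_ : 0 <= 1 - x).
by rewrite !subr_ge0 => /(_ y1 x1); lra.
Qed.

Lemma upper_rate n (sigma : R) Qs :
  (0 < n)%N -> 0 < sigma -> Qs `<=` noise_class sigma n -> 2 <= bandwidth (sigma / n%:R) ->
  ((n%:R `^ rate_exponent R k * (pinsker_constant k r sigma)^-1)%:E * minimax_risk k r n Qs <=
   (1 + (2 ^+ (2 * k) * 2 / K%:R + 2 * k.+1%:R / k%:R) / bandwidth (sigma / n%:R))%:E)%E.
Proof.
move=> n0 s0 QsP; rewrite pinsker_scale//.
have tau0 : 0 < sigma / n%:R by rewrite divr_gt0// ltr0n.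
have p0 : 0 < pi ^+ (2 * k) :> R by rewrite exprn_gt0// pi_gt0.
have := bandwidthE tau0; set w := bandwidth _; set tau := sigma / n%:R => wE w2.
have w0 : 0 < w by exact: lt_le_trans w2.
pose m := Num.truncn w.
have /andP[mw wm] : m%:R <= w < m.+1%:R by apply: truncn_itv; exact: ltW.
have M1 : w / 2 <= m%:R by move: wm; rewrite -natr1; lra.
have M0 : 0 < m%:R :> R by lra.
have m0 : (0 < m)%N by rewrite -(ltr0n R).
have wE' : w ^+ K * (k%:R * pi ^+ (2 * k) * tau) = r * k.+1%:R * K%:R.
  by rewrite wE divfK// gt_eqF//; exact: mulr_gt0 (mulr_gt0 kR0 p0) tau0.
have U0 : 0 < tau * w * k%:R / k.+1%:R by exact: divr_gt0 (mulr_gt0 (mulr_gt0 tau0 w0) kR0) k10.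
have := upper_ratio k0 tau0 w0 m0 mw wE' => H.
have H2 := le_trans (minimax_upper r k0 n0 m0 s0 QsP) (etrans (lee_fin _ _) H).
have Ui0 : 0 <= (tau * w * k%:R / k.+1%:R)^-1 by rewrite invr_ge0 ltW.
apply: (le_trans (lee_wpmul2l _ H2)); first by rewrite lee_fin.
rewrite -EFinM lee_fin mulrA mulVf ?gt_eqF// mul1r.
have wm1 : w / m%:R <= 1 + 2 / w.
  rewrite ler_pdivrMr// mulrDl mul1r.
  have : 1 <= 2 / w * m%:R by rewrite mulrAC ler_pdivlMr//; lra.
  by move: wm; rewrite -natr1; move: (2 / w * m%:R) => z; lra.
have x01 : 0 <= 2 / w <= 1 by rewrite divr_ge0 ?(ltW w0)//= ler_pdivrMr// mul1r.
have wm2 : (w / m%:R) ^+ (2 * k) <= 1 + 2 ^+ (2 * k) * (2 / w).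
  apply: le_trans (exp_le_linear _ x01); rewrite lerXn2r// nnegrE.
    by rewrite divr_ge0// ltW.
  by rewrite addr_ge0//; case/andP: x01.
apply: (@le_trans _ _ ((1 + 2 ^+ (2 * k) * (2 / w)) / K%:R + (2 * k)%:R / K%:R + 2 * k.+1%:R /
  (k%:R * w))).
  by rewrite !lerD2r ler_pM2r ?invr_gt0.
rewrite le_eqVlt; apply/orP; left; apply/eqP.
have KE : (2 * k)%:R = K%:R - 1 :> R by rewrite -natr1 addrK.
rewrite KE; have := KR0; have := kR0; move: (K%:R : R) (k%:R : R) => y1 y2 h1 h2.
by field; rewrite !gt_eqF.
Qed.

(** [C] depends on [delta], k and r alone, so that n can tend to infinity while [delta] is fixed. *)
Lemma lower_rate (delta : R) : 0 < delta -> delta <= 2^-1 -> exists2 C : R, 0 <= C &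
  forall n (sigma : R) Qs Q, (0 < n)%N -> 0 < sigma -> Qs Q -> brownian_noise sigma Q ->
  C + 3 <= bandwidth (sigma / n%:R) ->
  (((1 - delta) ^+ 2 - C / (bandwidth (sigma / n%:R) - 2))%:E <=
   (n%:R `^ rate_exponent R k * (pinsker_constant k r sigma)^-1)%:E * minimax_risk k r n Qs)%E.
Proof.
move=> d0 d1; have [C C0 HC] := lower_ratio k0 r0 d0 d1; exists C => //.
move=> n sigma Qs Q n0 s0 QsQ hQ; rewrite pinsker_scale//.
have tau0 : 0 < sigma / n%:R by rewrite divr_gt0// ltr0n.
have p0 : 0 < pi ^+ (2 * k) :> R by rewrite exprn_gt0// pi_gt0.
have := bandwidthE tau0; set w := bandwidth _; set tau := sigma / n%:R => wE w3.
have w0 : 0 < w by lra.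
(* The bandwidth M = 2L + 3 is odd, since the prior charges L full pairs and the constant; this L
   gives w - 2 < M <= w. *)
pose L := Num.truncn ((w - 3) / 2).
have /andP[Lw wL] : L%:R <= (w - 3) / 2 < L.+1%:R by apply: truncn_itv; lra.
have ME : L.*2.+3%:R = 2 * L%:R + 3 :> R.
  by rewrite -[L.*2.+3]addn3 natrD -mul2n natrM.
have Mw : L.*2.+3%:R <= w by rewrite ME; lra.
have wM : w <= L.*2.+3%:R + 2 by rewrite ME; move: wL; rewrite -natr1; lra.
have CM : C <= L.*2.+3%:R by lra.
have wE' : w ^+ K * (k%:R * pi ^+ (2 * k) * tau) = r * k.+1%:R * K%:R.
  by rewrite wE divfK// gt_eqF//; exact: mulr_gt0 (mulr_gt0 kR0 p0) tau0.
have U0 : 0 < tau * w * k%:R / k.+1%:R by exact: divr_gt0 (mulr_gt0 (mulr_gt0 tau0 w0) kR0) k10.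
have [s [t [t0 Hs H]]] := HC w tau L tau0 wE' Mw wM CM.
have := minimax_lower n0 r0 s0 QsQ hQ t0 Hs; rewrite -leeBlDr// -EFinB => H2.
have H3 : ((((1 - delta) ^+ 2 - C / L.*2.+3%:R) * (tau * w * k%:R / k.+1%:R))%:E <=
  minimax_risk k r n Qs)%E.
  by apply: le_trans H2; rewrite lee_fin.
have Ui0 : 0 <= (tau * w * k%:R / k.+1%:R)^-1 by rewrite invr_ge0 ltW.
apply: (le_trans _ (lee_wpmul2l _ H3)); last by rewrite lee_fin.
rewrite -EFinM lee_fin mulrCA mulVf ?gt_eqF// mulr1 lerD2l lerN2 ler_wpM2l//.
by rewrite lef_pV2 ?posrE ?ltr0n//; lra.
Qed.

(** The (2k+1)-th power of the bandwidth is a constant times n / sigma_n, and sigma_n is eventually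
    bounded. *)
Lemma bandwidth_large (sigma : nat -> R) (A : R) : (forall n, (0 < n)%N -> 0 < sigma n) ->
  (limn_esup (fun n => (sigma n)%:E) < +oo)%E -> 0 < A ->
  exists N, forall n, (N <= n)%N -> (0 < n)%N /\ A <= bandwidth (sigma n / n%:R).
Proof.
move=> s0 /limn_esup_bounded[B [N [B0 HB]]] A0.
have p0 : 0 < pi ^+ (2 * k) :> R by rewrite exprn_gt0// pi_gt0.
pose D := r * k.+1%:R * K%:R / (k%:R * pi ^+ (2 * k)).
have D0 : 0 < D by rewrite divr_gt0// !mulr_gt0.
pose N1 := (Num.truncn (A ^+ K * B / D)).+1.
exists (maxn N N1) => n; rewrite geq_max => /andP[Nn N1n].
have n0 : (0 < n)%N by exact: leq_trans N1n.
have nR0 : 0 < n%:R :> R by rewrite ltr0n.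
split => //; have tau0 : 0 < sigma n / n%:R by rewrite divr_gt0// s0.
rewrite -(@ler_pXn2r _ K)// ?nnegrE ?(ltW A0)// ?(ltW (bandwidth_gt0 tau0))// bandwidthE//.
have -> : r * k.+1%:R * K%:R / (k%:R * pi ^+ (2 * k) * (sigma n / n%:R)) = D * n%:R / sigma n.
  by rewrite /D; field; rewrite !gt_eqF ?s0.
rewrite ler_pdivlMr ?s0//.
apply: (@le_trans _ _ (A ^+ K * B)).
  by apply: ler_wpM2l; [rewrite exprn_ge0// ltW|exact: HB].
rewrite [D * _]mulrC -ler_pdivrMr//; apply: ltW; apply: (lt_le_trans (truncnS_gt _)).
by rewrite ler_nat.
Qed.

End rate.
End asymptotics.

Theorem corollary3p3 (R : realType) (k : nat) (r : R)
    (sigma l : nat -> R)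
    (Qstar : nat -> set (probability (skorohod R) R))
    (Q0 : nat -> probability (skorohod R) R) :
  (0 < k)%N -> 0 < r ->
  (forall n, (0 < n)%N -> 0 < sigma n) ->
  (0 < limn_einf (fun n => (sigma n)%:E))%E ->
  (limn_esup (fun n => (sigma n)%:E) < +oo)%E ->
  (forall n, (0 < n)%N -> 0 < l n) ->
  (forall n m, (0 < n)%N -> (n <= m)%N -> l n <= l m) ->
  l n @[n --> \oo] --> +oo ->
  (forall delta : R, 0 < delta -> l n / n%:R `^ delta @[n --> \oo] --> 0) ->
  (forall n, (0 < n)%N -> brownian_noise (sigma n) (Q0 n)) ->
  (forall n, (0 < n)%N ->
    Qstar n `<=` restricted_noise_class (sigma n) (l n) n) ->
  (forall n, (0 < n)%N -> Qstar n (Q0 n)) ->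
  ((n%:R `^ rate_exponent R k * (pinsker_constant k r (sigma n))^-1)%:E
     * minimax_risk k r n (Qstar n))%E @[n --> \oo] --> 1%E.
Proof.
move=> k0 r0 s0 _ sB _ _ _ _ hQ0 QsP QsQ0; apply: cvge_approx => e e0.
have s0n n : (0 < n)%N -> 0 < sigma n by exact: s0.
(* Half of [e] covers 1 - (1 - delta)^2 <= 2 delta, the other half C / (w - 2). *)
pose delta := Order.min (e / 4) 2^-1.
have d0 : 0 < delta by rewrite lt_min divr_gt0//= invr_gt0.
have d1 : delta <= 2^-1 by rewrite ge_min lexx orbT.
have de : delta <= e / 4 by rewrite ge_min lexx.
have [C C0 HC] := lower_rate k0 r0 d0 d1.
pose D : R := 2 ^+ (2 * k) * 2 / (2 * k).+1%:R + 2 * k.+1%:R / k%:R.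
have D0 : 0 <= D by rewrite addr_ge0// divr_ge0// mulr_ge0// exprn_ge0.
(* The terms ensure the conditions of [lower_rate] and [upper_rate], then C / (w - 2) <= e / 2, then
   D / w <= e. *)
pose A := C + 3 + 2 * C / e + D / e.
have Ce : 0 <= 2 * C / e by rewrite divr_ge0 ?(ltW e0)// mulr_ge0.
have De : 0 <= D / e by rewrite divr_ge0 ?(ltW e0).
have A0 : 0 < A by rewrite /A; lra.
have [N HN] := bandwidth_large k0 r0 s0n sB A0.
exists N => n Nn; have [n0 Aw] := HN n Nn.
set w := bandwidth _ _ _ in Aw.
have QsP' : Qstar n `<=` noise_class (sigma n) n by move=> Q /(QsP n n0)[].
have w0 : 0 < w - 2 by move: Aw; rewrite /A; lra.
apply/andP; split.
  apply: le_trans (HC n (sigma n) (Qstar n) (Q0 n) n0 (s0 n n0) (QsQ0 n n0) (hQ0 n n0) _).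
    rewrite lee_fin -/w.
    have : C / (w - 2) <= e / 2.
      rewrite ler_pdivrMr//; have : 2 * C / e <= w - 2 by move: Aw; rewrite /A; lra.
      by rewrite ler_pdivrMr//; lra.
    by move: (C / (w - 2)) => z; nra.
  by move: Aw; rewrite /A -/w; lra.
apply: le_trans (upper_rate k0 r0 n0 (s0 n n0) QsP' _) _.
  by move: Aw; rewrite /A -/w; lra.
rewrite lee_fin -/w -/D lerD2l.
have w1 : 0 < w by lra.
rewrite ler_pdivrMr//; have : D / e <= w by move: Aw; rewrite /A; lra.
by rewrite ler_pdivrMr// mulrC.
Qed.
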